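(* Fix $k\in\mathbb{Z}_{\ge1}$. For $n>k$ let $(s_1,\dots,s_N)$ be a uniformly random element of $\Omega_n$, $N=\binom n2$, and let $$\mathbf{T}_{FS,n}(k)=\min\{t\ge 1:\ s_t=k\}$$ be the first occurrence time of the swap $(k,k+1)$. Then, as $n\to\infty$, $$\frac{\mathbf{T}_{FS,n}(k)}{n^{3/2}}\longrightarrow \frac12\,\mathbf{T}_{FS}(k)\quad\text{in distribution},$$ where $\mathbf{T}_{FS}(k)$ is the smallest positive eigenvalue of a $2k\times 2k$ aGUE matrix.
   Context: For $n\ge2$ and $1\le k\le n-1$ let $\tau_k\in\mathfrak S_n$ be the adjacent transposition $(k,k+1)$, acting on one-row notation by $(a_1\dots a_n)\cdot\tau_k=(a_1\dots a_{k-1}\,a_{k+1}\,a_k\,a_{k+2}\dots a_n)$. A sorting network of size $n$ is a sequence $(s_1,\dots,s_N)$, $N=\binom n2$, $s_i\in\{1,\dots,n-1\}$, with $\tau_{s_1}\tau_{s_2}\cdots\tau_{s_N}=(n\ n-1\ \dots\ 2\ 1)$ (the reverse permutation); $\Omega_n$ denotes the (finite) set of all sorting networks of size $n$. For $\ell\ge1$, an $\ell\times\ell$ aGUE matrix is $M_\ell=\frac{\mathbf i}{2}(Y-Y^T)$ where $Y$ is an $\ell\times\ell$ matrix of i.i.d. standard Gaussian $N(0,1)$ entries; its eigenvalues are real and symmetric about $0$, and for even $\ell$ zero is almost surely not an eigenvalue. *)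

(* Defs.v *)
From HB Require Import structures.
From mathcomp Require Import all_boot all_order all_algebra.
From mathcomp Require Import complex.
From mathcomp Require Import all_classical all_reals all_analysis.
Set Implicit Arguments. Unset Strict Implicit. Unset Printing Implicit Defensive.
Import Order.TTheory GRing.Theory Num.Theory.
Local Open Scope ring_scope.

(* Right action of the adjacent transposition tau_k (1 <= k <= n-1) on a
   permutation in one-row notation a = (a_1 ... a_n): the entries at
   (1-indexed) positions k and k+1 are exchanged.  Lists are 0-indexed,
   so these are list indices k-1 and k. *)
Definition swap_at (a : seq nat) (k : nat) : seq nat :=
  [seq nth 0%N a (if i == k.-1 then k else if i == k then k.-1 else i)
  | i <- iota 0 (size a)].

Definition apply_swaps (n : nat) (s : seq nat) : seq nat :=
  foldl swap_at (iota 1 n) s.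

(* Omega_n : sequences (s_1,...,s_N), N = binom n 2, s_i in {1,...,n-1},
   whose product of adjacent transpositions is the reverse permutation.
   Values are stored in 'I_n (so s_i <= n-1) and s_i >= 1 is imposed. *)
Definition Omega (n : nat) : {set 'C(n, 2).-tuple 'I_n} :=
  [set s : 'C(n, 2).-tuple 'I_n | all (fun x : 'I_n => 0 < x)%N s &&
           (apply_swaps n (map val s) == rev (iota 1 n))].

(* T_{FS,n}(k)(s) = min { t >= 1 : s_t = k }  (1-indexed first occurrence). *)
Definition first_swap_time (n k : nat) (s : 'C(n, 2).-tuple 'I_n) : nat :=
  (index k (map val s)).+1.

Definition TFSn_cdf (R : realType) (k n : nat) (x : R) : R :=
  #|[set s in Omega n | (first_swap_time k s)%:R / (n%:R `^ (3/2 : R)) <= x]|%:R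
  / #|Omega n|%:R.

Definition aGUE (R : realType) (l : nat) (Y : 'M[R]_l) : 'M[R[i]]_l :=
  \matrix_(a, b) (('i%C / 2) * ((Y a b)%:C%C - (Y b a)%:C%C)).

(* Smallest positive eigenvalue of the aGUE matrix built from Y (infimum of
   the set of positive real eigenvalues; that set is a.s. finite and nonempty). *)
Definition smallest_pos_eig (R : realType) (l : nat) (Y : 'M[R]_l) : R :=
  inf [set mu : R | 0 < mu /\ eigenvalue (aGUE Y) (mu%:C%C)].

(* Law of i.i.d. standard Gaussians: iterated integral against N(0,1)
   of a function of the first m coordinates of a vector v : nat -> R
   (coordinates m-1, ..., 0 are integrated, outermost first). *)
Fixpoint gauss_iter (R : realType) (m : nat) (f : (nat -> R) -> \bar R) : \bar R :=
  match m with
  | 0%N => f (fun _ => 0)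
  | m'.+1 => (\int[@normal_prob R 0 1]_y
               gauss_iter m' (fun v => f (fun i => if i == m' then y else v i)))%E
  end.

Definition mx_of_vec (R : realType) (l : nat) (v : nat -> R) : 'M[R]_l :=
  \matrix_(a, b) v (a * l + b)%N.

Definition gauss_mx_prob (R : realType) (l : nat) (P : 'M[R]_l -> Prop) : \bar R :=
  gauss_iter (l * l)%N (fun v => (\1_[set v | P (mx_of_vec l v)] v)%:E).

Definition half_TFS_cdf (R : realType) (k : nat) (x : R) : \bar R :=
  gauss_mx_prob (fun Y : 'M[R]_(2 * k) => smallest_pos_eig Y / 2 <= x).

(* Main.v *)
(** Write N = 'C(n, 2), n = k + m, and let Cnt q be the number of sorting networks whose first
    swap k occurs after time q.  Divided differences applied to a staircase product give a
    generating function for sorting networks; restricting it to words that avoid the letter k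
    yields an exact formula

      sum_q 'C(N, q) t^q (1 - t)^(N - q) Cnt q = C det [int_t^1 u^(2(c + d)) (1 - u^2)^(m - k) du]

    with c, d < k.  At t = x / sqrt (2 n) the right-hand side, divided by its value at t = 0,
    tends to the ratio of Hankel determinants of the moments of g^2 / 2 on {|g| > x}, g standard
    normal; since Binomial(N, t) concentrates, this is also the limit of the tail of the first
    swap time at the scale n^(3/2).

    By Andreief's identity the same ratio is the probability that k Gaussians weighted by the
    squared Vandermonde determinant of the g_i^2 / 2 all exceed x in absolute value.  To compare it
    with the squared eigenvalues of the aGUE matrix no density is computed: integration by parts
    shows that the moments of the power sums P_a satisfy the same recursion for both models, even
    after tilting by exp (- s P_1).  The tilted moments therefore agree; they determine the
    expectations of products of the sums of exp (- m y_j), hence, through Bernstein polynomials,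
    the probability that no y_j lies in [0, c]. *)

Require Import Defs.
From HB Require Import structures.
From mathcomp Require Import all_boot all_order all_algebra all_fingroup.
From mathcomp Require Import boolp zify ring lra.
Set Implicit Arguments. Unset Strict Implicit. Unset Printing Implicit Defensive.
Import Order.TTheory GRing.Theory Num.Theory.
Local Open Scope ring_scope.

(** * Divided differences and the counting formula *)

(** The count is a linear evolution. Summing divided differences over an alphabet gives an operator
    U on functionals of exponents, and words whose first q letters avoid k are read off from exp(b
    U_k) exp(a U_0). Both exponentials are determinants with rows that are lowered by
    differentiation: antisymmetry collapses a divided difference to the lowering of one row, so the
    sum over the letters is d/db. To forbid k, the Taylor sums in the first k rows are cut off
    exactly where that letter would act. At a + b = 1 the other rows are constant, and the evenness
    of (1 - u^2)^(m - k) u^(2 d) provides vectors that they annihilate; this leaves a k by k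
    determinant.

    In the comparison with aGUE the power series of exp(- m y) cannot be integrated term by term,
    because exp(m y) is not integrable for y = g^2 / 2 and m >= 1. The tilt turns it into exp(- m
    P_1) exp(m (P_1 - y)), whose partial sums lie between 0 and 1. The price is an unknown mass of
    each tilted law, which has to be recovered separately. *)

Definition upd2 (e : nat -> nat) (i a b : nat) : nat -> nat :=
  fun p => if p == i then a else if p == i.+1 then b else e p.

(** The transpose of the divided difference. [F] stands for the linear functional whose value at the
    monomial x^e is [F e], and [dd i F e] is its value at (x^e - s_i x^e) / (x_i - x_(i+1)), written
    out as a signed sum of monomials. *)
Definition dd (V : zmodType) (i : nat) (F : (nat -> nat) -> V) (e : nat -> nat) : V :=
  if (e i.+1 <= e i)%N
  then \sum_(r < e i - e i.+1) F (upd2 e i (e i - r.+1) (e i.+1 + r))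
  else - \sum_(r < e i.+1 - e i) F (upd2 e i (e i.+1 - r.+1) (e i + r)).

(** As [dd] acts on functionals, the outermost operator, that of the first letter, reaches the
    monomial first: x^e meets the letters in reading order. *)
Definition ddw (V : zmodType) (s : seq nat) (F : (nat -> nat) -> V) :=
  foldr (@dd V) F s.

Definition edeg (n : nat) (e : nat -> nat) : nat := \sum_(p < n) e p.

Definition swapf (T : Type) (i : nat) (x : nat -> T) : nat -> T :=
  fun p => x (if p == i then i.+1 else if p == i.+1 then i else p).

Lemma edeg_upd2 n e i a b : (i.+1 < n)%N ->
  (edeg n (upd2 e i a b) + (e i + e i.+1) = edeg n e + (a + b))%N.
Proof.
move=> hi; rewrite /edeg.
have hi' : (i < n)%N by lia.
rewrite (bigD1 (Ordinal hi')) //= (bigD1 (Ordinal hi)) /=; last first.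
  by rewrite -val_eqE /=; lia.
rewrite [in RHS](bigD1 (Ordinal hi')) //= [in RHS](bigD1 (Ordinal hi)) /=; last first.
  by rewrite -val_eqE /=; lia.
rewrite {1 2}/upd2 eqxx.
have -> : (i.+1 == i) = false by lia.
rewrite eqxx.
set s1 := (\sum_(_ < n | _) _)%N; set s2 := (\sum_(_ < n | _) _)%N.
have -> : s1 = s2; last by lia.
apply: eq_bigr => p /andP[]; rewrite -!val_eqE /= => h1 h2.
by rewrite /upd2 (negbTE h1) (negbTE h2).
Qed.

Section ddV.
Variable V : zmodType.
Implicit Types F G : (nat -> nat) -> V.

Lemma dd_deg n d i F G : (i.+1 < n)%N ->
  (forall e, edeg n e = d -> F e = G e) ->
  forall e, edeg n e = d.+1 -> dd i F e = dd i G e.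
Proof.
move=> hi FG e he; rewrite /dd; case: leqP => h.
  apply: eq_bigr => r _; apply: FG.
  have := edeg_upd2 e (e i - r.+1) (e i.+1 + r) hi.
  by have := ltn_ord r; lia.
congr (- _); apply: eq_bigr => r _; apply: FG.
have := edeg_upd2 e (e i.+1 - r.+1) (e i + r) hi.
by have := ltn_ord r; lia.
Qed.

Lemma edeg0 n e i : edeg n e = 0%N -> (i < n)%N -> e i = 0%N.
Proof.
move=> /eqP; rewrite /edeg sum_nat_eq0 => /forallP h hi.
by have /eqP := h (Ordinal hi).
Qed.

Lemma dd_deg0 n i F e : (i.+1 < n)%N -> edeg n e = 0%N -> dd i F e = 0.
Proof.
move=> hi he; rewrite /dd (edeg0 he hi) (edeg0 he (ltnW hi)) /=.
by rewrite big_ord0.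
Qed.

Lemma ddw_deg n d s F G : all (fun i => i.+1 < n)%N s ->
  (forall e, edeg n e = d -> F e = G e) ->
  forall e, edeg n e = (size s + d)%N -> ddw s F e = ddw s G e.
Proof.
move=> + FG; elim: s => [|i s IH] /=; first by move=> _ e; apply: FG.
by move=> /andP[hi hs]; apply: dd_deg => //; exact: IH.
Qed.

(** Each letter lowers the degree by one, and a constant is annihilated. *)
Lemma ddw_small n s F e : all (fun i => i.+1 < n)%N s ->
  (edeg n e < size s)%N -> ddw s F e = 0.
Proof.
elim: s e => [|i s IH] //= e /andP[hi hs] he.
case: (posnP (edeg n e)) => [/dd_deg0->//|e0].
transitivity (dd i (fun _ => 0 : V) e); last first.
  by rewrite /dd !big1_eq oppr0 if_same.
apply: (@dd_deg n (edeg n e).-1) => //; last by lia.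
by move=> e' he'; apply: IH => //; lia.
Qed.

Lemma ddB i F G : dd i (fun e => F e - G e) = fun e => dd i F e - dd i G e.
Proof.
apply/funext => e; rewrite /dd; case: leqP => _; rewrite sumrB //.
by rewrite opprB opprK addrC.
Qed.

Lemma ddwB s F G : ddw s (fun e => F e - G e) = fun e => ddw s F e - ddw s G e.
Proof. by elim: s => //= i s ->; exact: ddB. Qed.

Lemma dd_sum (I : Type) (r : seq I) (P : pred I) i (F : I -> (nat -> nat) -> V) :
  dd i (fun e => \sum_(j <- r | P j) F j e) = fun e => \sum_(j <- r | P j) dd i (F j) e.
Proof.
apply/funext => e; rewrite /dd; case: leqP => _; rewrite exchange_big //.
by rewrite /= sumrN.
Qed.

End ddV.

Section ddR.
Variable R : comNzRingType.
Implicit Types (F G : (nat -> nat) -> R) (x : nat -> R).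

Lemma ddZ i (c : R) F : dd i (fun e => c * F e) = fun e => c * dd i F e.
Proof.
by apply/funext => e; rewrite /dd; case: leqP => _; rewrite -?mulrN -mulr_sumr ?mulrN.
Qed.

Lemma ddwZ s (c : R) F : ddw s (fun e => c * F e) = fun e => c * ddw s F e.
Proof. by elim: s => //= i s ->; exact: ddZ. Qed.

Definition mono_ev (n : nat) (x : nat -> R) (e : nat -> nat) : R := \prod_(p < n) x p ^+ e p.

Lemma mono_ev_split n i : (i.+1 < n)%N -> exists rest : (nat -> R) -> (nat -> nat) -> R,
  [/\ forall x e, mono_ev n x e = x i ^+ e i * x i.+1 ^+ e i.+1 * rest x e,
      forall x e, rest (swapf i x) e = rest x e &
      forall x e a b, rest x (upd2 e i a b) = rest x e].
Proof.
move=> hi; have hi' : (i < n)%N by lia.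
exists (fun x e => \prod_(p < n | (p != i :> nat) && (p != i.+1 :> nat)) x p ^+ e p).
split=> [x e|x e|x e a b].
- rewrite /mono_ev (bigD1 (Ordinal hi')) //= (bigD1 (Ordinal hi)) /=; last first.
    by rewrite -val_eqE /=; lia.
  by rewrite mulrA.
- by apply: eq_bigr => p /andP[h1 h2]; rewrite /swapf (negbTE h1) (negbTE h2).
- by apply: eq_bigr => p /andP[h1 h2]; rewrite /upd2 (negbTE h1) (negbTE h2).
Qed.

Lemma divided_difference_mono (x y : R) a b : (b <= a)%N ->
  (x - y) * (\sum_(r < a - b) x ^+ (a - r.+1) * y ^+ (b + r)) =
  x ^+ a * y ^+ b - y ^+ a * x ^+ b.
Proof.
move=> h; set d := (a - b)%N.
have -> : x ^+ a * y ^+ b - y ^+ a * x ^+ b = x ^+ b * y ^+ b * (x ^+ d - y ^+ d).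
  have -> : a = (b + d)%N by rewrite /d; lia.
  by rewrite !exprD; ring.
rewrite subrXX [RHS]mulrCA; congr (_ * _).
rewrite mulr_sumr; apply: eq_bigr => r _.
have -> : (a - r.+1 = b + (d.-1 - r))%N by have := ltn_ord r; lia.
by rewrite !exprD; ring.
Qed.

Lemma dd_mono_ev n i x : (i.+1 < n)%N ->
  (fun e => (x i - x i.+1) * dd i (mono_ev n x) e) =
  (fun e => mono_ev n x e - mono_ev n (swapf i x) e).
Proof.
move=> hi; apply/funext => e.
have [rest [h1 h2 h3]] := mono_ev_split hi.
have i1 : (i.+1 == i) = false by lia.
rewrite (h1 x) (h1 (swapf i x)) h2 /swapf eqxx i1 eqxx -mulrBl.
rewrite /dd; case: leqP => h.
  under eq_bigr do rewrite h1 h3 /upd2 eqxx i1 eqxx.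
  by rewrite -mulr_suml mulrA divided_difference_mono.
under eq_bigr do rewrite h1 h3 /upd2 eqxx i1 eqxx.
rewrite -mulr_suml -mulNr mulrA mulrN (divided_difference_mono _ _ (ltnW h)).
by rewrite opprB [x i.+1 ^+ _ * _]mulrC [x i ^+ e i.+1 * _]mulrC.
Qed.

Lemma ddw_rcons (V : zmodType) s j (F : _ -> V) : ddw (rcons s j) F = ddw s (dd j F).
Proof. by rewrite /ddw foldr_rcons. Qed.

(** The last letter is the innermost operator, so it acts on the evaluation functional; there a
    divided difference compares the points x and s_j x. This turns words into walks on the points
    given by permutations. *)
Lemma ddw_mono_ev_rcons n s j x e : (j.+1 < n)%N ->
  (x j - x j.+1) * ddw (rcons s j) (mono_ev n x) e =
  ddw s (mono_ev n x) e - ddw s (mono_ev n (swapf j x)) e.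
Proof.
move=> hj; rewrite ddw_rcons.
rewrite -[LHS](congr1 (fun f => f e) (ddwZ s (x j - x j.+1) (dd j (mono_ev n x)))).
by rewrite dd_mono_ev // ddwB.
Qed.

End ddR.

Lemma edeg_incr n i e : (i < n)%N ->
  edeg n (fun p => ((i == p) + e p)%N) = (edeg n e).+1.
Proof.
move=> hi; rewrite /edeg big_split /= (bigD1 (Ordinal hi)) //= eqxx big1 ?addn0 //.
by move=> p; rewrite -val_eqE /= eq_sym => /negbTE ->.
Qed.

Lemma mono_ev_incr (R : comNzRingType) n i x e : (i < n)%N ->
  mono_ev n x (fun p => ((i == p) + e p)%N) = x i * mono_ev n x e :> R.
Proof.
move=> hi; rewrite /mono_ev; under eq_bigr do rewrite exprD.
rewrite big_split /= (bigD1 (Ordinal hi)) //= eqxx expr1 big1 ?mulr1 //.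
by move=> p; rewrite -val_eqE /= eq_sym => /negbTE ->.
Qed.

Definition factor_exp (R : Type) (fs : seq (nat * R)) : nat -> nat :=
  fun p => count (fun f => f.1 == p) fs.

Lemma edeg_factor_exp (R : Type) n (fs : seq (nat * R)) :
  all (fun f => f.1 < n)%N fs -> edeg n (factor_exp fs) = size fs.
Proof.
elim: fs => [_|[i a] fs IH /= /andP[hi /IH {}IH]]; first by rewrite /edeg big1.
by rewrite -IH -(edeg_incr _ hi).
Qed.

(** Only the leading exponent and a degree bound for the others are recorded: a word with as many
    letters as there are factors annihilates all the others. *)
Lemma prod_factors_expand (R : comNzRingType) n (fs : seq (nat * R)) :
  all (fun f => f.1 < n)%N fs ->
  exists (T : finType) (c : T -> R) (E : T -> nat -> nat),
    (forall u, edeg n (E u) < size fs)%N /\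
    (forall x, \prod_(f <- fs) (x f.1 - f.2) =
      mono_ev n x (factor_exp fs) + \sum_u c u * mono_ev n x (E u)).
Proof.
elim: fs => [_|[i a] fs IH /= /andP[hi hfs]].
  exists void, (fun _ => 0), (fun _ _ => 0%N); split=> [[]//|x].
  by rewrite big_nil big_pred0 ?addr0 /mono_ev ?big1 // => -[].
have [T [c [E [hE hx]]]] := IH hfs.
pose c' (u : T + (T + unit)) := match u with
  | inl u => c u | inr (inl u) => - (a * c u) | inr (inr _) => - a end.
pose E' (u : T + (T + unit)) := match u with
  | inl u => fun p => ((i == p) + E u p)%N | inr (inl u) => E u
  | inr (inr _) => factor_exp fs end.
exists (T + (T + unit))%type, c', E'; split=> [[u|[u|[]]]|x] /=.
- by rewrite edeg_incr // ltnS; exact: hE.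
- exact/ltnW/hE.
- by rewrite edeg_factor_exp.
rewrite big_cons hx !big_sumType /=.
rewrite -[factor_exp (_ :: _)]/(fun p => ((i == p) + factor_exp fs p)%N) (mono_ev_incr _ _ hi).
have -> : \sum_(u : unit) - a * mono_ev n x (factor_exp fs) = - a * mono_ev n x (factor_exp fs).
  by rewrite (big_pred1 tt) //; case.
have -> : \sum_u c u * mono_ev n x (fun p => ((i == p) + E u p)%N) =
    x i * \sum_u c u * mono_ev n x (E u).
  by rewrite mulr_sumr; apply: eq_bigr => u _; rewrite (mono_ev_incr _ _ hi) mulrCA.
have -> : \sum_u - (a * c u) * mono_ev n x (E u) = - a * \sum_u c u * mono_ev n x (E u).
  by rewrite mulr_sumr; apply: eq_bigr => u _; rewrite -mulNr mulrA.
by ring.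
Qed.

(** * Evaluation at permutations and detection of sorting networks *)

Section Perms.
Variable R : realFieldType.

Definition ptof (l : seq nat) : nat -> R := fun p => (nth 0%N l p)%:R.

Lemma size_swap_at l k : size (swap_at l k) = size l.
Proof. by rewrite size_map size_iota. Qed.

Lemma nth_swap_at l k i : (i < size l)%N ->
  nth 0%N (swap_at l k) i = nth 0%N l (if i == k.-1 then k else if i == k then k.-1 else i).
Proof. by move=> hi; rewrite (nth_map 0%N) ?size_iota // nth_iota. Qed.

Lemma ptof_swap l j : (j.+1 < size l)%N -> ptof (swap_at l j.+1) = swapf j (ptof l).
Proof.
move=> hj; apply/funext => p; rewrite /swapf /ptof; congr (_%:R).
case: (ltnP p (size l)) => hp; first by rewrite nth_swap_at.
rewrite nth_default ?size_swap_at // nth_default //.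
by case: eqP => [?|_]; [lia|case: eqP => [?|_]; lia].
Qed.

Lemma swap_at_cat l1 a b l2 :
  swap_at (l1 ++ a :: b :: l2) (size l1).+1 = l1 ++ b :: a :: l2.
Proof.
apply: (@eq_from_nth _ 0%N); first by rewrite size_swap_at !size_cat.
move=> i; rewrite size_swap_at => hi; rewrite nth_swap_at //= !nth_cat.
case: (ltngtP i (size l1)) => h.
- have -> : (i == (size l1).+1) = false by lia.
  by rewrite h.
- case: eqP => [->|h'].
    by rewrite ltnn subnn /= subSn // subnn.
  rewrite ltnNge (ltnW h) /=.
  by case E : (i - size l1)%N => [|[|r]] //=; exfalso; lia.
- by rewrite ltnNge leqnSn /= h subnn subSn // subnn.
Qed.

Lemma adjacent_split (l : seq nat) j : (j.+1 < size l)%N ->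
  exists l1 a b l2, l = l1 ++ a :: b :: l2 /\ size l1 = j.
Proof.
move=> hj; exists (take j l), (nth 0%N l j), (nth 0%N l j.+1), (drop j.+2 l).
rewrite -drop_nth // -drop_nth ?cat_take_drop; last by lia.
by rewrite size_takel //; lia.
Qed.

Fixpoint inv_num (l : seq nat) : nat :=
  if l is a :: l' then (count (fun b => b < a) l' + inv_num l')%N else 0%N.

(** The product of a - b over the inversions: the denominators met along a reduced word, one for
    each letter. *)
Fixpoint inv_prod (l : seq nat) : R :=
  if l is a :: l' then \prod_(b <- l' | (b < a)%N) (a%:R - b%:R) * inv_prod l' else 1.

Lemma inv_num_swap l1 a b l2 : (b < a)%N ->
  inv_num (l1 ++ a :: b :: l2) = (inv_num (l1 ++ b :: a :: l2)).+1.
Proof.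
move=> h; elim: l1 => [|c l1 IH] /=; first by rewrite h; lia.
by rewrite IH !count_cat /=; lia.
Qed.

Lemma inv_prod_swap l1 a b l2 : (b < a)%N ->
  inv_prod (l1 ++ a :: b :: l2) = (a%:R - b%:R) * inv_prod (l1 ++ b :: a :: l2).
Proof.
move=> h; elim: l1 => [|c l1 IH] /=.
  by rewrite !big_cons h ltnNge (ltnW h) /=; ring.
rewrite IH mulrCA; congr (_ * (_ * _)); apply: perm_big.
by rewrite perm_cat2l; apply/seq.permP => p /=; rewrite addnCA.
Qed.

Lemma inv_prod_neq0 l : inv_prod l != 0.
Proof.
elim: l => [|a l IH] /=; first exact: oner_neq0.
rewrite mulf_neq0 // prodf_seq_neq0; apply/allP => b _; apply/implyP => h.
by rewrite subr_eq0 eqr_nat; lia.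
Qed.

Lemma inv_num_iota m n : inv_num (iota m n) = 0%N.
Proof.
elim: n m => [|n IH] m //=; rewrite IH addn0.
apply/eqP; rewrite -leqn0 leqNgt -has_count; apply/hasPn => b.
by rewrite mem_iota; lia.
Qed.

Lemma inv_num0_iota n l : perm_eq l (iota 1 n) -> inv_num l = 0%N -> l = iota 1 n.
Proof.
move=> hp h0; apply: (@sorted_eq _ leq) => //.
- exact: leq_trans.
- exact: anti_leq.
- elim: l h0 {hp} => [|a l IH] //= h0.
  have hl : inv_num l = 0%N by lia.
  rewrite (path_sortedE leq_trans) IH // andbT; apply/allP => b hb.
  rewrite leqNgt; apply/negP => hba.
  have : has (fun b => b < a)%N l by apply/hasP; exists b.
  by rewrite has_count; lia.
- exact: iota_sorted.
Qed.

Lemma inv_num_rev_iota n : inv_num (rev (iota 1 n)) = 'C(n, 2).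
Proof.
elim: n => [|n IH] //; have -> : iota 1 n.+1 = iota 1 n ++ [:: n.+1] by rewrite -[n.+1]addn1 iotaD add1n addn1.
rewrite rev_cat /= IH.
rewrite binS bin1 addnC; congr (_ + _)%N.
rewrite -[RHS](size_iota 1 n) -size_rev; apply/eqP; rewrite -all_count.
by apply/allP => b; rewrite mem_rev mem_iota add1n; lia.
Qed.

Definition stair_factors (n : nat) : seq (nat * R) :=
  [seq (p, v%:R) | p <- iota 0 n, v <- iota p.+2 (n - p.+1)].

Lemma stair_factors_all n : all (fun f => f.1 < n)%N (stair_factors n).
Proof.
apply/allP => f /allpairsPdep[p [v [hp hv ->]]] /=.
by move: hp; rewrite mem_iota; lia.
Qed.

Definition stair (n : nat) : nat -> nat := fun p => (n - p.+1)%N.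

Lemma stair_factors_exp n : factor_exp (stair_factors n) = stair n.
Proof.
apply/funext => p; rewrite /factor_exp /stair_factors count_flatten -map_comp.
have : iota 0 n =i [pred q | q < n]%N by move=> q; rewrite mem_iota.
have := iota_uniq 0 n; move: (iota 0 n) => s us hs.
rewrite sumnE big_map /=.
have E q : count (fun f : nat * R => f.1 == p) [seq (q, v%:R) | v <- iota q.+2 (n - q.+1)]
   = ((q == p) * stair n q)%N.
  rewrite count_map /=; case: eqP => [->|h].
    by rewrite mul1n (eq_count (a2 := predT)) ?count_predT ?size_iota // => v /=; rewrite eqxx.
  rewrite (eq_count (a2 := pred0)) ?count_pred0 // => v /=.
  by apply/eqP.
under eq_bigr do rewrite E.
case: (ltnP p n) => hp.
  rewrite (bigD1_seq p) ?hs //= eqxx mul1n big1 ?addn0 // => q /negbTE ->.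
  by rewrite mul0n.
rewrite big1_seq; first by rewrite /stair; lia.
move=> q /andP[_]; rewrite hs inE => hq.
by have -> : (q == p) = false by lia.
Qed.

Lemma size_stair_factors n : size (stair_factors n) = 'C(n, 2).
Proof.
rewrite -(edeg_factor_exp (stair_factors_all n)) stair_factors_exp /edeg /stair.
rewrite (reindex_inj rev_ord_inj) /= -triangular_sum big_mkord.
by apply: eq_bigr => i _; have := ltn_ord i; lia.
Qed.

(** A nonzero product forces l_p <= p + 1 at every position p; by strong induction the smaller
    values are already taken, so equality holds. *)
Lemma stair_factors_nonzero n l : perm_eq l (iota 1 n) ->
  \prod_(f <- stair_factors n) (ptof l f.1 - f.2) != 0 -> l = iota 1 n.
Proof.
move=> hp; have sl := perm_size hp; rewrite size_iota in sl.
rewrite prodf_seq_neq0 => /allP h.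
have lt_ : forall p, (p < n)%N -> (nth 0%N l p <= p.+1)%N.
  move=> p hpn; rewrite leqNgt; apply/negP => hgt.
  have hin : nth 0%N l p \in iota 1 n by rewrite -(perm_mem hp) mem_nth ?sl.
  have := h (p, (nth 0%N l p)%:R); rewrite subrr eqxx /=.
  move=> hh; have : false by apply: hh; apply/allpairsPdep; exists p, (nth 0%N l p);
    rewrite !mem_iota; move: hin; rewrite mem_iota; split=> //; lia.
  by [].
have ul : uniq l by rewrite (perm_uniq hp) iota_uniq.
apply: (@eq_from_nth _ 0%N); first by rewrite sl size_iota.
move=> i; rewrite sl => hi; rewrite nth_iota //.
elim/ltn_ind: i hi => i IH hi.
have hin : nth 0%N l i \in iota 1 n by rewrite -(perm_mem hp) mem_nth ?sl.
have := lt_ i hi; rewrite leq_eqVlt add1n => /orP[/eqP//|hlt].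
rewrite mem_iota in hin.
have hj : ((nth 0%N l i).-1 < i)%N by lia.
have := IH _ hj; rewrite (ltn_trans hj hi) => /(_ isT) /eqP hh.
have : nth 0%N l (nth 0%N l i).-1 == nth 0%N l i by move/eqP: hh => ->; lia.
by rewrite nth_uniq ?sl //; lia.
Qed.

Definition nfactors (n : nat) := \prod_(f <- stair_factors n) (ptof (iota 1 n) f.1 - f.2).

Lemma nfactors_neq0 n : nfactors n != 0.
Proof.
rewrite prodf_seq_neq0; apply/allP => f /allpairsPdep[p [v [hp hv ->]]] /=.
move: hp hv; rewrite !mem_iota => hp hv.
by rewrite /ptof nth_iota ?subr_eq0 ?eqr_nat; lia.
Qed.

Lemma swap_atK l k : (0 < k < size l)%N -> swap_at (swap_at l k) k = l.
Proof.
case: k => // j hj; have [l1 [a [b [l2 [-> s1]]]]] := adjacent_split hj.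
by rewrite -s1 !swap_at_cat.
Qed.

Lemma perm_swap_at l k : (0 < k < size l)%N -> perm_eq (swap_at l k) l.
Proof.
case: k => // j hj; have [l1 [a [b [l2 [-> s1]]]]] := adjacent_split hj.
by rewrite -s1 swap_at_cat perm_cat2l; apply/seq.permP => p /=; rewrite addnCA.
Qed.

(* Evaluating the divided differences of prod_{i+j<=n} (x_i - (n+1-j)) at the point
   [ptof l]: that polynomial vanishes at every permutation but the identity, so only
   words that lead from the identity to l in the minimal number of steps survive. *)
Lemma divided_difference_at_perm n (z : seq nat -> (nat -> R) -> R) :
  (forall x, z [::] x = \prod_(f <- stair_factors n) (x f.1 - f.2)) ->
  (forall s j x, (j.+1 < n)%N ->
     (x j - x j.+1) * z (rcons s j) x = z s x - z s (swapf j x)) ->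
  forall s l, all (fun i => i.+1 < n)%N s -> perm_eq l (iota 1 n) ->
    ((size s < inv_num l)%N -> z s (ptof l) = 0 /\ apply_swaps n (map S s) != l) /\
    (size s = inv_num l -> (-1) ^+ size s * inv_prod l * z s (ptof l) =
       nfactors n * (apply_swaps n (map S s) == l)%:R).
Proof.
move=> z0 zS; elim/last_ind => [|s j IH] l hs hp.
  split=> /= h.
    split; last first.
      by apply/negP => /eqP hl; move: h; rewrite -hl inv_num_iota.
    rewrite z0; apply/eqP/negPn/negP => /(stair_factors_nonzero hp) hl.
    by move: h; rewrite hl inv_num_iota.
  have hl := inv_num0_iota hp (esym h).
  rewrite z0 expr0 mul1r hl /nfactors /apply_swaps /= eqxx mulr1.
  suff -> : inv_prod (iota 1 n) = 1 by rewrite mul1r.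
  elim: (n) 1%N {hl h hp} => [|m IHm] q //=; rewrite IHm mulr1 big1_seq // => b.
  by rewrite mem_iota; lia.
move: hs; rewrite all_rcons => /andP[hj hs].
have sl := perm_size hp; rewrite size_iota in sl.
have hjl : (j.+1 < size l)%N by rewrite sl.
have hk : (0 < j.+1 < size l)%N by rewrite hjl.
have hp' : perm_eq (swap_at l j.+1) (iota 1 n) by rewrite (perm_trans (perm_swap_at hk)).
have ul : uniq l by rewrite (perm_uniq hp) iota_uniq.
have xneq : ptof l j - ptof l j.+1 != 0.
  by rewrite subr_eq0 /ptof eqr_nat nth_uniq //; lia.
have zE := zS s j (ptof l) hj; rewrite -ptof_swap // in zE.
have aE : apply_swaps n (map S (rcons s j)) = swap_at (apply_swaps n (map S s)) j.+1.
  by rewrite /apply_swaps map_rcons foldl_rcons.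
have sa : size (apply_swaps n (map S s)) = n.
  rewrite /apply_swaps; elim/last_ind: (s) => [|s' i' IH']; first by rewrite size_iota.
  by rewrite map_rcons foldl_rcons size_swap_at.
have aEl : (apply_swaps n (map S (rcons s j)) == l) = (apply_swaps n (map S s) == swap_at l j.+1).
  rewrite aE; apply/eqP/eqP => [<-|->]; first by rewrite swap_atK // sa -sl.
  by rewrite swap_atK.
have [H1 _] := IH l hs hp; have [H1' H2'] := IH _ hs hp'.
have [l1 [a [b [l2 [hl s1]]]]] := adjacent_split hjl.
have swE : swap_at l j.+1 = l1 ++ b :: a :: l2 by rewrite hl -s1 swap_at_cat.
have xa : ptof l j = a%:R by rewrite /ptof hl nth_cat s1 ltnn subnn.
have xb : ptof l j.+1 = b%:R by rewrite /ptof hl nth_cat s1 ltnNge leqnSn /= subSn // subnn.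
have ab : a != b.
  by apply/eqP => hab; move: xneq; rewrite xa xb hab subrr eqxx.
rewrite aEl size_rcons; split=> h.
  have hsw : (size s < inv_num (swap_at l j.+1))%N.
    rewrite swE; move: h; rewrite hl; case: (ltngtP b a) ab => // hba _.
      by rewrite inv_num_swap.
    by rewrite [inv_num (l1 ++ b :: _)]inv_num_swap //; lia.
  have [z1 n1] := H1' hsw; have [z2 n2] := H1 (ltnW h).
  rewrite n1; split=> //; apply: (mulfI xneq).
  by rewrite zE z1 z2 subrr mulr0.
have [|z2 _] := H1; first by rewrite -h.
(* At [l] itself [s] is one letter too short. If the swap removes an inversion, the swapped point
   alone carries the value; if it creates one, [s] is too short there as well, and both sides are
   zero. *)
case: (ltngtP b a) ab => // hba _.
  have hsw : size s = inv_num (swap_at l j.+1).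
    by apply: succn_inj; rewrite h swE -inv_num_swap // hl.
  rewrite -H2' // hl inv_prod_swap // -swE -hl -xa -xb exprS.
  rewrite z2 sub0r in zE.
  rewrite -[RHS]opprK -[in RHS]mulrN -zE; ring.
have hsw : (size s < inv_num (swap_at l j.+1))%N.
  rewrite swE inv_num_swap //; move: h; rewrite hl => <-; lia.
have [z1 /negbTE ->] := H1' hsw.
suff -> : z (rcons s j) (ptof l) = 0 by rewrite !mulr0.
by apply: (mulfI xneq); rewrite zE z1 z2 subrr mulr0.
Qed.

(** For a word of N letters only the leading monomial of the staircase product survives, and it is
    reduced to a constant. The value at the reverse permutation is therefore a pure count, and the
    vanishing of the product at the other permutations decides which words contribute. [kappa]
    combines the value of the product at the identity with the inversion product of the reverse
    permutation. *)
Lemma ddw_stair n : exists2 kappa : R, kappa != 0 &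
  forall s, all (fun i => i.+1 < n)%N s -> size s = 'C(n, 2) ->
    ddw s (fun _ => 1 : R) (stair n) =
    kappa * (apply_swaps n (map S s) == rev (iota 1 n))%:R.
Proof.
have [T [c [E [hE hx]]]] := prod_factors_expand (stair_factors_all n).
pose z s x := ddw s (mono_ev n x) (stair n) + \sum_u c u * ddw s (mono_ev n x) (E u).
have z0 x : z [::] x = \prod_(f <- stair_factors n) (x f.1 - f.2).
  by rewrite hx stair_factors_exp.
have zS s j x : (j.+1 < n)%N -> (x j - x j.+1) * z (rcons s j) x = z s x - z s (swapf j x).
  move=> hj; rewrite /z mulrDr ddw_mono_ev_rcons // mulr_sumr.
  under eq_bigr do rewrite mulrCA ddw_mono_ev_rcons // mulrBr.
  by rewrite sumrB; ring.
set w0 := rev (iota 1 n).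
have hw0 : perm_eq w0 (iota 1 n) by rewrite perm_rev.
exists (nfactors n / ((-1) ^+ 'C(n, 2) * inv_prod w0)).
  rewrite mulf_neq0 ?nfactors_neq0 // invr_neq0 // mulf_neq0 ?inv_prod_neq0 //.
  by rewrite signr_eq0.
move=> s hs ss; have [_ H] := divided_difference_at_perm z0 zS hs hw0.
have ed : edeg n (stair n) = 'C(n, 2).
  by rewrite -stair_factors_exp edeg_factor_exp ?stair_factors_all // size_stair_factors.
have zE : z s (ptof w0) = ddw s (fun _ => 1 : R) (stair n).
  rewrite /z big1 ?addr0 => [|u _]; last first.
    by rewrite (ddw_small _ hs) ?mulr0 // ss -size_stair_factors.
  apply: (ddw_deg (n := n) (d := 0)) => //; last by rewrite addn0 ss.
  move=> e he; rewrite /mono_ev big1 // => p _.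
  by rewrite (edeg0 he).
rewrite -zE mulrAC -H ?inv_num_rev_iota // ss [X in X / _]mulrC mulfK //.
by rewrite mulf_neq0 ?inv_prod_neq0 // signr_eq0.
Qed.

End Perms.

(** * From single words to numbers of words *)

Definition Uop (V : zmodType) (I : seq nat) (F : (nat -> nat) -> V) : (nat -> nat) -> V :=
  fun e => \sum_(i <- I) dd i F e.

(** Indices start at 0, so [i] stands for the letter i + 1; k = 0 excludes nothing, and
    [letters n 0] is the full alphabet. *)
Definition letters (n k : nat) : seq nat := [seq i <- iota 0 n.-1 | i.+1 != k].

Lemma big_tuple_cons (V : nmodType) (T : finType) N (G : seq T -> V) (P : pred (seq T)) :
  \sum_(s : N.+1.-tuple T | P s) G s =
  \sum_(x : T) \sum_(s : N.-tuple T | P (x :: s)) G (x :: s).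
Proof.
rewrite pair_big_dep /=.
rewrite (reindex (fun u : T * N.-tuple T => [tuple of u.1 :: u.2])) //=.
exists (fun s : N.+1.-tuple T => (thead s, [tuple of behead s])) => [[x s]|s] _ /=.
  by congr (_, _); apply/val_inj.
by rewrite [RHS]tuple_eta; apply/val_inj.
Qed.

Lemma sum_pos_ord (V : nmodType) n (P : pred nat) (H : nat -> V) :
  \sum_(x : 'I_n | (0 < x)%N && P x) H x.-1 =
  \sum_(i <- iota 0 n.-1 | P i.+1) H i.
Proof.
case: n => [|n]; first by rewrite big_ord0 big_nil.
rewrite big_mkcond big_ord_recl /= add0r -big_mkcond /=.
have -> : iota 0 n = index_iota 0 n by rewrite /index_iota subn0.
by rewrite big_mkord.
Qed.

(** One predicate for each position lets the alphabet change after the first q letters. *)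
Lemma sum_ddw_words (V : zmodType) n (Ps : seq (pred nat)) (F : (nat -> nat) -> V) e :
  foldr (fun P G => Uop [seq i <- iota 0 n.-1 | P i.+1] G) F Ps e =
  \sum_(s : (size Ps).-tuple 'I_n | all (fun x : 'I_n => 0 < x)%N s &&
      all2 (fun (P : pred nat) (x : 'I_n) => P x) Ps s)
    ddw [seq x.-1 | x : 'I_n <- s] F e.
Proof.
elim: Ps e => [|P Ps IH] e /=.
  rewrite (big_pred1 (nil_tuple 'I_n)) //= => s; rewrite (tuple0 s) /=.
  by apply/esym/eqP/val_inj.
rewrite (big_tuple_cons _ (fun s : seq 'I_n => ddw [seq x.-1 | x : 'I_n <- s] F e)
  (fun s => all (fun x : 'I_n => 0 < x)%N s && all2 (fun (P : pred nat) (x : 'I_n) => P x) (P :: Ps) s)).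
rewrite /Uop big_filter (funext IH); under eq_bigr do rewrite dd_sum.
rewrite -(sum_pos_ord n P (fun i => \sum_(s : (size Ps).-tuple 'I_n |
   all (fun x : 'I_n => 0 < x)%N s && all2 (fun (P : pred nat) (x : 'I_n) => P x) Ps s)
    dd i (ddw [seq x.-1 | x : 'I_n <- s] F) e)).
rewrite big_mkcond /=; apply: eq_bigr => x _; case: ifP => h.
  by apply: eq_bigl => s /=; move/andP: h => [-> ->].
rewrite big_pred0 // => s /=; move: h.
by case: (0 < x)%N; case: (P x); rewrite //= ?andbF.
Qed.

Lemma foldr_nseq (T U : Type) (f : T -> U -> U) (x : T) q y :
  foldr f y (nseq q x) = iter q (f x) y.
Proof. by elim: q => //= q ->. Qed.

(** [index] counts from 0, so this condition says that none of the first q letters is k. *)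
Definition Cnt (n k q : nat) : nat := #|[set s in Omega n | (q <= index k (map val s))%N]|.

Lemma all2_nseq (T U : Type) (P : T -> U -> bool) (t : T) s :
  all2 P (nseq (size s) t) s = all (P t) s.
Proof. by elim: s => //= a s ->. Qed.

Lemma all2_catE (T U : Type) (P : T -> U -> bool) t1 t2 s q : size t1 = q ->
  size s = (size t1 + size t2)%N ->
  all2 P (t1 ++ t2) s = all2 P t1 (take q s) && all2 P t2 (drop q s).
Proof.
elim: t1 s q => [|t t1 IH] s [|q] //=; first by rewrite take0 drop0.
by case: s => [|a s] //= [hq] [hs]; rewrite -andbA (IH s q).
Qed.

Lemma index_ge (k q : nat) s : (q <= size s)%N ->
  (q <= index k s)%N = all (fun x => x != k) (take q s).
Proof.
elim: s q => [|a s IH] [|q] //= hq; case: eqP => //= ak.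
by rewrite ltnS IH.
Qed.

Lemma Cnt_Uop (R : realFieldType) n : exists2 kappa : R, kappa != 0 & forall k q,
  (q <= 'C(n, 2))%N -> kappa * (Cnt n k q)%:R =
  iter q (Uop (letters n k)) (iter ('C(n, 2) - q) (Uop (letters n 0)) (fun _ => 1 : R)) (stair n).
Proof.
have [kap kap0 H] := ddw_stair R n; exists kap => // k q hq.
set p := ('C(n, 2) - q)%N.
pose Ps := nseq q (fun x => x != k) ++ nseq p (fun x => x != 0%N).
have sPs : size Ps = 'C(n, 2) by rewrite size_cat !size_nseq; lia.
have := sum_ddw_words n Ps (fun _ => 1 : R) (stair n).
rewrite /Ps foldr_cat !foldr_nseq -/(letters n k) -/(letters n 0) => ->.
rewrite -/Ps.
rewrite /Cnt -sum1_card natr_sum mulr_sumr sPs [RHS]big_mkcond [LHS]big_mkcond /=.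
apply: eq_bigr => s _; rewrite !inE.
have ss : size s = 'C(n, 2) by rewrite size_tuple.
case hall : (all _ s) => /=; last by [].
have -> : all2 (fun (P : pred nat) (x : 'I_n) => P x) Ps s = (q <= index k (map val s))%N.
  rewrite /Ps (@all2_catE _ _ _ _ _ _ q) ?size_nseq //; last by rewrite ss /p; lia.
  rewrite index_ge ?size_map ?ss // -map_take all_map.
  have := all2_nseq (fun (P : pred nat) (x : 'I_n) => P x) (fun x => x != k) (take q s).
  rewrite size_takel ?ss // => ->.
  have := all2_nseq (fun (P : pred nat) (x : 'I_n) => P x) (fun x => x != 0%N) (drop q s).
  rewrite size_drop ss => ->.
  rewrite [X in _ && X](_ : _ = true) ?andbT //.
  apply/allP => x /mem_drop hx; have := allP hall _ hx; lia.
have pm : map S [seq x.-1 | x : 'I_n <- s] = map val s.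
  rewrite -map_comp; apply/eq_in_map => x hx /=.
  by have := allP hall _ hx; lia.
rewrite H ?size_map //; last first.
  rewrite all_map; apply/allP => x hx /=.
  by have := allP hall _ hx; have := ltn_ord x; lia.
rewrite pm; case: (_ == _) => //=; last by rewrite mulr0 if_same.
Qed.

(** * Determinants that solve the evolution equation *)

Section Derivation.
Variables (A : comPzRingType) (D : A -> A).
Hypothesis DM : forall a b, D (a * b) = D a * b + a * D b.

Lemma derivation1 : D 1 = 0.
Proof.
have := DM 1 1; rewrite !mulr1 mul1r => h.
by apply: (addrI (D 1)); rewrite addr0 -h.
Qed.

Lemma derivation_prod (I : finType) (F : I -> A) :
  D (\prod_i F i) = \sum_i D (F i) * \prod_(j | j != i) F j.
Proof.
suff H (r : seq I) : uniq r -> D (\prod_(i <- r) F i) =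
    \sum_(i <- r) D (F i) * \prod_(j <- r | j != i) F j.
  by rewrite H ?index_enum_uniq.
elim: r => [_|x r IH /= /andP[xr ur]]; first by rewrite !big_nil derivation1.
rewrite !big_cons DM IH // eqxx /=; congr (_ * _ + _).
  rewrite [LHS]big_seq [RHS]big_seq_cond; apply: eq_bigl => j.
  by case: (boolP (j \in r)) => //= jr; apply/esym/eqP => jx; rewrite jx (negbTE xr) in jr.
rewrite mulr_sumr; rewrite [LHS]big_seq [RHS]big_seq; apply: eq_bigr => i ir.
rewrite big_cons; have -> : x != i by apply/eqP => xi; rewrite xi ir in xr.
by rewrite mulrCA.
Qed.

End Derivation.

Section Det.
Variable R : numFieldType.
Notation P := {poly R}.
Variable n : nat.
Variable r : nat -> nat -> 'I_n -> P.

Definition rowdet (l : nat -> nat) : P := \det (\matrix_(p < n, c < n) r p (l p) c).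

Definition decr (i : nat) (l : nat -> nat) : nat -> nat :=
  fun p => if p == i then (l p).-1 else l p.

(** The shift by n - p - 1 that turns the exponents of a Schur polynomial into those of its
    alternant. *)
Definition shifted (e : nat -> nat) : nat -> nat := fun p => (e p + (n - p.+1))%N.

Lemma rowdet_deriv (l : nat -> nat) :
  (forall (p : 'I_n) c, (r p (l p) c)^`() = if (0 < l p)%N then r p (l p).-1 c else 0) ->
  (rowdet l)^`() = \sum_(p < n | (0 < l p)%N) rowdet (decr p l).
Proof.
move=> hr; rewrite /rowdet /determinant raddf_sum /= exchange_big /=.
apply: eq_bigr => s _; rewrite -signr_odd -!mulr_sumr.
rewrite derivM (_ : ((-1) ^+ _)^`() = 0); last first.
  by case: odd; rewrite /= ?expr0 ?expr1 ?derivN -?[1]/(1%:P) ?derivC ?oppr0.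
rewrite mul0r add0r; congr (_ * _).
rewrite (derivation_prod (@derivM R)) [RHS]big_mkcond /=.
apply: eq_bigr => p _; rewrite mxE hr; case: ifP => hp; last by rewrite mul0r.
rewrite [RHS](bigD1 p) //= mxE /decr eqxx; congr (_ * _).
by apply: eq_bigr => j jp; rewrite !mxE val_eqE (negbTE jp).
Qed.

Lemma rowdet_swap l i a b : (i.+1 < n)%N -> r i = r i.+1 ->
  rowdet (upd2 l i b a) = - rowdet (upd2 l i a b).
Proof.
move=> hi hr; have hi' : (i < n)%N by lia.
pose o := Ordinal hi'; pose o1 := Ordinal hi.
have oo1 : o != o1 by rewrite -val_eqE /=; lia.
have i1 : (i.+1 == i) = false by lia.
rewrite /rowdet (_ : \matrix_(p, c) r p (upd2 l i b a p) c =
   xrow o o1 (\matrix_(p, c) r p (upd2 l i a b p) c)); last first.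
  apply/matrixP => p c; rewrite !mxE; case: tpermP => [->|->|/eqP h1 /eqP h2] /=.
  - by rewrite /upd2 eqxx i1 eqxx hr.
  - by rewrite /upd2 i1 !eqxx hr.
  - by rewrite /upd2 -[i]/(val o) -[(val o).+1]/(val o1) !val_eqE (negbTE h1) (negbTE h2).
by rewrite xrowE det_mulmx det_perm odd_tperm oo1 expr1 mulN1r.
Qed.

(** The terms at q and d - q cancel, so the sum up to d inclusive is zero. Dropping the last term
    leaves its opposite, which is the first term. *)
Lemma antisym_sum (g : nat -> P) d :
  (forall q, (q <= d)%N -> g (d - q)%N = - g q) -> \sum_(q < d) g q = g 0%N.
Proof.
move=> hg.
have S0 : \sum_(q < d.+1) g q = 0.
  have : \sum_(q < d.+1) g q = - \sum_(q < d.+1) g q.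
    rewrite {1}(reindex_inj rev_ord_inj) /= -sumrN; apply: eq_bigr => q _.
    by rewrite subSS hg // -ltnS.
  move/eqP; rewrite -addr_eq0 -mulr2n -scaler_nat scaler_eq0 pnatr_eq0 /=.
  by move/eqP.
move: S0; rewrite big_ord_recr /= => /eqP; rewrite addr_eq0 => /eqP ->.
by rewrite -(hg d) // subnn.
Qed.

(** Exchanging two exponents exchanges two rows of the same family. After the shift, the monomials
    of the divided difference therefore cancel in pairs, except the extreme one, in which row i is
    lowered by one. *)
Lemma dd_rowdet i e : (i.+1 < n)%N -> r i = r i.+1 ->
  dd i (fun e => rowdet (shifted e)) e = rowdet (decr i (shifted e)).
Proof.
move=> hi hr; set L := shifted e; set h := (n - i.+2)%N.
have sh a b : shifted (upd2 e i a b) = upd2 L i (a + h.+1) (b + h).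
  apply/funext => p; rewrite /shifted /upd2 /L /shifted.
  by case: eqP => [->|_]; [rewrite /h; lia|case: eqP => [->|_] //; rewrite /h; lia].
have -> : decr i L = upd2 L i (e i + h) (e i.+1 + h).
  apply/funext => p; rewrite /decr /upd2 /L /shifted.
  by case: eqP => [->|_]; [rewrite /h; lia|case: eqP => [->|_] //; rewrite /h; lia].
rewrite /dd; case: leqP => hab.
  transitivity (\sum_(q < e i - e i.+1) rowdet (upd2 L i (e i + h - q) (e i.+1 + h + q))).
    by apply: eq_bigr => q _; rewrite sh; congr (rowdet (upd2 _ _ _ _)); have := ltn_ord q; lia.
  rewrite (antisym_sum (g := fun q => rowdet (upd2 L i (e i + h - q) (e i.+1 + h + q)))).
    by rewrite subn0 addn0.
  move=> q hq; rewrite -rowdet_swap //.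
  by congr (rowdet (upd2 _ _ _ _)); lia.
transitivity (- \sum_(q < e i.+1 - e i) rowdet (upd2 L i (e i.+1 + h - q) (e i + h + q))).
  by congr (- _); apply: eq_bigr => q _; rewrite sh; congr (rowdet (upd2 _ _ _ _)); have := ltn_ord q; lia.
rewrite (antisym_sum (g := fun q => rowdet (upd2 L i (e i.+1 + h - q) (e i + h + q)))).
  by rewrite subn0 addn0 -rowdet_swap.
move=> q hq; rewrite -rowdet_swap //.
by congr (rowdet (upd2 _ _ _ _)); lia.
Qed.

End Det.

(* Exponents between the rectangle (n-k)^k and the staircase. *)
Definition between (n k : nat) (e : nat -> nat) : Prop :=
  forall p, (p < n)%N -> (e p <= n - p.+1)%N /\ ((p < k)%N -> (n - k <= e p)%N).

Section On.
Variable V : zmodType.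
Implicit Types F G : (nat -> nat) -> V.

(** Since i + 1 differs from k, positions i and i + 1 lie on the same side of k. The new exponents
    lie between the smaller old one and the larger old one minus 1, so both bounds persist. *)
Lemma dd_between n k d i F G : (i.+1 < n)%N -> i.+1 != k ->
  (forall e, between n k e -> edeg n e = d -> F e = G e) ->
  forall e, between n k e -> edeg n e = d.+1 -> dd i F e = dd i G e.
Proof.
move=> hi hk FG e he hd; rewrite /dd.
have [ha ha'] := he i (ltnW hi); have [hb hb'] := he _ hi.
case: leqP => hab.
  apply: eq_bigr => q _; apply: FG; last first.
    by have := edeg_upd2 e (e i - q.+1) (e i.+1 + q) hi; have := ltn_ord q; lia.
  move=> p hp; have [h1 h2] := he p hp; have := ltn_ord q; rewrite /upd2.
  by case: eqP => [->|_]; [lia|case: eqP => [->|_]; lia].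
congr (- _); apply: eq_bigr => q _; apply: FG; last first.
  by have := edeg_upd2 e (e i.+1 - q.+1) (e i + q) hi; have := ltn_ord q; lia.
move=> p hp; have [h1 h2] := he p hp; have := ltn_ord q; rewrite /upd2.
by case: eqP => [->|_]; [lia|case: eqP => [->|_]; lia].
Qed.

Lemma mem_letters n k i : i \in letters n k -> (i.+1 < n)%N /\ i.+1 != k.
Proof. by rewrite mem_filter mem_iota => /andP[-> /=]; split=> //; lia. Qed.

Lemma Uop_between n k d F G :
  (forall e, between n k e -> edeg n e = d -> F e = G e) ->
  forall e, between n k e -> edeg n e = d.+1 ->
  Uop (letters n k) F e = Uop (letters n k) G e.
Proof.
move=> FG e he hd; rewrite /Uop; apply: eq_big_seq => i /mem_letters[hi hk].
exact: (dd_between hi hk FG).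
Qed.

Lemma iter_Uop_between n k d F G q :
  (forall e, between n k e -> edeg n e = d -> F e = G e) ->
  forall e, between n k e -> edeg n e = (q + d)%N ->
  iter q (Uop (letters n k)) F e = iter q (Uop (letters n k)) G e.
Proof. by move=> FG; elim: q => //= q IH; exact: Uop_between. Qed.

Lemma iter_Uop_small n k F q e : (edeg n e < q)%N -> iter q (Uop (letters n k)) F e = 0.
Proof.
elim: q e => //= q IH e he; rewrite /Uop big1_seq // => i /andP[_ /mem_letters[hi _]].
case: (posnP (edeg n e)) => [/dd_deg0->//|e0].
transitivity (dd i (fun _ => 0 : V) e); last by rewrite /dd !big1_eq oppr0 if_same.
apply: (@dd_deg _ n (edeg n e).-1) => //; last by lia.
by move=> e' he'; apply: IH; lia.
Qed.

End On.

Lemma iter_UopZ (R : comNzRingType) n k q (c : R) F :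
  iter q (Uop (letters n k)) (fun e => c * F e) = fun e => c * iter q (Uop (letters n k)) F e.
Proof.
elim: q => //= q ->; apply/funext => e; rewrite /Uop mulr_sumr.
by apply: eq_bigr => i _; rewrite ddZ.
Qed.

Lemma dd_coef (R : nzRingType) i (F : (nat -> nat) -> {poly R}) q e :
  (dd i F e)`_q = dd i (fun e => (F e)`_q) e.
Proof. by rewrite /dd; case: leqP => _; rewrite ?coefN coef_sum. Qed.

(** The equation F' = U F solved coefficient by coefficient: F is exp(b U) applied to its value at b
    = 0. The exponents stay in a region stable under U, because the determinants satisfy the
    equation only there. *)
Lemma coef_iter_Uop (R : comNzRingType) n k (F : (nat -> nat) -> {poly R}) :
  (forall e, between n k e -> (F e)^`() = \sum_(i <- letters n k) dd i F e) ->
  forall q e, between n k e ->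
  (F e)`_q * q`!%:R = iter q (Uop (letters n k)) (fun e => (F e)`_0) e.
Proof.
move=> hF; elim=> [|q IH] e he /=; first by rewrite mulr1.
have -> : (F e)`_q.+1 * (q.+1)`!%:R = (F e)^`()`_q * q`!%:R.
  by rewrite coef_deriv factS natrM mulrA -[(F e)`_q.+1 *+ q.+1]mulr_natr.
rewrite hF // coef_sum /Uop mulr_suml; apply: eq_big_seq => i /mem_letters[hi hk].
rewrite dd_coef mulrC -[LHS](congr1 (fun f => f e) (ddZ i (q`!%:R) (fun e => (F e)`_q))).
case d : (edeg n e) => [|d']; first by rewrite !(dd_deg0 _ hi d).
apply: (dd_between hi hk) he d => e' he' _; by rewrite mulrC IH.
Qed.

Section RowdetUop.
Variable R : numFieldType.
Variables (n k : nat) (r : nat -> nat -> 'I_n -> {poly R}).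
Hypothesis kn : (k < n)%N.
Hypothesis rE : forall i, i.+1 != k -> r i = r i.+1.
Hypothesis rD : forall p l c, (r p l c)^`() = if (0 < l)%N then r p l.-1 c else 0.
Hypothesis r0 : forall c, (0 < k)%N -> r k.-1 (2 * (n - k)).-1 c = 0.

(** The derivative lowers each row in turn. The row of an allowed letter gives its divided
    difference; the last row has index 0 and gives nothing; at row k - 1 the bounds force the
    exponent n - k, hence the index 2 (n - k), and lowering it produces the zero row of [r0]. *)
Lemma rowdet_Uop e : between n k e ->
  (rowdet r (shifted n e))^`() = \sum_(i <- letters n k) dd i (fun e => rowdet r (shifted n e)) e.
Proof.
move=> he; rewrite rowdet_deriv //.
case: n kn r rE rD r0 e he => // m km r' rE' rD' r0' e he.
rewrite big_mkcond big_ord_recr /=.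
have [he1 _] := he m (ltnSn m).
have -> : (0 < shifted m.+1 e m)%N = false by rewrite /shifted; lia.
rewrite addr0 /letters big_filter /= [RHS]big_mkcond /=.
have -> : iota 0 m = index_iota 0 m by rewrite /index_iota subn0.
rewrite big_mkord; apply: eq_bigr => i _.
have hi := ltn_ord i.
have -> : (0 < shifted m.+1 e i)%N by rewrite /shifted; lia.
case: eqP => /= [ik|/eqP ik]; last by rewrite dd_rowdet // rE'.
have hi' : (i < m.+1)%N by lia.
rewrite /rowdet (expand_det_row _ (Ordinal hi')) big1 // => c _.
rewrite mxE /decr /= eqxx [r' _ _ _](_ : _ = 0) ?mul0r //.
have [h1 h2] := he i hi'.
have -> : (i : nat) = k.-1 by lia.
have -> : (shifted m.+1 e k.-1).-1 = (2 * (m.+1 - k)).-1.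
  have ik' : k.-1 = i by lia.
  by rewrite /shifted ik'; lia.
by rewrite r0' //; lia.
Qed.

End RowdetUop.

Lemma factr_neq0 (R : numFieldType) q : q`!%:R != 0 :> R.
Proof. by rewrite pnatr_eq0 -lt0n fact_gt0. Qed.

Section Rows.
Variable R : realFieldType.
Variable n : nat.

Definition divpow (a : R) (l j : nat) : R := if (j <= l)%N then a ^+ (l - j) / (l - j)`!%:R else 0.

Definition rowE (l : nat) (c : 'I_n) : {poly R} :=
  if (n - c.+1 <= l)%N then ((l - (n - c.+1))`!%:R^-1) *: 'X^(l - (n - c.+1)) else 0.

(** The expansion in X of (a + X)^(l - j) / (l - j)!, j = n - c - 1, cut after the power l - [low]
    of X. Differentiation still lowers [l] by one, but the row is now zero for [l] below [low]. *)
Definition rowD (a : R) (low l : nat) (c : 'I_n) : {poly R} :=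
  \poly_(g < l.+1 - low) (divpow a (l - g) (n - c.+1) / g`!%:R).

Lemma rowE_deriv l c : (rowE l c)^`() = if (0 < l)%N then rowE l.-1 c else 0.
Proof.
rewrite /rowE; set j := (n - c.+1)%N; case: (ltngtP j l) => h.
- have -> : (0 < l)%N by lia.
  have -> : (j <= l.-1)%N by lia.
  have -> : (l - j = (l.-1 - j).+1)%N by lia.
  rewrite derivZ derivXn /= -scaler_nat scalerA; congr (_ *: _).
  by rewrite factS natrM invfM mulrAC mulVf ?mul1r // pnatr_eq0.
- by rewrite deriv0; case: ifP => // _; have -> : (j <= l.-1)%N = false by lia.
- rewrite -h subnn expr0 derivZ derivC scaler0; case: ifP => // h0.
  by have -> : (j <= j.-1)%N = false by lia.
Qed.

Lemma rowD_deriv a low l c : (rowD a low l c)^`() = if (0 < l)%N then rowD a low l.-1 c else 0.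
Proof.
apply/polyP => g; rewrite coef_deriv /rowD coef_poly.
case: l => [|l] /=.
  by rewrite coef0; case: ifP => [h|_]; [exfalso; lia|rewrite mul0rn].
rewrite coef_poly subSS.
have -> : (g.+1 < l.+2 - low)%N = (g < l.+1 - low)%N by lia.
case: ifP => // _; last by rewrite mul0rn.
rewrite -[LHS]mulr_natr -mulrA; congr (_ * _).
by rewrite factS natrM invfM mulrAC mulVf ?mul1r // pnatr_eq0.
Qed.

Definition detE (e : nat -> nat) : {poly R} := rowdet (fun _ => rowE) (shifted n e).

(** The cut 2 (n - k) is the index of row k - 1, the one the letter k would lower. The rows above it
    must use the same cut, since divided differences need neighbouring rows of one family. *)
Definition detD (k : nat) (a : R) (e : nat -> nat) : {poly R} :=
  rowdet (fun p => rowD a (if p < k then 2 * (n - k) else 0)%N) (shifted n e).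

Lemma detE_coef0 e : edeg n e = 0%N -> (detE e)`_0 = 1.
Proof.
move=> he; rewrite /detE /rowdet -det_tr det_trig; last first.
  apply/is_trig_mxP => i j ij; rewrite !mxE /rowE /shifted (edeg0 he (ltn_ord j)).
  by have := ltn_ord i; have := ltn_ord j; case: ifP => // h hj hi; exfalso; lia.
rewrite big1 ?coef1 // => i _; rewrite !mxE /rowE /shifted (edeg0 he (ltn_ord i)).
by rewrite add0n leqnn subnn fact0 invr1 scale1r.
Qed.

Lemma sum_perm_rev (s : 'S_n) :
  (\sum_(p < n) (n - (s p).+1) = \sum_(p < n) (n - p.+1))%N.
Proof. by rewrite [RHS](reindex_inj (@perm_inj _ s)). Qed.

(** In each permutation term of the determinant the column shifts compensate the row shifts, so
    every nonzero term has the degree of [e]. *)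
Lemma detE_homog e q : q != edeg n e -> (detE e)`_q = 0.
Proof.
move=> hq; rewrite /detE /rowdet /determinant coef_sum big1 // => s _.
rewrite -signr_odd.
suff -> : \prod_i (\matrix_(p, c) rowE (shifted n e p) c) i (s i) =
   ((\prod_i (if (n - (s i).+1 <= shifted n e i)%N then ((shifted n e i - (n - (s i).+1))`!%:R^-1) else 0)) : R) *:
     'X^(edeg n e).
  by case: odd; rewrite ?expr1 ?expr0 ?mulN1r ?mul1r ?coefN coefZ coefXn (negbTE hq) mulr0 ?oppr0.
case: (boolP [forall i : 'I_n, n - (s i).+1 <= shifted n e i]%N) => [/forallP h|].
  have -> : edeg n e = (\sum_(i < n) (shifted n e i - (n - (s i).+1)))%N.
    rewrite sumnB //.
    by rewrite /shifted big_split /= sum_perm_rev addnK.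
  rewrite -prodrXr -scaler_prod; apply: eq_bigr => i _.
  by rewrite mxE /rowE h.
rewrite negb_forall => /existsP[i hi].
rewrite (bigD1 i) //= mxE /rowE (negbTE hi) mul0r.
by rewrite (bigD1 i) //= (negbTE hi) mul0r scale0r.
Qed.

(** The evolution with no letter excluded, started from 1; by homogeneity a single power of [a]
    remains. *)
Lemma detE_horner e a : (0 < n)%N -> between n 0 e ->
  (detE e).[a] * (edeg n e)`!%:R =
  a ^+ edeg n e * iter (edeg n e) (Uop (letters n 0)) (fun _ => 1) e.
Proof.
move=> n0 he; set d := edeg n e.
have H := @coef_iter_Uop R n 0 detE (fun e => @rowdet_Uop R n 0 (fun _ => rowE) n0
  (fun _ _ => erefl) (fun _ => rowE_deriv) (fun _ => ltac:(by [])) e).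
have <- : iter d (Uop (letters n 0)) (fun e => (detE e)`_0) e =
    iter d (Uop (letters n 0)) (fun _ => 1) e.
  apply: (iter_Uop_between (d := 0)) => //; last by rewrite addn0.
  by move=> e' _; exact: detE_coef0.
rewrite -H // mulrA; congr (_ * _).
have {1}-> : detE e = (detE e)`_d *: 'X^d.
  apply/polyP => q; rewrite coefZ coefXn; case: eqP => [->|/eqP hq]; first by rewrite mulr1.
  by rewrite mulr0 detE_homog.
by rewrite hornerZ hornerXn mulrC.
Qed.

(** For exponents in the region the first k row indices are at least 2 (n - k), so at b = 0 the cut
    removes nothing: the restricted evolution in b starts from the unrestricted one at time [a]. *)
Lemma detD_coef0 k a e : (k < n)%N -> between n k e -> (detD k a e)`_0 = (detE e).[a].
Proof.
move=> kn he; rewrite -horner_coef0 /detD /detE /rowdet.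
rewrite -[LHS]/(horner_eval 0 _) -[RHS]/(horner_eval a _) -!det_map_mx.
congr (\det _); apply/matrixP => p c; rewrite !mxE /= /horner_eval horner_coef0.
have [h1 h2] := he p (ltn_ord p); have hp := ltn_ord p; set l := shifted n e p.
rewrite /rowD coef_poly /rowE.
have -> : (0 < l.+1 - (if p < k then 2 * (n - k) else 0))%N.
  by case: ifP => h; rewrite subn_gt0 ltnS // /l /shifted; have := h2 h; lia.
rewrite subn0 fact0 divr1 /divpow; case: ifP => _; last by rewrite horner0.
by rewrite hornerZ hornerXn mulrC.
Qed.

Lemma edeg_stair : edeg n (stair n) = 'C(n, 2).
Proof.
by rewrite -(stair_factors_exp R) edeg_factor_exp ?stair_factors_all // size_stair_factors.
Qed.

Lemma between_stair k : (k <= n)%N -> between n k (stair n).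
Proof. by move=> kn p hp; rewrite /stair; lia. Qed.

Lemma detD_Cnt k : (0 < k < n)%N -> exists2 kappa : R, kappa != 0 & forall a b,
  kappa * \sum_(q < 'C(n, 2).+1) ('C('C(n, 2), q))%:R * b ^+ q * a ^+ ('C(n, 2) - q) * (Cnt n k q)%:R =
  (detD k a (stair n)).[b].
Proof.
move=> /andP[k0 kn]; have n0 : (0 < n)%N by lia.
have [kap kap0 HK] := Cnt_Uop R n.
exists (kap / 'C(n, 2)`!%:R) => [|a b].
  by rewrite mulf_neq0 // invr_neq0 // factr_neq0.
set N := 'C(n, 2).
have rE i : i.+1 != k -> (fun p => rowD a (if p < k then 2 * (n - k) else 0)%N) i =
   (fun p => rowD a (if p < k then 2 * (n - k) else 0)%N) i.+1.
  by move=> ik /=; have -> : (i.+1 < k)%N = (i < k)%N by lia.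
have r0 c : (0 < k)%N -> rowD a (if k.-1 < k then 2 * (n - k) else 0)%N (2 * (n - k)).-1 c = 0.
  move=> _; have -> : (k.-1 < k)%N by lia.
  by apply/polyP => g; rewrite /rowD coef_poly coef0; case: ifP => // h; exfalso; lia.
have H := @coef_iter_Uop R n k (detD k a) (fun e => @rowdet_Uop R n k _ kn
  rE (fun p => rowD_deriv a _) r0 e).
have bs := between_stair (ltnW kn).
have coefD q : (q <= N)%N -> (detD k a (stair n))`_q =
    kap * a ^+ (N - q) * (Cnt n k q)%:R / (q`!%:R * (N - q)`!%:R).
  move=> hq; apply: (canRL (mulfK _)); first by rewrite mulf_neq0 ?factr_neq0.
  rewrite mulrA H // [X in _ = X]mulrAC HK // [LHS]mulrC [RHS]mulrC.
  rewrite -[RHS](congr1 (fun f => f _) (iter_UopZ n k q (a ^+ (N - q)) _)).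
  rewrite -[LHS](congr1 (fun f => f _) (iter_UopZ n k q ((N - q)`!%:R) _)).
  apply: (iter_Uop_between (d := N - q)) bs _; last by rewrite edeg_stair; lia.
  move=> e he de; rewrite detD_coef0 // mulrC -de detE_horner //.
  by move=> p hp; have [? _] := he p hp; split.
have sD : (size (detD k a (stair n)) <= N.+1)%N.
  apply/leq_sizeP => q hq; apply: (mulIf (factr_neq0 R q)).
  by rewrite mul0r H // iter_Uop_small // edeg_stair; lia.
rewrite (horner_coef_wide _ sD) mulr_sumr; apply: eq_bigr => q _.
have hq : (q <= N)%N by rewrite -ltnS.
rewrite coefD // -[in LHS](bin_fact hq) !natrM !invfM.
field.
by rewrite !factr_neq0 /= pnatr_eq0 -lt0n bin_gt0.
Qed.

End Rows.

(** * Reduction to a Hankel determinant of size k *)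

(** Complete [K] to an invertible matrix. Right multiplication by it makes the stacked matrix block
    triangular because [E1] annihilates [K], and [E2] then enters only through the block
    [E2 *m K]. *)
Lemma det_col_mx_kernel (F : fieldType) (k m : nat) (K : 'M[F]_(k + m, k)) (E1 : 'M[F]_(m, k + m)) :
  row_free K^T -> E1 *m K = 0 ->
  exists C : F, forall E2 : 'M[F]_(k, k + m), \det (col_mx E2 E1) = C * \det (E2 *m K).
Proof.
move=> fK EK; pose W := row_ebase K^T; pose K2 := (dsubmx (W : 'M_(k + m)))^T.
have Wu : W \in unitmx by exact: row_ebase_unit.
have KE : K^T = col_ebase K^T *m usubmx (W : 'M_(k + m)).
  rewrite -{1}[K^T]mulmx_ebase (eqP fK) -/W -{1}[W]vsubmxK pid_mx_row -mulmxA mul_row_col.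
  by rewrite mul1mx mul0mx addr0.
have Qu : row_mx K K2 \in unitmx.
  rewrite -unitmx_tr tr_row_mx trmxK KE.
  have -> : col_mx (col_ebase K^T *m usubmx (W : 'M_(k + m))) (dsubmx (W : 'M_(k + m))) =
      block_mx (col_ebase K^T) 0 0 1%:M *m W.
    by rewrite -{3}[W]vsubmxK mul_block_col !mul0mx mul1mx addr0 add0r.
  rewrite unitmx_mul Wu andbT unitmxE det_ublock det1 mulr1 -unitmxE.
  exact: col_ebase_unit.
exists (\det (E1 *m K2) / \det (row_mx K K2)) => E2.
rewrite mulrAC; apply: (canRL (mulfK _)); first by rewrite -unitfE -unitmxE.
rewrite -det_mulmx mul_col_row EK det_ublock mulrC.
by [].
Qed.

Section Moments.
Variable R : realFieldType.
Implicit Types p : {poly R}.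

Definition prim p : {poly R} := \poly_(i < (size p).+1) (p`_i.-1 / i%:R).

Lemma deriv_prim p : (prim p)^`() = p.
Proof.
apply/polyP => i; rewrite coef_deriv coef_poly ltnS.
case: ltnP => h; last by rewrite mul0rn nth_default.
by rewrite -[LHS]mulr_natr -mulrA mulVf ?mulr1 // pnatr_eq0.
Qed.

Lemma deriv_eq0_const p : p^`() = 0 -> forall x y, p.[x] = p.[y].
Proof.
move=> hp; suff -> : p = (p`_0)%:P by move=> x y; rewrite !hornerC.
apply/polyP => -[|i]; rewrite coefC //=.
have : p^`()`_i = 0 by rewrite hp coef0.
by rewrite coef_deriv => /eqP; rewrite mulrn_eq0 /= => /eqP.
Qed.

Definition jac (k m d : nat) : {poly R} := (1 - 'X^2) ^+ (m - k) * 'X^(2 * d).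

(* The integral of u^{2d} (1-u^2)^(m-k) over [t,1], as a polynomial in t. *)
Definition jacmom (k m d : nat) (t : R) : R := (prim (jac k m d)).[1] - (prim (jac k m d)).[t].

Lemma jacmom_unique (W : {poly R}) k m d c : W^`() = - (c *: jac k m d) -> W.[1] = 0 ->
  forall t, W.[t] = c * jacmom k m d t.
Proof.
move=> hW W1 t; have hd : (W + c *: prim (jac k m d))^`() = 0.
  by rewrite derivD derivZ deriv_prim hW addNr.
have := deriv_eq0_const hd t 1; rewrite !hornerD !hornerZ W1 add0r /jacmom => /(canRL (addrK _)) ->.
by rewrite mulrBr.
Qed.

(** A truncated row at a = 1 - X. With M = 2 m + 2 c - j it is the part with at most 2 c powers of X
    in the binomial expansion of 1 / M!, that is, an incomplete beta integral. *)
Definition rowQ (m c j : nat) : {poly R} :=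
  \sum_(g < (2 * c).+1) ((2 * m + 2 * c - g - j)`!%:R^-1 / g`!%:R) *:
     ((1 - 'X) ^+ (2 * m + 2 * c - g - j) * 'X^g).

Lemma horner_1subX (x : R) : (1 - 'X).[x] = 1 - x.
Proof. by rewrite !hornerE. Qed.

Lemma factSV i : i.+1`!%:R^-1 * i.+1%:R = i`!%:R^-1 :> R.
Proof. by rewrite factS natrM invfM mulrAC mulVf ?mul1r // pnatr_eq0. Qed.

(** The derivative telescopes over consecutive terms; what remains is, up to sign and scale, a beta
    density. *)
Lemma deriv_betasum M s : (s < M)%N ->
  (\sum_(g < s.+1) ((M - g)`!%:R^-1 / g`!%:R : R) *: ((1 - 'X) ^+ (M - g) * 'X^g))^`() =
  - (((M - s.+1)`!%:R^-1 / s`!%:R) *: ((1 - 'X) ^+ (M - s.+1) * 'X^s)).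
Proof.
have d1X i : ((1 - 'X : {poly R}) ^+ i)^`() = - (i%:R *: (1 - 'X) ^+ i.-1).
  rewrite deriv_exp derivB derivC derivX sub0r mulN1r mulNrn.
  by rewrite scaler_nat.
elim: s => [|s IH] hs.
  rewrite big_ord1 subn0 expr0 !mulr1 derivZ d1X scalerN scalerA subn1.
  congr (- (_ *: _)); rewrite -[in LHS](prednK hs) factS natrM invfM invr1 !mulr1.
  by rewrite mulrAC mulVf ?mul1r // pnatr_eq0.
rewrite big_ord_recr /= derivD IH; last by lia.
rewrite derivZ derivM d1X derivXn /=.
have -> : (M - s.+1 = (M - s.+2).+1)%N by lia.
rewrite /= -scaler_nat mulNr -scalerAl scalerDr scalerN scalerA -scalerAr scalerA.
have h1 : (M - s.+2).+1`!%:R^-1 / s.+1`!%:R * (M - s.+2).+1%:R = (M - s.+2)`!%:R^-1 / s.+1`!%:R :> R.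
  by rewrite mulrAC factSV.
have h2 : (M - s.+2).+1`!%:R^-1 / s.+1`!%:R * s.+1%:R = (M - s.+2).+1`!%:R^-1 / s`!%:R :> R.
  by rewrite -mulrA factSV.
by rewrite h1 h2 addrCA addNr addr0.
Qed.

Lemma rowQ_deriv m c j : (j < 2 * m)%N ->
  (rowQ m c j)^`() = - (((2 * m - j.+1)`!%:R^-1 / (2 * c)`!%:R) *: ((1 - 'X) ^+ (2 * m - j.+1) * 'X^(2 * c))).
Proof.
move=> hj; have := @deriv_betasum (2 * m + 2 * c - j) (2 * c); rewrite /rowQ.
have -> : (2 * m + 2 * c - j - (2 * c).+1 = 2 * m - j.+1)%N by lia.
move=> <-; last by lia.
congr (_^`()); apply: eq_bigr => g _.
by have -> : (2 * m + 2 * c - g - j = 2 * m + 2 * c - j - g)%N by lia.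
Qed.

Lemma rowQ1 m c j : (j < 2 * m)%N -> (rowQ m c j).[1] = 0.
Proof.
move=> hj; rewrite /rowQ horner_sum big1 // => g _; have := ltn_ord g => hg.
have -> : (2 * m + 2 * c - g - j = (2 * m + 2 * c - g - j).-1.+1)%N by lia.
by rewrite hornerZ hornerM horner_exp horner_1subX subrr exprS !mul0r mulr0.
Qed.

Lemma rowD_group1 n k m (c : 'I_n) c' (t : R) : n = (k + m)%N -> (k <= m)%N -> (0 < k)%N ->
  (rowD (1 - t) (2 * m) (2 * m + 2 * c') c).[t] = (rowQ m c' (n - c.+1)).[t].
Proof.
move=> hn km k0; rewrite /rowD horner_poly /rowQ horner_sum.
have -> : ((2 * m + 2 * c').+1 - 2 * m = (2 * c').+1)%N by lia.
apply: eq_bigr => g _; have hg := ltn_ord g; have hc := ltn_ord c.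
rewrite hornerZ hornerM horner_exp horner_1subX hornerXn /divpow.
have -> : (n - c.+1 <= 2 * m + 2 * c' - g)%N by lia.
by rewrite -!mulrA mulrCA; congr (_ * _); rewrite mulrCA; congr (_ * _).
Qed.

Lemma divpow_binomial (a t : R) l j :
  \sum_(g < l.+1) divpow a (l - g) j / g`!%:R * t ^+ g = divpow (a + t) l j.
Proof.
rewrite /divpow; case: leqP => h; last first.
  rewrite big1 // => g _; have -> : (j <= l - g)%N = false by lia.
  by rewrite !mul0r.
rewrite exprDn mulr_suml.
rewrite (big_ord_widen_cond l.+1 xpredT (fun g => a ^+ (l - j - g) * t ^+ g *+ 'C(l - j, g) / (l - j)`!%:R)); last by lia.
rewrite [RHS]big_mkcond /=; apply: eq_bigr => g _; have hg := ltn_ord g.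
have -> : (j <= l - g)%N = (g < (l - j).+1)%N by lia.
case: ifP => hgj; last by rewrite !mul0r.
have -> : (l - g - j = l - j - g)%N by lia.
have hgj' : (g <= l - j)%N by lia.
rewrite -(bin_fact hgj') -[_ *+ 'C(_, _)]mulr_natr !natrM.
field.
have b0 : 'C(l - j, g)%:R != 0 :> R by rewrite pnatr_eq0 -lt0n bin_gt0.
by apply/and3P; split; rewrite pnatr_eq0 -lt0n ?fact_gt0 ?bin_gt0.
Qed.

Lemma rowD_group2 n l (c : 'I_n) (t : R) : (rowD (1 - t) 0 l c).[t] = divpow 1 l (n - c.+1).
Proof. by rewrite /rowD horner_poly subn0 divpow_binomial subrK. Qed.

(** [jac] is (1 - X)^(m - k) times this polynomial evaluated at 1 - X. Powers of 1 - X are wanted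
    because they occur in the derivatives of the rows [rowQ]. *)
Definition jacrho (k m d : nat) : {poly R} := (2%:P - 'X) ^+ (m - k) * (1 - 'X) ^+ (2 * d).

Lemma size_jacrho k m d : (k <= m)%N -> (d < k)%N -> (size (jacrho k m d) <= k + m)%N.
Proof.
move=> km dk; rewrite /jacrho.
have s1 (a : R) i : (size (((a%:P - 'X) ^+ i)%R : {poly R}) <= i.+1)%N.
  apply: (leq_trans (size_poly_exp_leq _ _)).
  have : (size ((a%:P - 'X)%R : {poly R}) <= 2)%N.
    by rewrite -opprB size_polyN size_XsubC.
  by case: (size _) => [|[|[|q]]] //= _; lia.
apply: (leq_trans (size_polyMleq _ _)).
move: (s1 2 (m - k)%N) (s1 1 (2 * d)%N); rewrite polyC1.
by set A := size _; set B := size _; lia.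
Qed.

Lemma jac_expand k m d : (k <= m)%N -> (d < k)%N ->
  jac k m d = \sum_(c < k + m) (jacrho k m d)`_c *: (1 - 'X) ^+ (m - k + c).
Proof.
move=> km dk.
have rE : jacrho k m d = \sum_(c < k + m) (jacrho k m d)`_c *: 'X^c.
  rewrite -poly_def; apply/polyP => i; rewrite coef_poly; case: ltnP => // h.
  by rewrite nth_default // (leq_trans (size_jacrho km dk)).
have : (jacrho k m d) \Po (1 - 'X) = (1 + 'X) ^+ (m - k) * 'X^(2 * d).
  rewrite /jacrho rmorphM !rmorphXn /= !rmorphB /= !comp_polyC comp_polyX.
  congr (_ ^+ _ * _ ^+ _).
    by rewrite -[2]/(1 + 1 : R) polyCD; ring.
  by ring.
rewrite {1}rE raddf_sum /= => h.
transitivity ((1 - 'X) ^+ (m - k) * ((1 + 'X) ^+ (m - k) * 'X^(2 * d)) : {poly R}).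
  rewrite /jac mulrA -exprMn; congr (_ ^+ _ * _).
  by rewrite -subr_sqr expr1n.
rewrite -h mulr_sumr; apply: eq_bigr => c _.
by rewrite comp_polyZ rmorphXn /= comp_polyX -scalerAr exprD.
Qed.

Lemma coef_1subX_exp i q : ((1 - 'X : {poly R}) ^+ i)`_q = (-1) ^+ q * ('C(i, q))%:R.
Proof.
rewrite exprBn coef_sum.
have E (j : 'I_i.+1) : ((-1) ^+ j * 1 ^+ (i - j) * 'X^j *+ 'C(i, j) : {poly R})`_q =
    if (j : nat) == q then (-1) ^+ q * ('C(i, q))%:R else 0.
  rewrite expr1n mulr1 coefMn.
  have -> : ((-1) ^+ j * 'X^j : {poly R}) = ((-1) ^+ j) *: 'X^j.
    by rewrite -mul_polyC rmorphXn /= rmorphN1.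
  rewrite coefZ coefXn eq_sym; case: eqP => [<-|_]; last by rewrite mulr0 mul0rn.
  by rewrite mulr1 mulr_natr.
under eq_bigr do rewrite E.
rewrite -big_mkcond /=; case: (ltnP q i.+1) => h.
  by rewrite (big_pred1 (Ordinal h)).
rewrite big_pred0 ?bin_small ?mulr0 // => j.
by apply/negbTE; rewrite neq_ltn (leq_trans (ltn_ord j)).
Qed.

Lemma jac_odd k m d q : odd q -> (jac k m d)`_q = 0.
Proof.
move=> oq; have -> : jac k m d = ((1 - 'X) ^+ (m - k) * 'X^d) \Po 'X^2.
  by rewrite /jac rmorphM !rmorphXn /= rmorphB /= rmorph1 comp_polyX exprM.
by rewrite coef_comp_poly_Xn // dvdn2 oq.
Qed.

(** Up to a factor the sum is the coefficient of X^(2 m - 1 - 2 i) in [jac]. That polynomial is even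
    and the exponent is odd. *)
Lemma jacrho_kernel k m d i : (k <= m)%N -> (d < k)%N -> (i < m)%N ->
  \sum_(c < k + m) divpow 1 (2 * i) (k + m - c.+1) *
    ((jacrho k m d)`_c * (m - k + c)`!%:R) = 0.
Proof.
move=> km dk im; set q := (2 * m - 1 - 2 * i)%N.
have oq : odd q.
  have -> : q = (2 * (m - i.+1)).+1 by rewrite /q; lia.
  by rewrite /= mul2n odd_double.
transitivity (q`!%:R * (-1) ^+ q * (jac k m d)`_q); last by rewrite jac_odd // mulr0.
rewrite jac_expand // coef_sum mulr_sumr; apply: eq_bigr => c _; have hc := ltn_ord c.
rewrite coefZ coef_1subX_exp /divpow expr1n.
have -> : (k + m - c.+1 <= 2 * i)%N = (q <= m - k + c)%N by rewrite /q; lia.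
case: leqP => h; last by rewrite bin_small // !mulr0 mul0r.
have -> : (2 * i - (k + m - c.+1) = m - k + c - q)%N by rewrite /q; lia.
rewrite -(bin_fact h) !natrM.
have s2 : (-1) ^+ q * (-1) ^+ q = 1 :> R by rewrite -expr2 sqrr_sign.
rewrite [RHS](_ : _ = ((-1) ^+ q * (-1) ^+ q) * (q`!%:R * ('C(m - k + c, q)%:R * (jacrho k m d)`_c))); last by ring.
by rewrite s2; field; rewrite pnatr_eq0 -lt0n fact_gt0.
Qed.

Lemma jacrho_free k m (v : 'I_k -> R) : (k <= m)%N ->
  (forall c : 'I_(k + m), \sum_d v d * (jacrho k m d)`_c = 0) -> forall d, v d = 0.
Proof.
move=> km h.
have : \sum_d v d *: jac k m d = 0.
  under eq_bigr => d _ do rewrite jac_expand // scaler_sumr.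
  rewrite exchange_big big1 // => c _ /=.
  under eq_bigr do rewrite scalerA.
  by rewrite -scaler_suml h scale0r.
have -> : \sum_d v d *: jac k m d = (1 - 'X^2) ^+ (m - k) * ((\poly_(d < k) (if insub d is Some d' then v d' else 0)) \Po 'X^2).
  rewrite poly_def raddf_sum mulr_sumr; apply: eq_bigr => d _ /=.
  by rewrite /jac valK comp_polyZ rmorphXn /= comp_polyX -scalerAr exprM.
move/eqP; rewrite mulf_eq0 => /orP[|/eqP h0 d].
  rewrite expf_eq0 => /andP[_ /eqP] /(congr1 (fun p : {poly R} => p.[0])).
  by rewrite !hornerE expr0n /= subr0 => /eqP; rewrite oner_eq0.
have := congr1 (fun p : {poly R} => p`_(2 * d)%N) h0.
rewrite coef_comp_poly_Xn // coef0 dvdn_mulr // mulKn // coef_poly ltn_ord.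
by rewrite valK.
Qed.

Definition jachankel (k m : nat) (t : R) : 'M[R]_k := \matrix_(c, d) jacmom k m (c + d) t.

(** [K] serves twice: its columns are annihilated by the last m rows, which do not depend on t, and
    the same columns combine the derivatives of the first k rows into [jac] times an even power.
    Being zero at 1, these combinations are integrals over [t, 1]. *)
Lemma Cnt_jachankel k m : (0 < k <= m)%N -> exists C : R, forall t : R,
  \sum_(q < 'C(k + m, 2).+1) ('C('C(k + m, 2), q))%:R * t ^+ q * (1 - t) ^+ ('C(k + m, 2) - q)
    * (Cnt (k + m) k q)%:R = C * \det (jachankel k m t).
Proof.
move=> /andP[k0 km]; have kn : (0 < k < k + m)%N by lia.
have [kap kap0 H] := detD_Cnt R kn.
pose K : 'M[R]_(k + m, k) := \matrix_(c, d) ((jacrho k m d)`_c * (m - k + c)`!%:R).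
pose E1 : 'M[R]_(m, k + m) := \matrix_(i, c) divpow 1 (2 * (m - i.+1)) (k + m - c.+1).
pose E2 (t : R) : 'M[R]_(k, k + m) := \matrix_(i, c) (rowQ m (k - i.+1) (k + m - c.+1)).[t].
have EK : E1 *m K = 0.
  apply/matrixP => i d; rewrite !mxE; under eq_bigr do rewrite !mxE.
  by apply: jacrho_kernel => //; have := ltn_ord i; lia.
have fK : row_free K^T.
  rewrite -kermx_eq0; apply/eqP/row_matrixP => i; rewrite row0.
  have : row i (kermx K^T) *m K^T = 0 by apply/sub_kermxP; exact: row_sub.
  set v := row i _ => hv; apply/rowP => d; rewrite [RHS]mxE.
  apply: (@jacrho_free k m (fun d => v 0 d) km) => c.
  have := congr1 (fun M : 'M_(1, k + m) => M 0 c) hv; rewrite mxE [RHS]mxE.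
  under eq_bigr do rewrite [K^T _ _]mxE [K _ _]mxE mulrA.
  by rewrite -mulr_suml => /eqP; rewrite mulf_eq0 (negbTE (factr_neq0 _ _)) orbF => /eqP.
have [C HC] := det_col_mx_kernel fK EK.
(* Row i of the determinant carries the moment index k - 1 - i and the factor 1 / (2 c)! from
   [rowQ_deriv]; [L] accounts for the reversal and for this factor. *)
pose L : 'M[R]_k := \matrix_(i, c) ((c == rev_ord i)%:R / (2 * c)`!%:R).
exists (kap^-1 * C * \det L) => t.
rewrite -!mulrA -[LHS](mulKf kap0); congr (_ * _).
transitivity ((detD (k + m) k (1 - t) (stair (k + m))).[t]).
  by rewrite -H; congr (_ * _); apply: eq_bigr => q _; rewrite !mulrA.
rewrite -det_mulmx.
have -> : L *m jachankel k m t = E2 t *m K.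
  apply/matrixP => i d; rewrite !mxE (bigD1 (rev_ord i)) //= big1 => [|c /negbTE hc]; last first.
    by rewrite !mxE hc !mul0r.
  rewrite !mxE eqxx mul1r addr0.
  pose W := \sum_(c < k + m) K c d *: rowQ m (k - i.+1) (k + m - c.+1).
  have hi := ltn_ord i.
  have <- : W.[t] = \sum_j E2 t i j * K j d.
    rewrite horner_sum; apply: eq_bigr => c _; rewrite hornerZ mulrC.
    by rewrite [E2 t i c]mxE.
  apply/esym; apply: jacmom_unique; last first.
    by rewrite horner_sum big1 // => c _; rewrite hornerZ rowQ1 ?mulr0 //; have := ltn_ord c; lia.
  rewrite raddf_sum /=.
  have -> : jac k m (k - i.+1 + d) = jac k m d * 'X^(2 * (k - i.+1)).
    by rewrite /jac mulnDr exprD -!mulrA [X in _ * X]mulrC.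
  rewrite jac_expand // mulr_suml scaler_sumr -sumrN; apply: eq_bigr => c _.
  have hc := ltn_ord c.
  rewrite derivZ rowQ_deriv; last by lia.
  rewrite scalerN scalerA; congr (- _).
  have -> : (2 * m - (k + m - c.+1).+1 = m - k + c)%N by lia.
  rewrite -scalerAl scalerA; congr (_ *: _).
  by rewrite mxE; field; rewrite !factr_neq0.
rewrite -HC /detD /rowdet -[LHS]/(horner_eval t _) -det_map_mx; congr (\det _).
apply/matrixP => p c; rewrite !mxE /= /horner_eval /shifted /stair.
have nE : (k + m - k = m)%N by lia.
case: split_ordP => i ->; rewrite /= mxE.
  have hi := ltn_ord i.
  rewrite nE -(rowD_group1 _ _ _ (erefl _)) //; congr ((rowD _ _ _ _).[_]); lia.
rewrite rowD_group2; congr (divpow _ _ _); have := ltn_ord i; lia.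
Qed.

End Moments.

(** * Existence of a sorting network *)

Lemma foldl_swap_cat l r s : all (fun k => 0 < k < size l)%N s ->
  foldl swap_at (l ++ r) s = foldl swap_at l s ++ r.
Proof.
elim: s l => //= -[|j] s IH l /andP[//= hj hs].
have [l1 [a [b [l2 [hl s1]]]]] := adjacent_split hj.
have -> : swap_at (l ++ r) j.+1 = swap_at l j.+1 ++ r.
  by rewrite hl -catA /= -s1 !swap_at_cat -catA.
by rewrite IH // size_swap_at.
Qed.

Lemma foldl_swap_back l x : foldl swap_at (l ++ [:: x]) (rev (iota 1 (size l))) = x :: l.
Proof.
elim/last_ind: l x => [|l y IH] x //; rewrite size_rcons.
have -> : iota 1 (size l).+1 = rcons (iota 1 (size l)) (size l).+1.
  by rewrite -cats1 -[(size l).+1]addn1 iotaD add1n addn1.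
rewrite rev_rcons /= -cats1 -catA swap_at_cat /=.
rewrite -[l ++ [:: x, y & [::]]]/(l ++ ([:: x] ++ [:: y])) catA foldl_swap_cat ?IH //.
by apply/allP => i; rewrite mem_rev mem_iota size_cat /=; lia.
Qed.

(** Reverse the first n entries, then carry the entry n + 1 from the last place to the front. *)
Lemma bubble_word n : exists2 s : seq nat, size s = 'C(n, 2) /\ all (fun x => 0 < x < n)%N s &
  apply_swaps n s = rev (iota 1 n).
Proof.
elim: n => [|n [s [ss hs] IH]]; first by exists [::].
exists (s ++ rev (iota 1 n)).
  rewrite size_cat ss size_rev size_iota binS bin1 addnC; split=> //.
  rewrite all_cat; apply/andP; split.
    by apply: sub_all hs => x; lia.
  by apply/allP => i; rewrite mem_rev mem_iota; lia.
have E : iota 1 n.+1 = iota 1 n ++ [:: n.+1] by rewrite -[n.+1]addn1 iotaD add1n addn1.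
rewrite /apply_swaps E foldl_cat foldl_swap_cat ?size_iota // -/(apply_swaps n s) IH.
have := foldl_swap_back (rev (iota 1 n)) n.+1; rewrite size_rev size_iota => ->.
by rewrite rev_cat.
Qed.

Lemma Omega_gt0 n : (0 < #|Omega n|)%N.
Proof.
have [s [ss hs] hw] := bubble_word n.
have s_lt (i : nat) : i \in s -> (i < n)%N by move=> /(allP hs) /andP[].
pose t : seq 'I_n := pmap insub s.
have tE : map val t = s.
  rewrite /t pmap_filter; last exact: insubK.
  apply/all_filterP/allP => i /s_lt hi; by rewrite /isSome insubT.
have st : size t == 'C(n, 2) by rewrite -ss -tE size_map.
apply/card_gt0P; exists (Tuple st); rewrite inE /= tE hw eqxx andbT.
have := hs; rewrite -tE all_map; apply: sub_all => x /=; lia.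
Qed.

From mathcomp Require Import finmap complex.
From mathcomp Require Import all_classical all_reals all_analysis.
From mathcomp Require Import measurable_realfun.
From mathcomp Require mpoly.
Import -(notations) mpoly.
Import Order.TTheory GRing.Theory Num.Theory.
Import numFieldNormedType.Exports.
Local Open Scope ring_scope.
Local Open Scope classical_set_scope.

(** * Gaussian integrals *)

Section Normal.
Variable R : realType.
Notation mu := (@lebesgue_measure R).
Notation Nrm := (@normal_prob R 0 1).

(** Identifies the Radon-Nikodym derivative with the explicit density by comparing integrals over
    measurable sets; integrals against the normal law become Lebesgue integrals through it. *)
Lemma normal_density_ae : ae_eq mu setT (Radon_Nikodym_SigmaFinite.f Nrm mu)
  (fun x => (normal_pdf 0 1 x)%:E).
Proof.
apply: integral_ae_eq => //=.
- by apply: Radon_Nikodym_SigmaFinite.f_integrable; exact: normal_prob_dominates.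
- by apply/measurable_EFinP; exact: measurable_normal_pdf.
- move=> E _ mE; rewrite -Radon_Nikodym_SigmaFinite.f_integral //.
  exact: normal_prob_dominates.
Qed.

Lemma ge0_integral_normal (f : R -> \bar R) : measurable_fun setT f -> (forall x, 0 <= f x)%E ->
  (\int[Nrm]_x f x = \int[mu]_x (f x * (normal_pdf 0 1 x)%:E))%E.
Proof.
move=> mf f0.
rewrite -(Radon_Nikodym_SigmaFinite.change_of_variables (normal_prob_dominates 0 1)) //.
apply: ae_eq_integral => //.
- apply: emeasurable_funM => //; apply: (measurable_int mu).
  by apply: Radon_Nikodym_SigmaFinite.f_integrable; exact: normal_prob_dominates.
- apply: emeasurable_funM => //; apply/measurable_EFinP; exact: measurable_normal_pdf.
- apply: ae_eqe_mul2l; exact: normal_density_ae.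
Qed.

Lemma integral_normal (f : R -> R) : measurable_fun setT f ->
  (\int[Nrm]_x (f x)%:E = \int[mu]_x (f x * normal_pdf 0 1 x)%:E)%E.
Proof.
move=> mf; rewrite integralE [RHS]integralE.
have mf' : measurable_fun setT (fun x => (f x)%:E) by exact/measurable_EFinP.
have p0 x : 0 <= normal_pdf 0 1 x :> R by exact: normal_pdf_ge0.
have E1 : (\int[Nrm]_x ((fun x => (f x)%:E)^\+ x) =
    \int[mu]_x ((fun x => (f x * normal_pdf 0 1 x)%:E)^\+ x))%E.
  rewrite ge0_integral_normal //; last exact: measurable_funepos.
  apply: eq_integral => x _; rewrite !funeposE -!EFin_max -EFinM; congr EFin.
  by rewrite maxr_pMl // mul0r.
have E2 : (\int[Nrm]_x ((fun x => (f x)%:E)^\- x) =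
    \int[mu]_x ((fun x => (f x * normal_pdf 0 1 x)%:E)^\- x))%E.
  rewrite ge0_integral_normal //; last exact: measurable_funeneg.
  apply: eq_integral => x _; rewrite !funenegE -!EFinN -!EFin_max -EFinM; congr EFin.
  by rewrite maxr_pMl // mul0r mulNr.
by rewrite E1 E2.
Qed.

Lemma poly_le_exp (r : nat) (c : R) : 0 < c ->
  exists2 C : R, 0 <= C & forall y : R, (1 + y ^+ 2) ^+ r <= C * expR (c * y ^+ 2).
Proof.
move=> c0; case: r => [|r].
  exists 1 => // y; rewrite expr0 mul1r.
  by rewrite (le_trans _ (expR_ge1Dx _)) // lerDl mulr_ge0 ?sqr_ge0 // ltW.
exists (r.+1`!%:R / c ^+ r.+1 * expR c) => [|y].
  by rewrite !mulr_ge0 ?expR_ge0 // invr_ge0 exprn_ge0 // ltW.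
have h0 : 0 <= c * (1 + y ^+ 2) by rewrite mulr_ge0 ?addr_ge0 ?sqr_ge0 // ltW.
have := expR_ge1Dxn r h0; rewrite mulrDr mulr1 expRD => h.
have {}h : (c + c * y ^+ 2) ^+ r.+1 / r.+1`!%:R <= expR c * expR (c * y ^+ 2).
  by apply: le_trans h; rewrite lerDr.
have K0 : 0 <= r.+1`!%:R / c ^+ r.+1 by rewrite mulr_ge0 // invr_ge0 exprn_ge0 // ltW.
rewrite -[X in _ <= X]mulrA; apply: (le_trans _ (ler_wpM2l K0 h)).
rewrite (_ : c + c * y ^+ 2 = c * (1 + y ^+ 2)); last by rewrite mulrDr mulr1.
rewrite exprMn [X in _ <= X](_ : _ = (1 + y ^+ 2) ^+ r.+1) //.
field; rewrite expf_neq0 ?gt_eqF //=.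
Qed.

Lemma normal_pdf01 (x : R) : normal_pdf 0 1 x = normal_peak 1 * expR (- (x ^+ 2 / 2)).
Proof.
rewrite normal_pdfE ?oner_neq0 //= /normal_fun subr0 expr1n mulNr.
by congr (_ * expR (- (_ / _))); rewrite mulr2n.
Qed.

Lemma measurable_expR_sqr (c : R) : measurable_fun setT (fun y : R => expR (c * y ^+ 2)).
Proof.
apply: measurableT_comp; first exact: measurable_expR.
by apply: measurable_funM => //; exact: measurable_funX.
Qed.

Lemma integrable_gauss (c : R) : 0 < c -> mu.-integrable setT (fun y : R => (expR (- (c * y ^+ 2)))%:E).
Proof.
move=> c0; pose s := Num.sqrt (2 * c)^-1.
have s0 : s != 0 by rewrite sqrtr_eq0 -ltNge invr_gt0 mulr_gt0.
have E y : expR (- (c * y ^+ 2)) = (normal_peak s)^-1 * normal_pdf 0 s y.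
  rewrite normal_pdfE // mulrA mulVf ?mul1r; last by rewrite gt_eqF // normal_peak_gt0.
  rewrite /normal_fun subr0 sqr_sqrtr ?invr_ge0 ?mulr_ge0 ?ltW //; congr expR.
  rewrite mulNr; congr (- _); rewrite mulrC; congr (_ * _).
  by rewrite -mulr_natl; field; rewrite gt_eqF.
rewrite (_ : (fun _ => _) = (fun y => ((normal_peak s)^-1)%:E * (normal_pdf 0 s y)%:E)%E); last first.
  by apply/funext => y; rewrite E EFinM.
by apply: integrableZl => //; exact: integrable_normal_pdf.
Qed.

Lemma integrable_normal_exp (c : R) : c < 2^-1 ->
  Nrm.-integrable setT (fun y : R => (expR (c * y ^+ 2))%:E).
Proof.
move=> c2; have mf := measurable_expR_sqr c.
apply/integrableP; split; first exact/measurable_EFinP.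
rewrite ge0_integral_normal //; last first.
  by apply: measurableT_comp => //; exact/measurable_EFinP.
have E (x : R) : (`|(expR (c * x ^+ 2))%:E| * (normal_pdf 0 1 x)%:E =
   (normal_peak 1)%:E * (expR (- ((2^-1 - c) * x ^+ 2)))%:E)%E.
  rewrite abse_EFin ger0_norm ?expR_ge0 // -!EFinM normal_pdf01 mulrCA -expRD.
  by congr (_ * expR _)%:E; field.
under eq_integral do rewrite E.
have c0 : 0 < 2^-1 - c by rewrite subr_gt0.
have := integrable_gauss c0 => /integrableP[mg fing].
rewrite ge0_integralZl //.
- rewrite lte_mul_pinfty ?lee_fin ?normal_peak_ge0 //.
  apply: le_lt_trans fing; rewrite le_eqVlt; apply/orP; left; apply/eqP.
  by apply: eq_integral => x _; rewrite gee0_abs // lee_fin expR_ge0.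
- by rewrite lee_fin normal_peak_ge0.
Qed.

End Normal.

(** * Gaussian integration by parts in one variable *)

Section Stein.
Variable R : realType.
Notation mu := (@lebesgue_measure R).
Notation Nrm := (@normal_prob R 0 1).

Lemma cvg_integral_symitv (h : R -> R) (b : R -> R) : continuous h ->
  (forall y, `|h y| <= b y) -> mu.-integrable setT (fun y => (b y)%:E) ->
  (\int[mu]_(y in `[(- n.+1%:R)%R, n.+1%:R%R]) (h y)%:E @[n --> \oo] --> \int[mu]_y (h y)%:E)%E.
Proof.
move=> ch hb ib.
have mh : measurable_fun setT h by exact: continuous_measurable_fun.
pose f_ (n : nat) (y : R) : \bar R := (((fun y => (h y)%:E) \_ `[(- n.+1%:R)%R, n.+1%:R%R]) y)%E.
have -> : (fun n : nat => \int[mu]_(y in `[(- n.+1%:R)%R, n.+1%:R%R]) (h y)%:E)%E =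
    (fun n => \int[mu]_y f_ n y)%E.
  by apply/funext => n; rewrite integral_mkcond.
apply: (@dominated_cvg _ _ _ mu setT measurableT f_ _ (fun y => (b y)%:E)) => //.
- move=> n; apply/(measurable_restrictT _ _).1 => //.
  by apply/measurable_EFinP; exact: measurable_funTS.
- move=> y _; apply: cvg_near_cst.
  near=> n; rewrite /f_ patchE mem_set //= in_itv /= -ler_norml.
  near: n; exists (Num.truncn `|y|) => // n /= hn.
  by rewrite (le_trans (ltW (truncnS_gt _))) // ler_nat.
- move=> n y _; rewrite /f_ patchE; case: ifPn => _; first by rewrite lee_fin.
  by rewrite abse0 lee_fin (le_trans _ (hb y)).
Unshelve. all: by end_near.
Qed.

Lemma FTC_is_derive (F f : R -> R) (a b : R) : a < b ->
  (forall x : R, is_derive x 1 F (f x)) -> continuous f ->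
  (\int[mu]_(x in `[a, b]) (f x)%:E = (F b - F a)%:E)%E.
Proof.
move=> ab dF cf.
have cF : continuous F.
  by move=> x; apply/differentiable_continuous/derivable1_diffP; exact: ex_derive.
rewrite (@continuous_FTC2 _ f F) //.
- by apply: continuous_subspaceT.
- split.
  + by move=> x _; exact: ex_derive.
  + exact/cvg_at_right_filter/cF.
  + exact/cvg_at_left_filter/cF.
- by move=> x _; rewrite derive1E derive_val.
Qed.

Definition gphi (y : R) : R := normal_peak 1 * expR (- (y ^+ 2 / 2)).

Lemma is_derive_expN2 (c y : R) : is_derive y 1 (fun y : R => expR (- (c * y ^+ 2))) (- (2 * c * y) * expR (- (c * y ^+ 2))).
Proof.
have d1 : is_derive y 1 (fun y : R => - (c * y ^+ 2)) (- (2 * c * y)).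
  have -> : (fun y : R => - (c * y ^+ 2)) = (horner (- (c *: 'X^2))).
    by apply/funext => z; rewrite hornerN hornerZ hornerXn.
  apply: is_derive_eq; rewrite derivN derivZ derivXn hornerN hornerZ hornerMn hornerXn /=.
  by rewrite expr1; ring.
have := @is_derive1_comp R expR (fun y : R => - (c * y ^+ 2)) y _ _ (is_derive_expR _) d1.
by move=> h; apply: is_derive_eq h _; rewrite mulrC.
Qed.

Lemma is_derive_gphi (y : R) : is_derive y 1 gphi (- (y * gphi y)).
Proof.
have h := is_derive_expN2 2^-1 y.
have hc : is_derive y 1 (cst (normal_peak 1 : R)) 0 by exact: is_derive_cst.
have hm := is_deriveM hc h.
have E : gphi = (cst (normal_peak 1 : R)) * (fun y : R => expR (- (2^-1 * y ^+ 2))).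
  by apply/funext => z; rewrite /gphi [_ / 2]mulrC.
rewrite [X in is_derive _ _ X _]E; apply: is_derive_eq hm _.
rewrite /gphi /GRing.scale /= [y ^+ 2 / 2]mulrC.
by field.
Qed.

Lemma continuous_gphi : continuous gphi.
Proof.
move=> y; apply/differentiable_continuous/derivable1_diffP.
by apply: ex_derive; exact: is_derive_gphi.
Qed.

(** With the density phi, (y g - g') phi is the derivative of - g phi, and the boundary terms at - n
    - 1 and n + 1 vanish in the limit. The exponent 1/8 leaves room for the factor y: 1/8 + 1/8 -
    1/2 = - 1/4. *)
Lemma stein1 (g g' : R -> R) (C : R) : (forall y : R, is_derive y 1 g (g' y)) -> continuous g' ->
  (forall y, `|g y| <= C * expR (8^-1 * y ^+ 2)) ->
  (forall y, `|g' y| <= C * expR (8^-1 * y ^+ 2)) ->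
  (\int[Nrm]_y (y * g y - g' y)%:E = 0)%E.
Proof.
move=> dg cg' gb gb'.
have cg : continuous g.
  by move=> x; apply/differentiable_continuous/derivable1_diffP; exact: ex_derive.
have C0 : 0 <= C.
  have := le_trans (normr_ge0 _) (gb 0); rewrite pmulr_lge0 // expR_gt0.
have cf : continuous (fun y : R => y * g y - g' y).
  by move=> y; apply: cvgB; [apply: cvgM; [exact: cvg_id|exact: cg]|exact: cg'].
rewrite integral_normal; last exact: continuous_measurable_fun.
pose h (y : R) := (y * g y - g' y) * gphi y.
transitivity (\int[mu]_y (h y)%:E)%E.
  by apply: eq_integral => y _; rewrite /h normal_pdf01.
have ch : continuous h by move=> y; apply: cvgM; [exact: cf|exact: continuous_gphi].
have p0 : 0 <= normal_peak 1 :> R by exact: normal_peak_ge0.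
have i8 : 0 < 8^-1 :> R by [].
have [C1 C10 hC1] := poly_le_exp 1 i8.
pose b (y : R) := (2 * C * C1 * normal_peak 1) * expR (- (4^-1 * y ^+ 2)).
have hb y : `|h y| <= b y.
  rewrite /h /gphi normrM [ `|normal_peak 1 * _|]ger0_norm; last by rewrite mulr_ge0 ?expR_ge0.
  have h1 : `|y * g y - g' y| <= 2 * C * C1 * expR (4^-1 * y ^+ 2).
    apply: (le_trans (ler_normB _ _)); rewrite normrM.
    apply: (@le_trans _ _ ((`|y| + 1) * (C * expR (8^-1 * y ^+ 2)))).
      by rewrite mulrDl mul1r lerD // ler_wpM2l.
    have y1 : `|y| + 1 <= 2 * (C1 * expR (8^-1 * y ^+ 2)).
      have := hC1 y; rewrite expr1.
      have : 2 * `|y| <= 1 + y ^+ 2.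
        rewrite -real_normK ?num_real //; have := sqr_ge0 (`|y| - 1); lra.
      have := normr_ge0 y; have := sqr_ge0 y; lra.
    apply: (le_trans (ler_wpM2r _ y1)); first by rewrite mulr_ge0 ?expR_ge0.
    have -> : 4^-1 * y ^+ 2 = 8^-1 * y ^+ 2 + 8^-1 * y ^+ 2 by field.
    by rewrite expRD le_eqVlt; apply/orP; left; apply/eqP; ring.
  apply: (le_trans (ler_wpM2r _ h1)); first by rewrite mulr_ge0 ?expR_ge0.
  have E : expR (- (4^-1 * y ^+ 2)) = expR (4^-1 * y ^+ 2) * expR (- (y ^+ 2 / 2)).
    by rewrite -expRD; congr expR; field.
  by rewrite /b E le_eqVlt; apply/orP; left; apply/eqP; ring.
have ib : mu.-integrable setT (fun y => (b y)%:E).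
  rewrite (_ : (fun _ => _) = (fun y => (2 * C * C1 * normal_peak 1)%:E * (expR (- (4^-1 * y ^+ 2)))%:E)%E).
    by apply: integrableZl => //; exact: integrable_gauss.
  by apply/funext => y; rewrite -EFinM.
have cvh := cvg_integral_symitv ch hb ib.
pose G (y : R) := - (g y * gphi y).
have dG (y : R) : is_derive y 1 G (h y).
  have := is_deriveN (is_deriveM (dg y) (is_derive_gphi y)).
  move=> hh; apply: is_derive_eq hh _; rewrite /h /GRing.scale /=; ring.
have cv0 : (\int[mu]_(y in `[(- n.+1%:R)%R, n.+1%:R%R]) (h y)%:E @[n --> \oo] --> 0%:E)%E.
  have -> : (fun n : nat => \int[mu]_(y in `[(- n.+1%:R)%R, n.+1%:R%R]) (h y)%:E)%E =
      (fun n : nat => (G n.+1%:R - G (- n.+1%:R))%:E).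
    apply/funext => n; rewrite (FTC_is_derive (F := G)) //.
    by rewrite (lt_trans (y := 0)) // oppr_lt0.
  apply: cvg_EFin; first by near=> n.
  have Gb (y : R) : `|G y| <= (C * normal_peak 1) * (expR (- (4^-1 * y ^+ 2))).
    rewrite /G normrN normrM [ `|gphi y|]ger0_norm; last by rewrite mulr_ge0 ?expR_ge0.
    apply: (le_trans (ler_wpM2r _ (gb y))); first by rewrite mulr_ge0 ?expR_ge0.
    rewrite /gphi [X in X <= _](_ : _ = C * normal_peak 1 * expR (8^-1 * y ^+ 2 - y ^+ 2 / 2)); last first.
      by rewrite expRD; ring.
    rewrite ler_wpM2l ?mulr_ge0 // ler_expR; have := sqr_ge0 y; lra.
  have Eb (n : nat) : expR (- (4^-1 * n.+1%:R ^+ 2)) <= 4 * n.+1%:R^-1 :> R.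
    rewrite expRN -[4]invrK -invfM lef_pV2 ?posrE ?expR_gt0 //.
    apply: le_trans (expR_ge1Dx _).
    have : 1 <= n.+1%:R :> R by rewrite ler1n.
    move: (n.+1%:R) => u u1.
    have u2 : u <= u ^+ 2 by rewrite expr2 ler_peMl // (le_trans ler01).
    lra.
  have Gn (n : nat) : `|G n.+1%:R - G (- n.+1%:R)| <= 8 * (C * normal_peak 1) * n.+1%:R^-1.
    apply: (le_trans (ler_normB _ _)).
    have := Gb n.+1%:R; have := Gb (- n.+1%:R); rewrite sqrrN => h1 h2.
    apply: (le_trans (lerD h2 h1)).
    have := ler_wpM2l (mulr_ge0 C0 p0) (Eb n); move: (expR _) (n.+1%:R^-1) (C * _) => E iu K hh; lra.
  apply/cvgr0Pnorm_le => e e0.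
  have hcv : (8 * (C * normal_peak 1) * n.+1%:R^-1 : R) @[n --> \oo] --> (0 : R).
    rewrite -[X in _ --> X](mulr0 (8 * (C * normal_peak 1))); apply: cvgMr.
    exact: cvg_harmonic.
  have /cvgr0Pnorm_le /(_ _ e0) := hcv.
  apply: filterS => n hn; apply: (le_trans (Gn n)); apply: le_trans hn.
  by rewrite ler_norm.
exact: (cvg_unique (@ereal_hausdorff R) cvh cv0).
Unshelve. all: by end_near.
Qed.

End Stein.

(** * The law of independent Gaussian coordinates on sequences *)

Section Gamma.
Variable R : realType.
Notation Nrm := (@normal_prob R 0 1).

Definition coord_sets : set (set (nat -> R)) :=
  [set A | exists i (B : set R), measurable B /\ A = (fun v : nat -> R => v i) @^-1` B].

Notation seqspace := (g_sigma_algebraType coord_sets).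

Lemma measurable_coord i : measurable_fun setT (fun v : seqspace => v i : R).
Proof.
move=> _ B mB; rewrite setTI; apply: sub_sigma_algebra.
by exists i, B.
Qed.

Lemma measurable_to_seqspace d (T : measurableType d) (f : T -> seqspace) :
  (forall i, measurable_fun setT (fun t => f t i : R)) -> measurable_fun setT f.
Proof.
move=> mf; apply: (@measurability _ _ T seqspace setT f coord_sets) => //.
move=> _ [_ [i [B [mB ->]] <-]]; rewrite setTI.
by have := mf i measurableT B mB; rewrite setTI.
Qed.

Definition updv (m : nat) (z : (measurableTypeR R * seqspace)%type) : seqspace :=
  fun i => if i == m then z.1 else z.2 i.

Lemma measurable_updv m : measurable_fun setT (updv m).
Proof.
apply: measurable_to_seqspace => i; rewrite /updv; case: eqP => _ //.
  exact: measurable_fst.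
exact: (measurableT_comp (measurable_coord i) measurable_snd).
Qed.

HB.instance Definition _ m := isMeasurableFun.Build _ _ _ _ (updv m) (measurable_updv m).

(** Coordinates below m are independent standard normals and the others are 0; they are adjoined in
    the order in which [gauss_iter] integrates. *)
Fixpoint gam (m : nat) : probability seqspace R :=
  match m with
  | 0%N => @dirac _ seqspace (fun _ => 0) R
  | m'.+1 => distribution (Nrm \x gam m')%E (updv m')
  end.

Lemma measurable_updv2 m (y : R) : measurable_fun setT (fun v : seqspace => updv m (y, v)).
Proof.
apply: measurable_to_seqspace => i; rewrite /updv /=; case: eqP => _ //.
exact: measurable_coord.
Qed.

Lemma ge0_integral_gamS m (f : seqspace -> \bar R) : measurable_fun setT f -> (forall v, 0 <= f v)%E ->
  (\int[gam m.+1]_v f v = \int[Nrm]_y \int[gam m]_v f (updv m (y, v)))%E.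
Proof.
move=> mf f0; rewrite /= /distribution (ge0_integral_pushforward (measurable_updv m)) //=.
rewrite preimage_setT fubini_tonelli1 //.
exact: (measurableT_comp mf (measurable_updv m)).
Qed.

Lemma gauss_iterE m (f : (nat -> R) -> \bar R) : measurable_fun setT (f : seqspace -> \bar R) ->
  (forall v, 0 <= f v)%E -> gauss_iter m f = (\int[gam m]_v f v)%E.
Proof.
elim: m f => [|m IH] f mf f0.
  by rewrite /= integral_dirac // diracT mul1e.
rewrite ge0_integral_gamS //=; apply: eq_integral => y _.
rewrite IH //.
exact: (measurableT_comp mf (measurable_updv2 m y)).
Qed.

Lemma integral_gam_prod m (f : nat -> R -> R) :
  (forall i, measurable_fun setT (f i)) -> (forall i y, 0 <= f i y) ->
  (\int[gam m]_v (\prod_(i < m) f i (v i))%:E = \prod_(i < m) \int[Nrm]_y (f i y)%:E)%E.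
Proof.
move=> mf f0.
have mp m' : measurable_fun setT (fun v : seqspace => \prod_(i < m') f i (v i)).
  apply: measurable_prod => i _; exact: (measurableT_comp (mf i) (measurable_coord i)).
have p0 m' (v : seqspace) : 0 <= \prod_(i < m') f i (v i) by rewrite prodr_ge0.
elim: m => [|m IH].
  rewrite big_ord0; under eq_integral do rewrite big_ord0.
  by rewrite /= integral_dirac // diracT mul1e.
rewrite ge0_integral_gamS; last 2 first.
- exact/measurable_EFinP.
- by move=> v; rewrite lee_fin.
rewrite big_ord_recr /= -IH.
have I0 : (0 <= \int[gam m]_v (\prod_(i < m) f i (v i))%:E)%E.
  by apply: integral_ge0 => v _; rewrite lee_fin.
rewrite muleC -ge0_integralZr //; last 2 first.
- by have h := mf m; apply/measurable_EFinP; exact: h.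
- by move=> y _; rewrite lee_fin.
apply: eq_integral => y _.
under eq_integral.
  move=> v _; rewrite big_ord_recr /= {2}/updv eqxx /= mulrC EFinM.
  rewrite (eq_bigr (fun i : 'I_m => f i (v i))); last first.
    by move=> i _; rewrite /updv /= ltn_eqF.
  over.
rewrite /= ge0_integralZl //.
- by apply/measurable_EFinP; exact: mp.
- by move=> v _; rewrite lee_fin; exact: p0.
- by rewrite lee_fin.
Qed.

Definition sqnorm (m : nat) (v : nat -> R) : R := \sum_(i < m) v i ^+ 2.

Lemma measurable_sqnorm m : measurable_fun setT (sqnorm m : seqspace -> R).
Proof.
rewrite /sqnorm; apply: measurable_sum => i; apply: measurable_funX; exact: measurable_coord.
Qed.

Lemma integrable_gam_exp m (c : R) : c < 2^-1 ->
  (gam m).-integrable setT (fun v : seqspace => (expR (c * sqnorm m v))%:E).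
Proof.
move=> c2; apply/integrableP; split.
  apply/measurable_EFinP; apply: measurableT_comp; first exact: measurable_expR.
  by apply: measurable_funM => //; exact: measurable_sqnorm.
rewrite (eq_integral (fun v : seqspace => (\prod_(i < m) expR (c * v i ^+ 2))%:E)); last first.
  move=> v _; rewrite gee0_abs ?lee_fin ?expR_ge0 //; congr EFin.
  by rewrite /sqnorm mulr_sumr expR_sum.
rewrite (integral_gam_prod m (f := fun _ y => expR (c * y ^+ 2))); last 2 first.
- by move=> _; exact: measurable_expR_sqr.
- by move=> _ y; rewrite expR_ge0.
have /integrableP[_ fin] := integrable_normal_exp c2.
have {}fin : (\int[Nrm]_y (expR (c * y ^+ 2))%:E < +oo)%E.
  apply: le_lt_trans fin; rewrite le_eqVlt; apply/orP; left; apply/eqP.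
  by apply: eq_integral => y _; rewrite gee0_abs // lee_fin expR_ge0.
have fn : (\int[Nrm]_y (expR (c * y ^+ 2))%:E)%E \is a fin_num.
  rewrite ge0_fin_numE //; apply: integral_ge0 => y _; by rewrite lee_fin expR_ge0.
by rewrite -(fineK fn) prodEFin ltry.
Qed.

Lemma integrable_gam_bounded m (F : seqspace -> R) (K c : R) : c < 2^-1 ->
  measurable_fun setT F -> (forall v, `|F v| <= K * expR (c * sqnorm m v)) ->
  (gam m).-integrable setT (fun v => (F v)%:E).
Proof.
move=> c2 mF hF.
apply: (@le_integrable _ _ _ (gam m) setT measurableT _ (fun v => (K * expR (c * sqnorm m v))%:E)).
- exact/measurable_EFinP.
- by move=> v _; rewrite !abse_EFin lee_fin (le_trans (hF v)) // ler_norm.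
rewrite (_ : (fun _ => _) = (fun v => K%:E * (expR (c * sqnorm m v))%:E)%E); last first.
  by apply/funext => v; rewrite EFinM.
by apply: integrableZl => //; exact: integrable_gam_exp.
Qed.

Lemma sqnorm_updv m j (y : R) v : (j < m)%N ->
  sqnorm m (updv j (y, v)) = y ^+ 2 + \sum_(i < m | i != j :> nat) v i ^+ 2.
Proof.
move=> jm; rewrite /sqnorm (bigD1 (Ordinal jm)) //= {1}/updv eqxx /=; congr (_ + _).
by apply: eq_bigr => i; rewrite -val_eqE /= /updv => /negbTE ->.
Qed.

(** Induction peels off the top coordinate. Fubini puts it inside when it is the coordinate j and
    outside otherwise. The bound exp(|v|^2 / 4) is integrable and keeps its form, with another
    constant, when a coordinate is frozen. *)
Lemma gam_slice0 m j (F : seqspace -> R) (K : R) : (j < m)%N -> measurable_fun setT F ->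
  (forall v, `|F v| <= K * expR (4^-1 * sqnorm m v)) ->
  (forall v, \int[Nrm]_y (F (updv j (y, v)))%:E = 0)%E ->
  (\int[gam m]_v (F v)%:E = 0)%E.
Proof.
elim: m F K => // m IH F K jm mF hF hs.
have i4 : 4^-1 < 2^-1 :> R by lra.
have iF := integrable_gam_bounded i4 mF hF.
have mFu : measurable_fun setT (fun z : R * seqspace => (F (updv m z))%:E).
  by apply/measurable_EFinP; exact: (measurableT_comp mF (measurable_updv m)).
have iFu : (Nrm \x gam m)%E.-integrable setT (fun z => (F (updv m z))%:E).
  move/integrableP: iF => [_ fin]; apply/integrableP; split => //.
  move: fin; rewrite /= /distribution (ge0_integral_pushforward (measurable_updv m)) //=.
  - by apply/measurable_EFinP; exact: measurableT_comp.
have E : (\int[gam m.+1]_v (F v)%:E = \int[Nrm \x gam m]_z (F (updv m z))%:E)%E.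
  rewrite /= /distribution (integral_pushforward (measurable_updv m)) //.
  - exact/measurable_EFinP.
rewrite E; move: jm; rewrite ltnS leq_eqVlt => /orP[/eqP jm|jm].
  rewrite -(integral21_prod_meas1 iFu) /fubini_G; apply: integral0_eq => v _.
  by have := hs v; rewrite jm.
rewrite -(integral12_prod_meas1 iFu) /fubini_F; apply: integral0_eq => y _.
apply: (IH (fun v => F (updv m (y, v))) (K * expR (4^-1 * y ^+ 2))) => //.
- exact: (measurableT_comp mF (measurable_updv2 m y)).
- move=> v; apply: (le_trans (hF _)); rewrite -mulrA -expRD -mulrDr le_eqVlt; apply/orP; left.
  apply/eqP; congr (_ * expR (_ * _)); rewrite /sqnorm big_ord_recr /= {2}/updv eqxx addrC; congr (_ + _).
  by apply: eq_bigr => i _; rewrite /updv ltn_eqF.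
- move=> v; rewrite -[RHS](hs (updv m (y, v))); apply: eq_integral => y' _.
  congr (F _)%:E; apply/funext => i; rewrite /updv /=.
  by case: eqP => // ->; case: eqP => // jm'; rewrite jm' ltnn in jm.
Qed.

Lemma stein_gam m j (g g' : seqspace -> R) (K : R) : (j < m)%N ->
  measurable_fun setT g -> measurable_fun setT g' ->
  (forall v (y : R), is_derive y 1 (fun y : R => g (updv j (y, v))) (g' (updv j (y, v)))) ->
  (forall v, continuous (fun y : R => g' (updv j (y, v)))) ->
  (forall v, `|g v| <= K * expR (8^-1 * sqnorm m v)) ->
  (forall v, `|g' v| <= K * expR (8^-1 * sqnorm m v)) ->
  (\int[gam m]_v (v j * g v - g' v)%:E = 0)%E.
Proof.
move=> jm mg mg' dg cg hg hg'.
have K0 : 0 <= K.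
  by have := le_trans (normr_ge0 _) (hg (fun _ => 0)); rewrite pmulr_lge0 // expR_gt0.
have i8 : 0 < 8^-1 :> R by [].
have [C1 C10 hC1] := poly_le_exp 1 i8.
apply: (@gam_slice0 m j _ (2 * C1 * K)) => //.
- by apply: measurable_funB => //; apply: measurable_funM => //; exact: measurable_coord.
- move=> v; apply: (le_trans (ler_normB _ _)); rewrite normrM.
  apply: (@le_trans _ _ ((`|v j| + 1) * (K * expR (8^-1 * sqnorm m v)))).
    by rewrite mulrDl mul1r lerD // ler_wpM2l.
  have y1 : `|v j| + 1 <= 2 * (C1 * expR (8^-1 * sqnorm m v)).
    have := hC1 (v j); rewrite expr1.
    have : C1 * expR (8^-1 * v j ^+ 2) <= C1 * expR (8^-1 * sqnorm m v).
      rewrite ler_wpM2l // ler_expR ler_wpM2l // /sqnorm (bigD1 (Ordinal jm)) //= lerDl.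
      by rewrite sumr_ge0 // => i _; rewrite sqr_ge0.
    have : 2 * `|v j| <= 1 + v j ^+ 2.
      rewrite -real_normK ?num_real //; have := sqr_ge0 (`|v j| - 1); lra.
    have := normr_ge0 (v j); have := sqr_ge0 (v j); lra.
  apply: (le_trans (ler_wpM2r _ y1)); first by rewrite mulr_ge0 ?expR_ge0.
  have -> : 4^-1 * sqnorm m v = 8^-1 * sqnorm m v + 8^-1 * sqnorm m v by field.
  by rewrite expRD le_eqVlt; apply/orP; left; apply/eqP; ring.
- move=> v; pose c := K * expR (8^-1 * \sum_(i < m | i != j :> nat) v i ^+ 2).
  rewrite -[RHS](@stein1 R (fun y => g (updv j (y, v))) (fun y => g' (updv j (y, v))) c) //.
  + by apply: eq_integral => y _; rewrite {1}/updv eqxx.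
  + by move=> y; apply: (le_trans (hg _)); rewrite sqnorm_updv // mulrDr expRD /c mulrA mulrAC.
  + by move=> y; apply: (le_trans (hg' _)); rewrite sqnorm_updv // mulrDr expRD /c mulrA mulrAC.
Qed.

End Gamma.

Notation seqspace R := (g_sigma_algebraType (@coord_sets R)).
Notation mvar R j := (mpolyX R (mnm1 j)).

(** * Tilted Gaussian expectations of polynomials *)

Section Mpoly.
Variables (R : realType) (M : nat).
Notation mp := (mpoly.mpoly M R).
Implicit Types (p q : mp) (j : 'I_M).

Definition mev (v : nat -> R) p : R := meval (fun i : 'I_M => v i) p.

Lemma mevD v : {morph mev v : p q / p + q}. Proof. exact: mevalD. Qed.
Lemma mevB v : {morph mev v : p q / p - q}. Proof. exact: mevalB. Qed.
Lemma mevM v : {morph mev v : p q / p * q}. Proof. exact: mevalM. Qed.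
Lemma mev1 v : mev v 1 = 1. Proof. exact: meval1. Qed.
Lemma mev0 v : mev v 0 = 0. Proof. exact: meval0. Qed.

Lemma mevX v j : mev v (mvar R j) = v j.
Proof. exact: mevalXU. Qed.

Lemma mevZ v (c : R) p : mev v (c *: p) = c * mev v p.
Proof. exact: mevalZ. Qed.

Lemma mpoly_gen_ind (P : mp -> Prop) : (forall c : R, P (c *: 1)) -> (forall j, P (mvar R j)) ->
  (forall p q, P p -> P q -> P (p + q)) -> (forall p q, P p -> P q -> P (p * q)) ->
  forall p, P p.
Proof.
move=> Pc PX PD PM; elim/mpolyind => [|c m p _ _ Pp].
  by rewrite -(scale0r 1); exact: Pc.
apply: PD => //; rewrite -[mpolyX R m]mul1r scalerAl; apply: (PM); first exact: Pc.
rewrite mpolyXE_id; apply: big_ind; first by rewrite -(scale1r 1).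
  exact: PM.
move=> i _; elim: (m i) => [|a IH]; first by rewrite expr0 -(scale1r 1).
by rewrite exprS; apply: PM.
Qed.

Lemma measurable_mev p : measurable_fun setT (fun v : seqspace R => mev v p).
Proof.
elim/mpoly_gen_ind: p => [c|j|p q mp mq|p q mp mq].
- apply: (eq_measurable_fun (fun _ : seqspace R => c)); last exact: measurable_cst.
  by move=> v _; rewrite mevZ mev1 mulr1.
- apply: (eq_measurable_fun (fun v : seqspace R => v j)); last exact: measurable_coord.
  by move=> v _; rewrite mevX.
- apply: (eq_measurable_fun (fun v : seqspace R => mev v p + mev v q)); last exact: measurable_funD.
  by move=> v _; rewrite mevD.
- apply: (eq_measurable_fun (fun v : seqspace R => mev v p * mev v q)); last exact: measurable_funM.
  by move=> v _; rewrite mevM.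
Qed.

Lemma is_derive_mev p (j : 'I_M) v (y : R) :
  is_derive y 1 (fun y : R => mev (updv j (y, v)) p) (mev (updv j (y, v)) (mderiv j p)).
Proof.
elim/mpoly_gen_ind: p => [c|i|p q dp dq|p q dp dq].
- have -> : (fun y : R => mev (updv j (y, v)) (c *: 1)) = cst c.
    by apply/funext => z; rewrite mevZ mev1 mulr1.
  rewrite mderivZ -[1 : mp]/(mpolyC M 1) mderivC scaler0 mev0.
  exact: is_derive_cst.
- rewrite mderivX mevZ mnm1E.
  have -> : (fun y : R => mev (updv j (y, v)) (mvar R i)) = fun y : R => if i == j then y else v i.
    by apply/funext => z; rewrite mevX /updv val_eqE.
  case: eqP => [->|ij].
    have -> : mnm_sub (mnm1 j) (mnm1 j) = mnm0 :> multinom M.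
      by apply/mnmP => h; rewrite mnmBE subnn mnm0E.
    by rewrite mpolyX0 mev1 mulr1; exact: is_derive_id.
  by rewrite mul0r; exact: is_derive_cst.
- rewrite mderivD mevD /=.
  have -> : (fun y : R => mev (updv j (y, v)) (p + q)) =
    (fun y : R => mev (updv j (y, v)) p) + (fun y : R => mev (updv j (y, v)) q).
    by apply/funext => z; rewrite mevD.
  exact: is_deriveD.
- have -> : (fun y : R => mev (updv j (y, v)) (p * q)) =
    (fun y : R => mev (updv j (y, v)) p) * (fun y : R => mev (updv j (y, v)) q).
    by apply/funext => z; rewrite mevM.
  apply: is_derive_eq (is_deriveM dp dq) _.
  by rewrite mderivM mevD !mevM /= /GRing.scale /=; ring.
Qed.

Lemma continuous_mev p (j : 'I_M) v : continuous (fun y : R => mev (updv j (y, v)) p).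
Proof.
move=> y; apply/differentiable_continuous/derivable1_diffP.
by apply: ex_derive; exact: is_derive_mev.
Qed.

Lemma mev_bound p : exists K : R, forall v, `|mev v p| <= K * expR (8^-1 * sqnorm M v).
Proof.
suff [r [K K0 H]] : exists r : nat, exists2 K : R, 0 <= K &
    forall v, `|mev v p| <= K * (1 + sqnorm M v) ^+ r.
  have i8 : 0 < 8^-1 :> R by [].
  have [C C0 hC] := poly_le_exp r i8.
  exists (K * C) => v; apply: (le_trans (H v)); rewrite -mulrA ler_wpM2l //.
  have n0 : 0 <= sqnorm M v by apply: sumr_ge0 => i _; exact: sqr_ge0.
  by have := hC (Num.sqrt (sqnorm M v)); rewrite sqr_sqrtr.
have n1 (v : nat -> R) : 1 <= 1 + sqnorm M v.
  by rewrite lerDl; apply: sumr_ge0 => i _; exact: sqr_ge0.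
have n0 (v : nat -> R) : 0 <= 1 + sqnorm M v by rewrite (le_trans _ (n1 v)).
elim/mpoly_gen_ind: p => [c|j|p q [r [K K0 hp]] [r' [K' K0' hq]]|p q [r [K K0 hp]] [r' [K' K0' hq]]].
- by exists 0%N, `|c| => // v; rewrite mevZ mev1 mulr1 expr0 mulr1.
- exists 1%N, 1 => // v; rewrite mevX mul1r expr1.
  have : v j ^+ 2 <= sqnorm M v.
    by rewrite /sqnorm (bigD1 j) //= lerDl sumr_ge0 // => i _; exact: sqr_ge0.
  have : 2 * `|v j| <= 1 + v j ^+ 2.
    by rewrite -real_normK ?num_real //; have := sqr_ge0 (`|v j| - 1); lra.
  have := sqr_ge0 (v j); have := normr_ge0 (v j); lra.
- exists (maxn r r'), (K + K') => [|v]; first exact: addr_ge0.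
  rewrite mevD /= mulrDl; apply: (le_trans (ler_normD _ _)); apply: lerD.
    by apply: (le_trans (hp v)); rewrite ler_wpM2l // ler_weXn2l // leq_maxl.
  by apply: (le_trans (hq v)); rewrite ler_wpM2l // ler_weXn2l // leq_maxr.
- exists (r + r')%N, (K * K') => [|v]; first exact: mulr_ge0.
  rewrite mevM /= normrM exprD mulrACA; apply: ler_pM => //.
Qed.

Variables (q : mp) (s : R).
Hypothesis s0 : 0 <= s.
Hypothesis q0 : forall v, 0 <= mev v q.

Definition expw (v : nat -> R) : R := expR (- (s * mev v q)).

Lemma expw_ge0 v : 0 <= expw v. Proof. exact: expR_ge0. Qed.

Lemma expw_le1 v : expw v <= 1.
Proof. by rewrite /expw -expR0 ler_expR oppr_le0 mulr_ge0. Qed.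

Lemma measurable_expw : measurable_fun setT (expw : seqspace R -> R).
Proof.
apply: measurableT_comp; first exact: measurable_expR.
by apply: measurableT_comp => //; apply: measurable_funM => //; exact: measurable_mev.
Qed.

Lemma integrable_mev p : (gam R M).-integrable setT (fun v => (mev v p * expw v)%:E).
Proof.
have [K hK] := mev_bound p.
apply: (@integrable_gam_bounded R M _ K 8^-1); first lra.
  by apply: measurable_funM; [exact: measurable_mev|exact: measurable_expw].
move=> v; rewrite normrM [ `|expw v|]ger0_norm ?expw_ge0 //.
by apply: le_trans (hK v); rewrite ler_piMr ?expw_le1.
Qed.

Definition Iexp p : R := (\int[gam R M]_v (mev v p * expw v))%R.

Lemma IexpD p p' : Iexp (p + p') = Iexp p + Iexp p'.
Proof.
rewrite /Iexp -RintegralD //; first by apply: eq_Rintegral => v _; rewrite mevD mulrDl.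
all: exact: integrable_mev.
Qed.

Lemma IexpZ (c : R) p : Iexp (c *: p) = c * Iexp p.
Proof.
rewrite /Iexp -RintegralZl //; last exact: integrable_mev.
by apply: eq_Rintegral => v _; rewrite mevZ mulrA.
Qed.

Lemma Iexp0 : Iexp 0 = 0.
Proof. by rewrite -(scale0r 0) IexpZ mul0r. Qed.

Lemma Iexp_sum (I : Type) (r : seq I) (F : I -> mp) : Iexp (\sum_(i <- r) F i) = \sum_(i <- r) Iexp (F i).
Proof. exact: (big_morph Iexp IexpD Iexp0). Qed.

(** Integration by parts applied to p exp(- s q); the second term is the derivative of the tilt. *)
Lemma Iexp_stein p j : Iexp (mvar R j * p) = Iexp (mderiv j p) - s * Iexp (p * mderiv j q).
Proof.
pose g (v : nat -> R) := mev v p * expw v.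
pose r := mderiv j p - s *: (p * mderiv j q).
pose g' (v : nat -> R) := mev v r * expw v.
have dg v (y : R) : is_derive y 1 (fun y : R => g (updv j (y, v))) (g' (updv j (y, v))).
  have dp := is_derive_mev p j v y; have dq := is_derive_mev q j v y.
  have hs : is_derive y 1 (fun y : R => - (s * mev (updv j (y, v)) q)) (- (s * mev (updv j (y, v)) (mderiv j q))).
    have h := is_deriveN (is_deriveM (is_derive_cst s y 1) dq).
    apply: is_derive_eq h _.
    by rewrite /GRing.scale /= mulr0 addr0.
  have he := @is_derive1_comp R expR _ y _ _ (is_derive_expR _) hs.
  have hm := is_deriveM dp he.
  apply: is_derive_eq hm _.
  rewrite /g' /r /expw mevB /= mevZ mevM /= /GRing.scale /=; ring.
have [K hK] := mev_bound p; have [K' hK'] := mev_bound r.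
have bnd (P : mp) (L : R) v : `|mev v P| <= L * expR (8^-1 * sqnorm M v) -> L <= Num.max K K' ->
    `|mev v P * expw v| <= Num.max K K' * expR (8^-1 * sqnorm M v).
  move=> h hL; rewrite normrM [ `|expw v|]ger0_norm ?expw_ge0 //.
  apply: (le_trans (ler_piMr (normr_ge0 _) (expw_le1 v))); apply: (le_trans h).
  by rewrite ler_wpM2r // expR_ge0.
have H := @stein_gam R M j g g' (Num.max K K') (ltn_ord j).
have {}H : (\int[gam R M]_v (v j * g v - g' v)%:E = 0)%E.
  apply: H => //.
  - by apply: measurable_funM; [exact: measurable_mev|exact: measurable_expw].
  - by apply: measurable_funM; [exact: measurable_mev|exact: measurable_expw].
  - move=> v y; apply: cvgM; first exact: continuous_mev.
    apply: (continuous_comp (f := fun y : R => - (s * mev (updv j (y, v)) q))); last exact: continuous_expR.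
    by apply: cvgN; apply: cvgMr; exact: continuous_mev.
  - by move=> v; apply: bnd => //; rewrite le_max lexx.
  - by move=> v; apply: bnd => //; rewrite le_max lexx orbT.
have E : Iexp (mvar R j * p - r) = 0.
  rewrite /Iexp /Rintegral.
  rewrite (eq_integral (fun v : seqspace R => (v j * g v - g' v)%:E)) ?H // => v _.
  by rewrite mevB mevM /= mevX mulrBl mulrA.
move: E; rewrite -scaleN1r IexpD IexpZ mulN1r => /eqP; rewrite subr_eq0 => /eqP ->.
by rewrite /r -scaleN1r scalerA mulN1r IexpD IexpZ mulNr.
Qed.

End Mpoly.

(** * The moment recursion *)

Section Lists.
Variable R : realType.

(** Formal sums: a pair is a coefficient with the list of indices of a product of power sums.
    [GG a l] is the Leibniz expansion of Gamma(P_a, P_l). *)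
Fixpoint GG (a : nat) (l : seq nat) : seq (R * seq nat) :=
  if l is b :: l' then ((4 * a * b)%:R, (a + b).-1 :: l') :: [seq (u.1, b :: u.2) | u <- GG a l']
  else [::].

(** The formal expansion of the weighted generator at P_l. The outer groups of terms come from L(f
    g) = f L g + g L f + 2 Gamma(f, g), the two middle ones from L P_a itself. *)
Fixpoint LL (l : seq nat) : seq (R * seq nat) :=
  if l is a :: l' then
    [seq (u.1, a :: u.2) | u <- LL l'] ++
    [seq (a%:R, [:: b, (a.-1 - b)%N & l']) | b <- iota 0 a] ++
    (- a%:R, a.-1 :: l') :: [seq (2 * u.1, u.2) | u <- GG a l']
  else [::].

(** The alternative of a zero coefficient covers vanishing indices, where the predecessor of a + b
    may fail to lower the sum. *)
Lemma GG_deg a l u : u \in GG a l -> u.1 = 0 \/ (sumn u.2 < a + sumn l)%N.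
Proof.
elim: l u => //= b l IH u; rewrite inE => /orP[/eqP -> /=|/mapP[w /IH + ->] /=].
  case: (posnP a) => [->|a0]; first by left; rewrite muln0 mul0n.
  case: (posnP b) => [->|b0]; first by left; rewrite muln0.
  by right; lia.
by case=> [->|h]; [left|right; lia].
Qed.

Lemma LL_deg l u : u \in LL l -> u.1 = 0 \/ (sumn u.2 < sumn l)%N.
Proof.
elim: l u => //= a l IH u; rewrite !mem_cat inE => /orP[/mapP[w /IH + ->] /=|].
  by case=> [->|h]; [left|right; lia].
move=> /orP[/mapP[b + ->] /=|/orP[/eqP -> /=|/mapP[w /GG_deg + ->] /=]].
- rewrite mem_iota add0n => /= hb; right; rewrite addnA ltn_add2r.
  by case: a hb {IH} => // a; rewrite ltnS => hb; rewrite /= subnKC.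
- by case: (posnP a) => [->|a0]; [left; rewrite oppr0|right; lia].
- by case=> [->|h]; [left; rewrite mulr0|right].
Qed.

(** Each term on the right has a smaller index sum or coefficient 0, and the factor on the left is
    nonzero for a positive index sum, so everything is determined by the value at the empty list.
    The cross-multiplied form states this proportionality even when that value is 0. *)
Lemma rec_unique (s c : R) (I1 I2 : seq nat -> R) : 0 <= s ->
  (forall l, (1 + 2 * s) * (2 * (sumn l)%:R) * I1 l = \sum_(u <- LL l) u.1 * I1 u.2) ->
  (forall l, (1 + 2 * s) * (2 * (sumn l)%:R) * I2 l = \sum_(u <- LL l) u.1 * I2 u.2) ->
  (forall l, I1 (0%N :: l) = c * I1 l) -> (forall l, I2 (0%N :: l) = c * I2 l) ->
  forall l, I1 l * I2 [::] = I2 l * I1 [::].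
Proof.
move=> s0 r1 r2 z1 z2 l; have [d] := ubnP (sumn l); elim: d l => // d IH l hl.
case: (posnP (sumn l)) => [h0|lpos].
  have {h0} : all (pred1 0%N) l by move/eqP: h0; rewrite -leqn0; elim: (l) => //= a l' IHl h; rewrite IHl; lia.
  elim: (l) => [_|a l' IHl /= /andP[/eqP -> /IHl h]]; first exact: mulrC.
  by rewrite z1 z2 -!mulrA h.
have K0 : (1 + 2 * s) * (2 * (sumn l)%:R) != 0.
  by rewrite mulf_neq0 // ?mulf_neq0 ?pnatr_eq0 -?lt0n // gt_eqF //; lra.
apply: (mulfI K0); rewrite [LHS]mulrA r1 [RHS]mulrA r2 !mulr_suml.
apply: eq_big_seq => u /LL_deg[->|hu]; first by rewrite !mul0r.
by rewrite -!mulrA IH //; exact: (leq_trans hu).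
Qed.

End Lists.

Section Generic.
Variables (R : realType) (M : nat).
Notation mp := (mpoly.mpoly M R).
Variables (P : nat -> mp) (vdm : mp).
Implicit Types (f g h : mp).

Definition prodP (l : seq nat) : mp := \prod_(a <- l) P a.

(** The carre du champ of the Laplacian. *)
Definition Gam f g : mp := \sum_(j < M) mderiv j f * mderiv j g.

(** [vdm] times the generator f |-> Laplacian f + 2 grad f . grad log vdm that belongs to the weight
    vdm^2; the extra factor keeps it polynomial. *)
Definition Lap f : mp :=
  \sum_(j < M) (mderiv j (mderiv j f) * vdm + 2%:R *: (mderiv j f * mderiv j vdm)).

Lemma mderiv1 (j : 'I_M) : mderiv j (1 : mp) = 0.
Proof. exact: (derivation1 (@mderivM M R j)). Qed.

Lemma Gam1 f : Gam f 1 = 0.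
Proof. by rewrite /Gam big1 // => j _; rewrite mderiv1 mulr0. Qed.

Lemma GamM f g h : Gam f (g * h) = g * Gam f h + h * Gam f g.
Proof.
rewrite /Gam !mulr_sumr -big_split /=; apply: eq_bigr => j _.
by rewrite mderivM; ring.
Qed.

Lemma Lap1 : Lap 1 = 0.
Proof. by rewrite /Lap big1 // => j _; rewrite mderiv1 mderiv0 !mul0r scaler0 addr0. Qed.

Lemma LapM f g : Lap (f * g) = f * Lap g + g * Lap f + 2%:R *: (Gam f g * vdm).
Proof.
rewrite /Lap /Gam mulr_suml scaler_sumr !mulr_sumr -!big_split /=; apply: eq_bigr => j _.
rewrite !mderivM !mderivD !mderivM !scaler_nat; ring.
Qed.

Hypothesis GamP : forall a b, Gam (P a) (P b) = (4 * a * b)%:R *: P (a + b).-1.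
Hypothesis LapP : forall a, Lap (P a) =
  a%:R *: (\sum_(b <- iota 0 a) P b * P (a.-1 - b)%N - P a.-1) * vdm.

Lemma Gam_prodP a l : Gam (P a) (prodP l) = \sum_(u <- GG R a l) u.1 *: prodP u.2.
Proof.
elim: l => [|b l IH] /=; first by rewrite /prodP big_nil Gam1 big_nil.
rewrite /prodP big_cons -/(prodP l) GamM IH GamP big_cons /= /prodP big_cons -/(prodP l).
rewrite big_map addrC; congr (_ + _); first by rewrite mulrC -scalerAl.
rewrite mulr_sumr; apply: eq_bigr => u _.
by rewrite -scalerAr big_cons.
Qed.

Lemma Lap_prodP l : Lap (prodP l) = (\sum_(u <- LL R l) u.1 *: prodP u.2) * vdm.
Proof.
elim: l => [|a l IH] /=; first by rewrite /prodP !big_nil mul0r Lap1.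
rewrite /prodP big_cons -/(prodP l) LapM IH LapP Gam_prodP.
rewrite !big_cat big_cons /= !big_map /=.
set S1 := \sum_(u <- LL R l) _; set S2 := \sum_(u <- GG R a l) _.
have -> : \sum_(u <- LL R l) u.1 *: prodP (a :: u.2) = P a * S1.
  by rewrite mulr_sumr; apply: eq_bigr => u _; rewrite /prodP big_cons scalerAr.
have -> : \sum_(u <- GG R a l) (2 * u.1) *: prodP u.2 = 2%:R *: S2.
  by rewrite scaler_sumr; apply: eq_bigr => u _; rewrite scalerA.
have -> : \sum_(b <- iota 0 a) a%:R *: prodP [:: b, (a.-1 - b)%N & l] =
    a%:R *: (prodP l * \sum_(b <- iota 0 a) P b * P (a.-1 - b)%N).
  rewrite mulr_sumr scaler_sumr; apply: eq_bigr => b _; congr (_ *: _).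
  by rewrite /prodP !big_cons mulrA mulrC.
rewrite /prodP big_cons -/(prodP l) scaleNr !scaler_nat; ring.
Qed.

Hypothesis EulP : forall a, \sum_(j < M) mvar R j * mderiv j (P a) = (2 * a)%:R *: P a.

Lemma Eul_prodP l : \sum_(j < M) mvar R j * mderiv j (prodP l) = (2 * sumn l)%:R *: prodP l.
Proof.
elim: l => [|a l IH].
  by rewrite /prodP !big_nil muln0 scale0r big1 // => j _; rewrite mderiv1 mulr0.
rewrite /prodP big_cons -/(prodP l).
transitivity (P a * (\sum_(j < M) mvar R j * mderiv j (prodP l)) +
   prodP l * \sum_(j < M) mvar R j * mderiv j (P a)).
  rewrite !mulr_sumr -big_split /=; apply: eq_bigr => j _; rewrite mderivM; ring.
by rewrite IH EulP /= mulnDr natrD scalerDl -scalerAr -scalerAr [prodP l * _]mulrC addrC.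
Qed.

Lemma Gam1_prodP l : Gam (P 1) (prodP l) = (4 * sumn l)%:R *: prodP l.
Proof.
elim: l => [|a l IH]; first by rewrite /prodP big_nil Gam1 muln0 scale0r.
rewrite /prodP big_cons -/(prodP l) GamM IH GamP /= muln1.
by rewrite mulnDr natrD scalerDl -scalerAr -scalerAr [prodP l * _]mulrC addrC.
Qed.

Hypothesis P1_ge0 : forall v, 0 <= mev v (P 1).

(** Integrate by parts the functions vdm^2 d_j F and sum over j. The left sides add up by Euler's
    relation, the divergence is vdm times [Lap F], and the tilt contributes - s times the integral
    of Gamma(P_1, F) vdm^2, again a multiple of the unknown, which moves to the left as the factor 1
    + 2 s. *)
Lemma Iexp_rec (s : R) l : 0 <= s ->
  (1 + 2 * s) * (2 * (sumn l)%:R) * Iexp (P 1) s (prodP l * vdm ^+ 2) =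
  \sum_(u <- LL R l) u.1 * Iexp (P 1) s (prodP u.2 * vdm ^+ 2).
Proof.
move=> s0; set F := prodP l.
have H : \sum_(j < M) Iexp (P 1) s (mvar R j * (mderiv j F * vdm ^+ 2)) =
    \sum_(j < M) (Iexp (P 1) s (mderiv j (mderiv j F * vdm ^+ 2)) -
                  s * Iexp (P 1) s (mderiv j F * vdm ^+ 2 * mderiv j (P 1))).
  by apply: eq_bigr => j _; apply: Iexp_stein.
have e1 : \sum_(j < M) Iexp (P 1) s (mvar R j * (mderiv j F * vdm ^+ 2)) =
    (2 * sumn l)%:R * Iexp (P 1) s (F * vdm ^+ 2).
  rewrite -IexpZ // -Iexp_sum //; congr Iexp.
  rewrite scalerAl -Eul_prodP mulr_suml; apply: eq_bigr => j _; by rewrite mulrA.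
have e2 : \sum_(j < M) Iexp (P 1) s (mderiv j F * vdm ^+ 2 * mderiv j (P 1)) =
    (4 * sumn l)%:R * Iexp (P 1) s (F * vdm ^+ 2).
  rewrite -IexpZ // -Iexp_sum //; congr Iexp.
  rewrite scalerAl -Gam1_prodP mulr_suml; apply: eq_bigr => j _; ring.
have e3 : \sum_(j < M) Iexp (P 1) s (mderiv j (mderiv j F * vdm ^+ 2)) =
    \sum_(u <- LL R l) u.1 * Iexp (P 1) s (prodP u.2 * vdm ^+ 2).
  rewrite -Iexp_sum //.
  under [RHS]eq_bigr do rewrite -IexpZ //.
  rewrite -Iexp_sum //; congr Iexp.
  transitivity (Lap F * vdm).
    rewrite /Lap mulr_suml; apply: eq_bigr => j _.
    rewrite mderivM expr2 mderivM !scaler_nat; ring.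
  rewrite Lap_prodP -mulrA -expr2 mulr_suml; apply: eq_bigr => u _.
  by rewrite scalerAl.
move: H; rewrite e1 sumrB e3 -mulr_sumr e2 => /eqP; rewrite eq_sym subr_eq => /eqP ->.
rewrite !natrM; ring.
Qed.

End Generic.

(** * Traces of powers of an antisymmetric Gaussian matrix *)

Section Mpow.
Variables (A : comPzRingType) (L : nat).
Implicit Types B C : 'M[A]_L.

Definition mpow B (r : nat) : 'M[A]_L := iter r (mulmx B) 1%:M.

Lemma mpowS B r : mpow B r.+1 = B *m mpow B r. Proof. by []. Qed.

Lemma mpowD B p q : mpow B (p + q) = mpow B p *m mpow B q.
Proof. by elim: p => [|p IH]; rewrite ?mul1mx // addSn !mpowS IH mulmxA. Qed.

Lemma mpowSr B r : mpow B r.+1 = mpow B r *m B.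
Proof. by rewrite -addn1 mpowD mpowS /mpow /= mulmx1. Qed.

Lemma tr_mpow B r : (mpow B r)^T = mpow B^T r.
Proof. by elim: r => [|r IH]; [rewrite trmx1|rewrite mpowS mpowSr trmx_mul IH]. Qed.

Lemma mpowN B r : mpow (- B) r = (-1) ^+ r *: mpow B r.
Proof.
elim: r => [|r IH]; first by rewrite expr0 scale1r.
by rewrite !mpowS IH -scalemxAr mulNmx scalerN exprS mulN1r scaleNr.
Qed.

Lemma mpowZ (c : A) B r : mpow (c *: B) r = c ^+ r *: mpow B r.
Proof.
elim: r => [|r IH]; first by rewrite expr0 scale1r.
by rewrite !mpowS IH -scalemxAl -scalemxAr scalerA exprS.
Qed.

Variable D : A -> A.
Hypothesis DD : forall a b, D (a + b) = D a + D b.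
Hypothesis DM : forall a b, D (a * b) = D a * b + a * D b.

Lemma derivation0 : D 0 = 0.
Proof. by apply: (addrI (D 0)); rewrite addr0 -DD addr0. Qed.

Lemma derivation_sum (I : Type) (r : seq I) (F : I -> A) :
  D (\sum_(i <- r) F i) = \sum_(i <- r) D (F i).
Proof. exact: (big_morph D DD derivation0). Qed.

Lemma derivation_mulmx B C : map_mx D (B *m C) = map_mx D B *m C + B *m map_mx D C.
Proof.
apply/matrixP => i j; rewrite !mxE derivation_sum -big_split /=; apply: eq_bigr => l _.
by rewrite !mxE DM.
Qed.

Lemma derivation_trace B : D (\tr B) = \tr (map_mx D B).
Proof. by rewrite /mxtrace derivation_sum; apply: eq_bigr => i _; rewrite mxE. Qed.

Lemma derivation_mpow B r :
  map_mx D (mpow B r) = \sum_(q < r) mpow B (r - q.+1) *m map_mx D B *m mpow B q.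
Proof.
elim: r => [|r IH].
  rewrite big_ord0; apply/matrixP => i j; rewrite !mxE.
  by case: eqP => _; rewrite ?(derivation1 DM) ?derivation0.
rewrite mpowS derivation_mulmx IH big_ord_recr /= subnn mul1mx addrC; congr (_ + _).
rewrite mulmx_sumr; apply: eq_bigr => q _; have := ltn_ord q => hq.
by rewrite subSn // mpowS !mulmxA.
Qed.

Lemma derivation_trace_mpow B r : D (\tr (mpow B r)) = r%:R * \tr (mpow B r.-1 *m map_mx D B).
Proof.
rewrite derivation_trace derivation_mpow raddf_sum /=.
rewrite (eq_bigr (fun=> \tr (mpow B r.-1 *m map_mx D B))); last first.
  move=> q _; rewrite mxtrace_mulC mulmxA -mpowD; congr (\tr (mpow _ _ *m _)).
  by have := ltn_ord q; lia.
by rewrite sumr_const card_ord mulr_natl.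
Qed.

End Mpow.

Lemma map_mpow (A A' : comPzRingType) (f : {rmorphism A -> A'}) L (B : 'M[A]_L) r :
  map_mx f (mpow B r) = mpow (map_mx f B) r.
Proof. by elim: r => [|r IH]; [rewrite map_mx1|rewrite !mpowS map_mxM IH]. Qed.

Lemma mxtrace_mul_delta (A : comPzRingType) L (B : 'M[A]_L) i j : \tr (B *m delta_mx i j) = B j i.
Proof.
rewrite mxtrace_mulC /mxtrace (bigD1 i) //= big1 => [|l li]; rewrite !mxE.
  rewrite (bigD1 j) //= big1 => [|h hj]; rewrite !mxE ?eqxx ?mul1r ?addr0 //.
  by rewrite (negbTE hj) andbF mul0r.
by rewrite big1 // => h _; rewrite !mxE (negbTE li) mul0r.
Qed.

Lemma sum_even_terms (V : zmodType) (F : nat -> V) a :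
  (forall q, odd q -> F q = 0) -> \sum_(q < (2 * a).+1) F q = \sum_(b < a.+1) F (2 * b)%N.
Proof.
move=> h; elim: a => [|a IH]; first by rewrite !big_ord1.
rewrite mulnS addSn add1n 2!big_ord_recr /= IH [RHS]big_ord_recr /=.
rewrite -addrA; congr (_ + _).
rewrite h ?add0r; last by rewrite /= mul2n odd_double.
by rewrite mulnS.
Qed.

Lemma sign_2S (A : pzRingType) a : (-1) ^+ (2 * a).+1 = -1 :> A.
Proof. by rewrite exprS exprM sqrrN !expr1n mulr1. Qed.

Section Side1.
Variables (R : realType) (L : nat).
Notation mp := (mpoly.mpoly (L * L) R).

Lemma pairidx_subproof (i j : 'I_L) : (i * L + j < L * L)%N.
Proof. by have := ltn_ord i; have := ltn_ord j; nia. Qed.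

Definition pairidx (i j : 'I_L) : 'I_(L * L) := Ordinal (pairidx_subproof i j).

Lemma pairidx_inj i j i' j' : pairidx i j = pairidx i' j' -> i = i' /\ j = j'.
Proof.
move=> /(congr1 val) /= h; have hj := ltn_ord j; have hj' := ltn_ord j'.
have L0 : (0 < L)%N by lia.
have := congr1 (divn^~ L) h; rewrite /= !divnMDl // !divn_small // !addn0 => e1.
have := congr1 (modn^~ L) h; rewrite /= !modnMDl !modn_small // => e2.
by split; apply/val_inj.
Qed.

Lemma sum_pairidx (V : nmodType) (F : 'I_(L * L) -> V) : \sum_v F v = \sum_i \sum_j F (pairidx i j).
Proof.
rewrite pair_big /= (reindex (fun u : 'I_L * 'I_L => pairidx u.1 u.2)) //=.
apply: onW_bij; apply: inj_card_bij.
  by move=> [i j] [i' j'] /= /pairidx_inj[-> ->].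
by rewrite card_prod !card_ord.
Qed.

Definition AA : 'M[mp]_L := \matrix_(i, j) (mvar R (pairidx i j) - mvar R (pairidx j i)).

Lemma AA_tr : AA^T = - AA.
Proof. by apply/matrixP => i j; rewrite !mxE opprB. Qed.

Lemma mderivU (v w : 'I_(L * L)) : mderiv v (mvar R w) = (w == v)%:R :> mp.
Proof.
rewrite mderivX mnm1E; case: eqP => [->|_]; last by rewrite scale0r.
have -> : mnm_sub (mnm1 v) (mnm1 v) = mnm0 :> multinom (L * L).
  by apply/mnmP => h; rewrite mnmBE subnn mnm0E.
by rewrite mpolyX0 scale1r.
Qed.

Lemma mderiv_AA i j : map_mx (mderiv (pairidx i j)) AA = delta_mx i j - delta_mx j i.
Proof.
apply/matrixP => h l; rewrite !mxE mderivB !mderivU.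
have E a b : (pairidx a b == pairidx i j) = (a == i) && (b == j).
  by apply/eqP/andP => [/pairidx_inj[-> ->]|[/eqP-> /eqP->]].
by rewrite !E [(l == i) && _]andbC.
Qed.

Lemma euler_AA : map_mx (fun f => \sum_(v < L * L) mvar R v * mderiv v f) AA = AA.
Proof.
apply/matrixP => i j; rewrite !mxE.
under eq_bigr do rewrite mderivB mulrBr !mderivU.
rewrite sumrB; congr (_ - _).
  rewrite (bigD1 (pairidx i j)) //= eqxx mulr1 big1 ?addr0 // => v /negbTE h.
  by rewrite eq_sym h mulr0.
rewrite (bigD1 (pairidx j i)) //= eqxx mulr1 big1 ?addr0 // => v /negbTE h.
by rewrite eq_sym h mulr0.
Qed.

(** The scalar is (i / 2)^(2 a): this is the trace of the power 2 a of the aGUE matrix, written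
    without complex numbers. *)
Definition PA (a : nat) : mp := ((- 4^-1) ^+ a) *: \tr (mpow AA (2 * a)).

Lemma mpow_AA_tr r : (mpow AA r)^T = (-1) ^+ r *: mpow AA r.
Proof. by rewrite tr_mpow AA_tr mpowN. Qed.

Lemma mpow_AA_sym r i j : mpow AA r j i = (-1) ^+ r * mpow AA r i j.
Proof. by have := congr1 (fun B : 'M[mp]_L => B i j) (mpow_AA_tr r); rewrite !mxE. Qed.

Lemma tr_odd r : odd r -> \tr (mpow AA r) = 0.
Proof.
move=> hr; have := mxtrace_tr (mpow AA r); rewrite mpow_AA_tr mxtraceZ -signr_odd hr expr1 mulN1r.
move/eqP; rewrite eq_sym -addr_eq0 -mulr2n -scaler_nat scaler_eq0 pnatr_eq0 /=.
by move/eqP.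
Qed.

Lemma mderiv_PA a i j : mderiv (pairidx i j) (PA a) =
  ((- 4^-1) ^+ a * - (4 * a)%:R) *: mpow AA (2 * a).-1 i j.
Proof.
rewrite /PA mderivZ (derivation_trace_mpow (@mderivD _ _ _) (@mderivM _ _ _)) mderiv_AA.
rewrite mulmxBr raddfB /= !mxtrace_mul_delta -scalerA; congr (_ *: _).
case: a => [|a]; first by rewrite !muln0 oppr0 scale0r mul0r.
have -> : (2 * a.+1).-1 = (2 * a).+1 by lia.
rewrite mpow_AA_sym sign_2S mulN1r.
rewrite scaleNr scaler_nat -[_ *+ (4 * _)]mulr_natl !natrM; ring.
Qed.

Lemma sum_mpow_AA p q : \sum_i \sum_j mpow AA p i j * mpow AA q i j = (-1) ^+ q * \tr (mpow AA (p + q)).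
Proof.
rewrite mpowD -mxtraceZ scalemxAr -mpow_AA_tr /mxtrace; apply: eq_bigr => i _.
by rewrite mxE; apply: eq_bigr => j _; rewrite mxE.
Qed.

Lemma GamPA a b : Gam (PA a) (PA b) = (4 * a * b)%:R *: PA (a + b).-1.
Proof.
rewrite /Gam sum_pairidx.
under eq_bigr do under eq_bigr do rewrite !mderiv_PA -scalerAl -scalerAr scalerA.
under eq_bigr do rewrite -scaler_sumr; rewrite -scaler_sumr sum_mpow_AA.
case: a => [|a]; first by rewrite !muln0 mul0n oppr0 mulr0 mul0r !scale0r.
case: b => [|b]; first by rewrite !muln0 oppr0 !mulr0 !scale0r.
have -> : (2 * b.+1).-1 = (2 * b).+1 by lia.
rewrite sign_2S mulN1r /PA scalerN -scaleNr scalerA.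
have -> : ((2 * a.+1).-1 + (2 * b).+1 = 2 * (a.+1 + b.+1).-1)%N by lia.
congr (_ *: _).
have -> : (a.+1 + b.+1).-1 = (a + b).+1 by lia.
rewrite !natrM !exprS exprD; by field.
Qed.

(** Differentiating the entry (i, j) of a power in its own variable produces products of two
    diagonal entries and, through the antisymmetric partner, products of two (i, j) entries. Summed
    over i and j, the former give products of traces, of which only even powers survive; the latter
    alternate in sign and leave a single trace, the origin of - P_(a-1). *)
Lemma LapPA a : Lap 1 (PA a) =
  a%:R *: (\sum_(b <- iota 0 a) PA b * PA (a.-1 - b)%N - PA a.-1) * 1.
Proof.
rewrite mulr1 /Lap.
under eq_bigr do rewrite mulr1 mderiv1 mulr0 scaler0 addr0.
rewrite sum_pairidx.
under eq_bigr do under eq_bigr do rewrite mderiv_PA mderivZ.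
under eq_bigr do rewrite -scaler_sumr; rewrite -scaler_sumr.
case: a => [|a]; first by rewrite muln0 oppr0 mulr0 !scale0r.
have -> : (2 * a.+1).-1 = (2 * a).+1 by lia.
have E i j : mderiv (pairidx i j) (mpow AA (2 * a).+1 i j) =
   \sum_(q < (2 * a).+1) (mpow AA (2 * a - q) i i * mpow AA q j j -
                          mpow AA (2 * a - q) i j * mpow AA q i j).
  have := congr1 (fun B : 'M[mp]_L => B i j)
    (derivation_mpow (@mderivD _ _ (pairidx i j)) (@mderivM _ _ (pairidx i j)) AA (2 * a).+1).
  rewrite mxE => ->; rewrite summxE; apply: eq_bigr => q _.
  rewrite subSS mderiv_AA mulmxBr mulmxBl !mxE; congr (_ - _).
    rewrite (bigD1 j) //= big1 => [|l lj]; rewrite !mxE.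
      rewrite addr0; congr (_ * _); rewrite (bigD1 i) //= big1 => [|l li]; rewrite !mxE ?eqxx ?mulr1 ?addr0 //.
      by rewrite (negbTE li) mulr0.
    rewrite big1 ?mul0r // => h _; by rewrite !mxE (negbTE lj) andbF mulr0.
  rewrite (bigD1 i) //= big1 => [|l lj]; rewrite !mxE.
    rewrite addr0; congr (_ * _); rewrite (bigD1 j) //= big1 => [|l li]; rewrite !mxE ?eqxx ?mulr1 ?addr0 //.
    by rewrite (negbTE li) mulr0.
  rewrite big1 ?mul0r // => h _; by rewrite !mxE (negbTE lj) andbF mulr0.
have -> : \sum_i \sum_j mderiv (pairidx i j) (mpow AA (2 * a).+1 i j) =
    \sum_(q < (2 * a).+1) (\tr (mpow AA (2 * a - q)) * \tr (mpow AA q) -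
      (-1) ^+ q * \tr (mpow AA (2 * a))).
  under eq_bigr do under eq_bigr do rewrite E.
  under eq_bigr do rewrite exchange_big /=.
  rewrite exchange_big /=; apply: eq_bigr => q _.
  have hq := ltn_ord q.
  under eq_bigr do rewrite sumrB; rewrite sumrB; congr (_ - _).
    by rewrite /mxtrace mulr_suml; apply: eq_bigr => i _; rewrite mulr_sumr.
  by rewrite sum_mpow_AA; congr (_ * \tr (mpow _ _)); lia.
rewrite sumrB -mulr_suml.
have -> : \sum_(q < (2 * a).+1) (-1) ^+ q = 1 :> mp.
  elim: (a) => [|a' IHa]; first by rewrite muln0 big_ord1.
  rewrite mulnS addSn add1n 2!big_ord_recr /= IHa [_ ^+ (2 * a').+2]exprS sign_2S; ring.
rewrite mul1r (sum_even_terms (F := fun q => \tr (mpow AA (2 * a - q)) * \tr (mpow AA q))); last first.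
  by move=> q hq; rewrite (tr_odd hq) mulr0.
have -> : iota 0 a.+1 = index_iota 0 a.+1 by rewrite /index_iota subn0.
rewrite big_mkord /=.
have -> : \sum_(b < a.+1) PA b * PA (a - b) =
    ((- 4^-1) ^+ a) *: \sum_(b < a.+1) \tr (mpow AA (2 * a - 2 * b)) * \tr (mpow AA (2 * b)).
  rewrite scaler_sumr; apply: eq_bigr => b _; have hb := ltn_ord b.
  rewrite /PA -scalerAl -scalerAr scalerA -exprD subnKC; last by lia.
  by rewrite mulrC mulnBr.
rewrite /PA -scalerBr !scalerA; congr (_ *: _).
by rewrite exprS natrM; field.
Qed.

Lemma EulPA a : \sum_(v < L * L) mvar R v * mderiv v (PA a) = (2 * a)%:R *: PA a.
Proof.
pose D (f : mp) := \sum_(v < L * L) mvar R v * mderiv v f.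
have DD f g : D (f + g) = D f + D g.
  by rewrite /D -big_split /=; apply: eq_bigr => v _; rewrite mderivD mulrDr.
have DM f g : D (f * g) = D f * g + f * D g.
  rewrite /D mulr_suml mulr_sumr -big_split /=; apply: eq_bigr => v _.
  by rewrite mderivM; ring.
have -> : \sum_(v < L * L) mvar R v * mderiv v (PA a) =
    ((- 4^-1) ^+ a) *: D (\tr (mpow AA (2 * a))).
  by rewrite /D scaler_sumr; apply: eq_bigr => v _; rewrite /PA mderivZ scalerAr.
rewrite (derivation_trace_mpow DD DM) euler_AA.
case: a => [|a]; first by rewrite muln0 mul0r scaler0 scale0r.
rewrite -mpowSr prednK // /PA; set T := \tr _.
have -> : (2 * a.+1)%:R * T = (2 * a.+1)%:R *: T by rewrite scaler_nat mulr_natl.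
by rewrite !scalerA [X in X *: _]mulrC.
Qed.

End Side1.

(** * Gaussians weighted by a squared Vandermonde product *)

Section Side2.
Variables (R : realType) (k : nat).
Notation mp := (mpoly.mpoly k R).

Lemma mderiv_mvar (v w : 'I_k) : mderiv v (mvar R w) = (w == v)%:R :> mp.
Proof.
rewrite mderivX mnm1E; case: eqP => [->|_]; last by rewrite scale0r.
have -> : mnm_sub (mnm1 v) (mnm1 v) = mnm0 :> multinom k.
  by apply/mnmP => h; rewrite mnmBE subnn mnm0E.
by rewrite mpolyX0 scale1r.
Qed.

Definition ysq (j : 'I_k) : mp := 2^-1 *: mvar R j ^+ 2.

Lemma mvar_sqr j : mvar R j * mvar R j = 2%:R *: ysq j :> mp.
Proof. by rewrite /ysq scalerA divff ?scale1r ?expr2 // pnatr_eq0. Qed.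

Lemma mderiv_ysq (v j : 'I_k) : mderiv v (ysq j) = (j == v)%:R * mvar R j.
Proof.
rewrite /ysq mderivZ expr2 mderivM mderiv_mvar; set c : mp := _%:R.
have -> : c * mvar R j + mvar R j * c = 2%:R *: (c * mvar R j) by rewrite scaler_nat; ring.
by rewrite scalerA mulVf ?scale1r // pnatr_eq0.
Qed.

Lemma derivation_exp (A : comPzRingType) (D : A -> A) :
  (forall a b, D (a * b) = D a * b + a * D b) ->
  forall x n, D (x ^+ n) = n%:R * x ^+ n.-1 * D x.
Proof.
move=> DM x; elim=> [|n IH]; first by rewrite expr0 (derivation1 DM) !mul0r.
rewrite exprS DM IH -[n.+1%:R]/(n.+1%:R) -natr1 /=.
by case: n {IH} => [|n] /=; [rewrite !expr0|rewrite [x ^+ n.+1]exprS]; ring.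
Qed.

Lemma mderiv_ysq_exp (v j : 'I_k) a :
  mderiv v (ysq j ^+ a) = (j == v)%:R * (a%:R * ysq j ^+ a.-1 * mvar R j).
Proof. by rewrite (derivation_exp (@mderivM _ _ v)) mderiv_ysq; ring. Qed.

Definition psum (a : nat) : mp := \sum_j ysq j ^+ a.

(** Twice the power sum, because the squared eigenvalues of an antisymmetric matrix of even size
    come in equal pairs. *)
Definition PB (a : nat) : mp := 2%:R *: psum a.

Lemma mderiv_PB v a : mderiv v (PB a) = (2 * a)%:R * ysq v ^+ a.-1 * mvar R v.
Proof.
rewrite /PB /psum mderivZ (derivation_sum (@mderivD _ _ v)) (bigD1 v) //= big1 => [|j jv]; last first.
  by rewrite mderiv_ysq_exp (negbTE jv) mul0r.
by rewrite mderiv_ysq_exp eqxx mul1r addr0 scaler_nat natrM; ring.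
Qed.

Lemma ysq_mvar2 j a : ysq j ^+ a * (mvar R j * mvar R j) = 2%:R * ysq j ^+ a.+1.
Proof. by rewrite mvar_sqr scaler_nat exprS; ring. Qed.

Lemma GamPB a b : Gam (PB a) (PB b) = (4 * a * b)%:R *: PB (a + b).-1.
Proof.
rewrite /Gam; case: a => [|a].
  by rewrite !muln0 mul0n scale0r big1 // => j _; rewrite mderiv_PB muln0 !mul0r.
case: b => [|b].
  by rewrite !muln0 scale0r big1 // => j _; rewrite [X in _ * X]mderiv_PB muln0 !mul0r mulr0.
have -> : (a.+1 + b.+1).-1 = (a + b).+1 by lia.
transitivity (\sum_(j < k) ((4 * a.+1 * b.+1)%:R * 2%:R) *: ysq j ^+ (a + b).+1); last first.
  by rewrite /PB scalerA /psum scaler_sumr.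
apply: eq_bigr => j _.
rewrite !mderiv_PB /= -natrM scaler_nat.
transitivity ((2 * a.+1)%:R * (2 * b.+1)%:R * (ysq j ^+ (a + b) * (mvar R j * mvar R j)) : mp).
  by rewrite exprD; ring.
by rewrite ysq_mvar2 -[in RHS]mulr_natl !natrM; ring.
Qed.

(** The value 1 for the remaining pairs makes [vdmB] an unconditional product, the form in which the
    product rule is stated. *)
Definition vfac (u : 'I_k * 'I_k) : mp := if (u.1 < u.2)%N then ysq u.1 - ysq u.2 else 1.

Definition vdmB : mp := \prod_u vfac u.

Lemma sum_lt_sym (F : 'I_k -> 'I_k -> mp) : (forall i j, F i j = F j i) ->
  2%:R * \sum_(u : 'I_k * 'I_k | (u.1 < u.2)%N) F u.1 u.2 =
  \sum_i \sum_j F i j - \sum_i F i i.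
Proof.
move=> FC; rewrite pair_big /=.
rewrite [X in _ = X - _](bigID (fun u : 'I_k * 'I_k => (u.1 < u.2)%N)) /=.
rewrite [X in _ = _ + X - _](bigID (fun u : 'I_k * 'I_k => (u.2 < u.1)%N)) /=.
have -> : \sum_(u : 'I_k * 'I_k | ~~ (u.1 < u.2)%N && (u.2 < u.1)%N) F u.1 u.2 =
    \sum_(u : 'I_k * 'I_k | (u.1 < u.2)%N) F u.1 u.2.
  rewrite (reindex (fun u : 'I_k * 'I_k => (u.2, u.1))) /=; last first.
    by exists (fun u : 'I_k * 'I_k => (u.2, u.1)) => -[].
  by apply: eq_big => [[i j]|[i j] _] /=; [lia|exact: FC].
have -> : \sum_(u : 'I_k * 'I_k | ~~ (u.1 < u.2)%N && ~~ (u.2 < u.1)%N) F u.1 u.2 = \sum_i F i i.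
  rewrite (reindex_onto (fun i : 'I_k => (i, i)) (fun u : 'I_k * 'I_k => u.1)) /=.
    by apply: eq_bigl => i; rewrite eqxx ltnn.
  by move=> [i j] /= h; congr (_, _); apply/val_inj => /=; lia.
ring.
Qed.

(** The gradient of P_(a+1) is a multiple of the derivation [D], which sends y_i to 2 y_i^(a+1). It
    multiplies each factor y_i - y_j by 2 [h i j], a quotient of differences of powers, and the sum
    of these over pairs is a sum of products of power sums without its diagonal. The diagonal and
    the second derivatives together leave - P_a. *)
Lemma LapPB a : Lap vdmB (PB a) =
  a%:R *: (\sum_(b <- iota 0 a) PB b * PB (a.-1 - b)%N - PB a.-1) * vdmB.
Proof.
case: a => [|a].
  rewrite /Lap big1 ?scale0r ?mul0r // => j _.
  by rewrite mderiv_PB muln0 !mul0r mderiv0 mul0r scaler0 addr0.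
rewrite /Lap big_split /= -mulr_suml.
have -> : \sum_(j < k) mderiv j (mderiv j (PB a.+1)) = (2 * a.+1 * (2 * a).+1)%:R * psum a.
  rewrite /psum mulr_sumr; apply: eq_bigr => j _.
  rewrite mderiv_PB /= mderivM mderivM mderiv_ysq_exp eqxx mderiv_mvar eqxx.
  rewrite (_ : mderiv j (2 * a.+1)%:R = 0); last first.
    by rewrite -[_%:R]mulr1 mulr_natl mderivMn mderiv1 mul0rn.
  case: a => [|a] /=; first by rewrite !expr0; ring.
  have h := ysq_mvar2 j a.
  have E : ((2 * a.+1).+1)%:R = 2%:R * a.+1%:R + 1 :> mp by rewrite -natr1 natrM.
  transitivity ((2 * a.+2)%:R * (a.+1%:R * (ysq j ^+ a * (mvar R j * mvar R j)) + ysq j ^+ a.+1) : mp).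
    by ring.
  by rewrite h [in RHS]natrM E; ring.
pose D (f : mp) := \sum_(j < k) ysq j ^+ a * mvar R j * mderiv j f.
have DD f g : D (f + g) = D f + D g.
  by rewrite /D -big_split /=; apply: eq_bigr => v _; rewrite mderivD mulrDr.
have DM f g : D (f * g) = D f * g + f * D g.
  rewrite /D mulr_suml mulr_sumr -big_split /=; apply: eq_bigr => v _.
  by rewrite mderivM; ring.
have Dy i : D (ysq i) = 2%:R * ysq i ^+ a.+1.
  rewrite /D (bigD1 i) //= big1 => [|j ij]; last by rewrite mderiv_ysq eq_sym (negbTE ij) mul0r mulr0.
  by rewrite mderiv_ysq eqxx mul1r addr0 -mulrA ysq_mvar2.
have DN f : D (- f) = - D f.
  by rewrite /D -sumrN; apply: eq_bigr => j _; rewrite mderivN mulrN.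
pose h (i j : 'I_k) : mp := \sum_(b < a.+1) ysq i ^+ (a - b) * ysq j ^+ b.
have Dv : D vdmB = 2%:R * (\sum_(u : 'I_k * 'I_k | (u.1 < u.2)%N) h u.1 u.2) * vdmB.
  rewrite /vdmB (derivation_prod DM) [X in 2%:R * X]big_mkcond mulr_sumr mulr_suml /=.
  apply: eq_bigr => u _; rewrite [in RHS](bigD1 u) //= mulrA; congr (_ * _).
  rewrite /vfac; case: ifP => _; last by rewrite (derivation1 DM) mulr0 mul0r.
  by rewrite DD DN !Dy -mulrBr subrXX -mulrA; congr (_ * _); rewrite mulrC.
have -> : \sum_(j < k) 2%:R *: (mderiv j (PB a.+1) * mderiv j vdmB) =
    2%:R * (2 * a.+1)%:R * D vdmB.
  rewrite /D mulr_sumr; apply: eq_bigr => j _; rewrite mderiv_PB /= scaler_nat -mulr_natl; ring.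
have hC i j : h i j = h j i.
  rewrite /h (reindex_inj rev_ord_inj) /=; apply: eq_bigr => b _.
  rewrite subSS mulrC subKn //; have := ltn_ord b; lia.
have H := sum_lt_sym hC.
have S1 : \sum_i \sum_j h i j = \sum_(b <- iota 0 a.+1) psum b * psum (a - b).
  have -> : iota 0 a.+1 = index_iota 0 a.+1 by rewrite /index_iota subn0.
  rewrite big_mkord /h; under eq_bigr do rewrite exchange_big /=.
  rewrite exchange_big /=; apply: eq_bigr => b _.
  rewrite mulrC /psum mulr_suml; apply: eq_bigr => i _.
  by rewrite mulr_sumr.
have S2 : \sum_i h i i = a.+1%:R * psum a.
  rewrite /psum mulr_sumr; apply: eq_bigr => i _.
  rewrite /h (eq_bigr (fun=> ysq i ^+ a)); first by rewrite sumr_const card_ord mulr_natl.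
  by move=> b _; rewrite -exprD subnK // -ltnS.
rewrite S1 S2 in H.
have -> : \sum_(b <- iota 0 a.+1) PB b * PB (a.+1.-1 - b)%N =
    4%:R * \sum_(b <- iota 0 a.+1) psum b * psum (a - b).
  rewrite mulr_sumr; apply: eq_bigr => b _; rewrite /PB !scaler_nat /=; ring.
have -> : \sum_(b <- iota 0 a.+1) psum b * psum (a - b) =
    2%:R * (\sum_(u : 'I_k * 'I_k | (u.1 < u.2)%N) h u.1 u.2) + a.+1%:R * psum a.
  by rewrite H subrK.
have E : ((2 * a).+1)%:R = 2%:R * a%:R + 1 :> mp by rewrite -natr1 natrM.
have E1 : (a.+1)%:R = a%:R + 1 :> mp by rewrite -natr1.
rewrite Dv /PB !scaler_nat [(2 * a.+1 * _)%:R]natrM [(2 * a.+1)%:R]natrM E E1 /=; ring.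
Qed.

Lemma EulPB a : \sum_(v < k) mvar R v * mderiv v (PB a) = (2 * a)%:R *: PB a.
Proof.
case: a => [|a].
  by rewrite muln0 scale0r big1 // => j _; rewrite mderiv_PB muln0 !mul0r mulr0.
transitivity (\sum_(j < k) (2 * a.+1)%:R *: (2%:R *: ysq j ^+ a.+1)); last first.
  by rewrite /PB /psum !scaler_sumr.
apply: eq_bigr => j _; rewrite mderiv_PB /= !scaler_nat.
transitivity ((2 * a.+1)%:R * (ysq j ^+ a * (mvar R j * mvar R j)) : mp); first by ring.
by rewrite ysq_mvar2; ring.
Qed.

Lemma mev_ysq v j : mev v (ysq j) = v j ^+ 2 / 2.
Proof. by rewrite /ysq mevZ !expr2 mevM mevX mulrC. Qed.

Lemma mev_sum M (v : nat -> R) (I : Type) (r : seq I) (Q : pred I) (F : I -> mpoly.mpoly M R) :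
  mev v (\sum_(i <- r | Q i) F i) = \sum_(i <- r | Q i) mev v (F i).
Proof. exact: (big_morph (mev v) (@mevD R M v) (@mev0 R M v)). Qed.

Lemma mev_prod M (v : nat -> R) (I : Type) (r : seq I) (Q : pred I) (F : I -> mpoly.mpoly M R) :
  mev v (\prod_(i <- r | Q i) F i) = \prod_(i <- r | Q i) mev v (F i).
Proof. exact: (big_morph (mev v) (@mevM R M v) (@mev1 R M v)). Qed.

Lemma mev_exp M (v : nat -> R) (f : mpoly.mpoly M R) a : mev v (f ^+ a) = mev v f ^+ a.
Proof. by elim: a => [|a IH]; [rewrite !expr0 mev1|rewrite !exprS mevM IH]. Qed.

Lemma mev_PB v a : mev v (PB a) = 2 * \sum_(j < k) (v j ^+ 2 / 2) ^+ a.
Proof.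
by rewrite /PB mevZ mev_sum; congr (_ * _); apply: eq_bigr => j _; rewrite mev_exp mev_ysq.
Qed.

Lemma mev_vdmB v : mev v vdmB =
  \prod_(u : 'I_k * 'I_k | (u.1 < u.2)%N) (v u.1 ^+ 2 / 2 - v u.2 ^+ 2 / 2).
Proof.
rewrite /vdmB mev_prod [RHS]big_mkcond /=; apply: eq_bigr => u _.
by rewrite /vfac; case: ifP => _; rewrite ?mev1 // mevB !mev_ysq.
Qed.

End Side2.

(** * The binomial law *)

Section BinomialLaw.
Variable R : realType.
Implicit Types (x d : R) (N q : nat) (f : nat -> R).

Definition binl N q x : R := 'C(N, q)%:R * x ^+ q * (1 - x) ^+ (N - q).

Lemma binl_ge0 N q x : 0 <= x <= 1 -> 0 <= binl N q x.
Proof.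
by move=> /andP[x0 x1]; rewrite /binl !mulr_ge0 ?exprn_ge0 // subr_ge0.
Qed.

Lemma binl_sumS N x f : \sum_(q < N.+2) binl N.+1 q x * f q =
  x * (\sum_(q < N.+1) binl N q x * f q.+1) + (1 - x) * (\sum_(q < N.+1) binl N q x * f q).
Proof.
have -> : \sum_(q < N.+1) binl N q x * f q = \sum_(q < N.+2) binl N q x * f q.
  by rewrite [RHS]big_ord_recr /= /binl bin_small // !mul0r addr0.
rewrite [\sum_(q < N.+2) binl N q x * f q]big_ord_recl [LHS]big_ord_recl /=.
rewrite mulrDr addrCA; congr (_ + _).
  by rewrite /binl !bin0 !expr0 !subn0 exprS; ring.
rewrite !mulr_sumr -big_split /=; apply: eq_bigr => q _.
rewrite /bump leq0n add1n /binl subSS binS natrD exprS.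
have [qN|qN] := leqP N q.
  by rewrite (@bin_small N q.+1) ?ltnS //; ring.
by rewrite -[(N - q)%N]prednK ?subn_gt0 // -subnS exprS; ring.
Qed.

Lemma binl_sum1 N x : \sum_(q < N.+1) binl N q x = 1.
Proof.
elim: N => [|N IH]; first by rewrite big_ord1 /binl bin0 !expr0 !mulr1.
have := binl_sumS N x (fun=> 1); under eq_bigr do rewrite mulr1.
by move=> ->; under eq_bigr do rewrite mulr1; rewrite IH; ring.
Qed.

Lemma binl_sqdist N x (a : R) : \sum_(q < N.+1) binl N q x * (q%:R - a) ^+ 2 =
  N%:R * x * (1 - x) + (N%:R * x - a) ^+ 2.
Proof.
elim: N a => [|N IH] a; first by rewrite big_ord1 /binl /= ?bin0 ?subnn !expr0 !mul1r !mul0r !add0r.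
rewrite (binl_sumS N x (fun q => (q%:R - a) ^+ 2)) IH.
under eq_bigr do rewrite -natr1 -addrA -[1 - a]opprB.
by rewrite IH -natr1; ring.
Qed.

Lemma binl_chebyshev N x d (A : pred nat) : 0 <= x <= 1 -> 0 < d ->
  (forall q, A q -> d <= `|q%:R - N%:R * x|) ->
  \sum_(q < N.+1 | A q) binl N q x <= N%:R / d ^+ 2.
Proof.
move=> hx d0 hA; rewrite ler_pdivlMr ?exprn_gt0 // mulr_suml.
apply: (@le_trans _ _ (\sum_(q < N.+1) binl N q x * (q%:R - N%:R * x) ^+ 2)).
  rewrite [leRHS](bigID (fun q : 'I_N.+1 => A q)) /= -[leLHS]addr0; apply: lerD.
    apply: ler_sum => q Aq; rewrite ler_wpM2l ?binl_ge0 // -[leRHS]real_normK ?num_real //.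
    by rewrite lerXn2r ?nnegrE ?hA // ltW.
  by apply: sumr_ge0 => q _; rewrite mulr_ge0 ?binl_ge0 ?sqr_ge0.
move/andP: hx => [x0 x1].
rewrite binl_sqdist subrr expr0n addr0 -mulrA -[leRHS]mulr1 ler_wpM2l //.
by rewrite -[leRHS]mulr1 ler_pM ?subr_ge0 // gerBl.
Qed.

(** The probability that a binomial variable with N = (K + 1)^3 trials is at least N x0 - N^(2/3).
    This margin exceeds the standard deviation, of order N^(1/2), and is negligible against N, so
    the limit is the closed step at every x, including x = x0. *)
Definition bstep (x0 : R) (K : nat) x : R :=
  \sum_(q < (K.+1 ^ 3).+1 | K.+1%:R ^+ 3 * x0 - K.+1%:R ^+ 2 <= q%:R) binl (K.+1 ^ 3) q x.

Lemma bstep_bound x0 K x : 0 <= x <= 1 -> 0 <= bstep x0 K x <= 1.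
Proof.
move=> hx; apply/andP; split; first by apply: sumr_ge0 => q _; exact: binl_ge0.
rewrite -[leRHS](binl_sum1 (K.+1 ^ 3) x) /bstep big_mkcond; apply: ler_sum => q _.
by case: ifP => // _; exact: binl_ge0.
Qed.

Lemma bstep_cvg x0 x : 0 <= x <= 1 -> bstep x0 K x @[K --> \oo] --> ((x0 <= x)%R%:R : R).
Proof.
move=> hx; have [xx0|xx0] := leP x0 x.
  have h1 : (1 - harmonic K) @[K --> \oo] --> (1 : R).
    rewrite -[X in _ --> X]subr0; apply: cvgB; first exact: cvg_cst.
    exact: cvg_harmonic.
  apply: (squeeze_cvgr _ h1 (cvg_cst (1 : R))).
  apply: nearW => K; have /andP[_ ->] := bstep_bound x0 K hx; rewrite andbT.
  rewrite -[X in X - _](binl_sum1 (K.+1 ^ 3) x) (bigID (fun q : 'I_ _ =>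
    K.+1%:R ^+ 3 * x0 - K.+1%:R ^+ 2 <= q%:R)) /= -addrA gerDl subr_le0.
  have K0 : 0 < K.+1%:R ^+ 2 :> R by rewrite exprn_gt0.
  apply: (le_trans (@binl_chebyshev (K.+1 ^ 3) x _
    (fun q : nat => ~~ (K.+1%:R ^+ 3 * x0 - K.+1%:R ^+ 2 <= q%:R)) hx K0 _)).
    move=> q; rewrite -ltNge natrX => hq; rewrite distrC ler_normr; apply/orP; left.
    have : K.+1%:R ^+ 3 * x0 <= K.+1%:R ^+ 3 * x by rewrite ler_wpM2l ?exprn_ge0.
    move: hq; lra.
  rewrite natrX /harmonic le_eqVlt; apply/orP; left; apply/eqP.
  by field; rewrite addrC natr1 pnatr_eq0.
pose e := x0 - x; have e0 : 0 < e by rewrite subr_gt0.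
have h1 : (4 / e ^+ 2 * harmonic K) @[K --> \oo] --> (0 : R).
  rewrite -[X in _ --> X](mulr0 (4 / e ^+ 2)); apply: cvgMr; exact: cvg_harmonic.
apply: (squeeze_cvgr _ (cvg_cst (0 : R)) h1).
near=> K; have /andP[-> _] := bstep_bound x0 K hx; rewrite andTb.
have Ke : 2 / e <= K.+1%:R.
  by near: K; apply: filterS (nbhs_infty_ger (2 / e)) => n hn; rewrite (le_trans hn) // ler_nat.
have {}Ke : 2 <= K.+1%:R * e by rewrite -ler_pdivrMr.
set k := K.+1%:R in Ke *.
have k1 : 1 <= k by rewrite /k ler1n.
have k0 : 0 < k by lra.
have d0 : 0 < k ^+ 3 * e / 2 by rewrite divr_gt0 // mulr_gt0 // exprn_gt0.
apply: (le_trans (@binl_chebyshev (K.+1 ^ 3) x _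
  (fun q : nat => k ^+ 3 * x0 - k ^+ 2 <= q%:R) hx d0 _)).
  move=> q; rewrite natrX -/k => hq; rewrite ler_normr; apply/orP; left.
  have : k ^+ 2 * 2 <= k ^+ 2 * (k * e) by rewrite ler_wpM2l ?exprn_ge0 // ltW.
  have -> : k ^+ 2 * (k * e) = k ^+ 3 * e by ring.
  move: hq; rewrite /e; lra.
rewrite natrX -/k /harmonic /= -/k.
have -> : k ^+ 3 / (k ^+ 3 * e / 2) ^+ 2 = 4 / e ^+ 2 * (k ^+ 3)^-1.
  by field; rewrite !gt_eqF.
rewrite ler_wpM2l //; first by rewrite divr_ge0 // exprn_ge0 // ltW.
rewrite lef_pV2 ?posrE ?exprn_gt0 //.
by rewrite -[leLHS]expr1 ler_weXn2l.
Unshelve. all: by end_near. Qed.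

End BinomialLaw.

(** * Comparison of two systems with the same recursion *)

Section Rdominated.
Context d (T : measurableType d) (R : realType) (mu : {measure set T -> \bar R}).

Lemma Rdominated_cvg (F : nat -> T -> R) (f g : T -> R) :
  (forall n, measurable_fun setT (F n)) -> (forall x, F n x @[n --> \oo] --> f x) ->
  mu.-integrable setT (fun x => (g x)%:E) -> (forall n x, `|F n x| <= g x) ->
  mu.-integrable setT (fun x => (f x)%:E) /\
  ((\int[mu]_x (F n x))%R @[n --> \oo] --> (\int[mu]_x (f x))%R).
Proof.
move=> mF cF ig hF.
have mf : measurable_fun setT f.
  by apply: (measurable_fun_cvg mF) => x _; exact: cF.
have hf x : `|f x| <= g x.
  apply: (cvgr_to_le (cvg_norm (cF x))).
  by apply: nearW => n; exact: hF.
have igf : mu.-integrable setT (fun x => (f x)%:E).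
  apply: (le_integrable measurableT _ _ ig); first exact/measurable_EFinP.
  by move=> x _; rewrite !abse_EFin lee_fin (le_trans (hf x)) // ler_norm.
split=> //.
have igF n : mu.-integrable setT (fun x => (F n x)%:E).
  apply: (le_integrable measurableT _ _ ig); first exact/measurable_EFinP.
  by move=> x _; rewrite !abse_EFin lee_fin (le_trans (hF n x)) // ler_norm.
apply: fine_cvg; rewrite fineK; last exact: integrable_fin_num.
apply: (@dominated_cvg _ _ _ mu setT measurableT (fun n x => (F n x)%:E) _ (fun x => (g x)%:E)) => //.
- by move=> n; exact/measurable_EFinP.
- by move=> x _; apply: cvg_EFin; [apply: nearW|exact: cF].
- by move=> n x _; rewrite abse_EFin lee_fin hF.
Qed.

End Rdominated.

Lemma cvg_sumr (R : realType) (I : Type) (r : seq I) (u : I -> nat -> R) (a : I -> R) :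
  (forall i, u i n @[n --> \oo] --> a i) ->
  (\sum_(i <- r) u i n) @[n --> \oo] --> \sum_(i <- r) a i.
Proof.
move=> h; elim: r => [|i r IH].
  by under eq_fun do rewrite big_nil; rewrite big_nil; exact: cvg_cst.
by under eq_fun do rewrite big_cons; rewrite big_cons; exact: cvgD.
Qed.

Lemma cvg_prodr (R : realType) (I : Type) (r : seq I) (u : I -> nat -> R) (a : I -> R) :
  (forall i, u i n @[n --> \oo] --> a i) ->
  (\prod_(i <- r) u i n) @[n --> \oo] --> \prod_(i <- r) a i.
Proof.
move=> h; elim: r => [|i r IH].
  by under eq_fun do rewrite big_nil; rewrite big_nil; exact: cvg_cst.
by under eq_fun do rewrite big_cons; rewrite big_cons; exact: cvgM.
Qed.

Section ExpSeries.
Variable R : realType.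

Definition expser (n : nat) (x : R) : R := \sum_(i < n) x ^+ i / i`!%:R.

Lemma expser_series n x : expser n x = series (exp_coeff x) n.
Proof. by rewrite /expser /series /= big_mkord. Qed.

Lemma expser_cvg x : expser n x @[n --> \oo] --> expR x.
Proof.
rewrite (_ : (fun n => expser n x) = series (exp_coeff x)).
  exact: is_cvg_series_exp_coeff.
by apply/funext => n; exact: expser_series.
Qed.

Lemma expser_ge0 n x : 0 <= x -> 0 <= expser n x.
Proof. by move=> x0; apply: sumr_ge0 => i _; rewrite divr_ge0 // exprn_ge0. Qed.

Lemma expser_le n x : 0 <= x -> expser n x <= expR x.
Proof.
move=> x0; rewrite expser_series; apply: nondecreasing_cvgn_le.
  apply/nondecreasing_seqP => m; rewrite /series /= big_nat_recr //= lerDl /exp_coeff /=.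
  by rewrite divr_ge0 // exprn_ge0.
exact: is_cvg_series_exp_coeff.
Qed.

End ExpSeries.

Section Formal.
Variable R : realType.
Implicit Types (e : (nat -> R) -> R) (g : nat -> R).

Definition feval g (F : seq (R * seq nat)) : R := \sum_(u <- F) u.1 * \prod_(a <- u.2) g a.

(** Polynomial in finitely many values of [g]: once two models agree on the expectations of all
    products of such values, they agree on [e]. *)
Definition definable e := exists F, forall g, e g = feval g F.

Lemma definable_cst c : definable (fun _ => c).
Proof. by exists [:: (c, [::])] => g; rewrite /feval big_seq1 big_nil mulr1. Qed.

Lemma definable_var a : definable (fun g => g a).
Proof. by exists [:: (1, [:: a])] => g; rewrite /feval !big_seq1 mul1r. Qed.

Lemma definableD e1 e2 : definable e1 -> definable e2 -> definable (fun g => e1 g + e2 g).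
Proof.
by move=> [F1 h1] [F2 h2]; exists (F1 ++ F2) => g; rewrite /feval big_cat h1 h2.
Qed.

Lemma definableM e1 e2 : definable e1 -> definable e2 -> definable (fun g => e1 g * e2 g).
Proof.
move=> [F1 h1] [F2 h2].
exists [seq (u.1 * w.1, u.2 ++ w.2) | u <- F1, w <- F2] => g.
rewrite h1 h2 /feval big_flatten big_map mulr_suml; apply: eq_bigr => u _.
rewrite mulr_sumr big_map; apply: eq_bigr => w _ /=.
by rewrite big_cat mulrACA.
Qed.

Lemma definable_sum (I : Type) (r : seq I) (E : I -> (nat -> R) -> R) :
  (forall i, definable (E i)) -> definable (fun g => \sum_(i <- r) E i g).
Proof.
move=> h; elim: r => [|i r IH].
  rewrite (_ : (fun _ => _) = (fun _ => 0)); first exact: definable_cst.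
  by apply/funext => g; rewrite big_nil.
rewrite (_ : (fun _ => _) = (fun g => E i g + \sum_(j <- r) E j g)); first exact: definableD.
by apply/funext => g; rewrite big_cons.
Qed.

Lemma definable_prod (I : Type) (r : seq I) (E : I -> (nat -> R) -> R) :
  (forall i, definable (E i)) -> definable (fun g => \prod_(i <- r) E i g).
Proof.
move=> h; elim: r => [|i r IH].
  rewrite (_ : (fun _ => _) = (fun _ => 1)); first exact: definable_cst.
  by apply/funext => g; rewrite big_nil.
rewrite (_ : (fun _ => _) = (fun g => E i g * \prod_(j <- r) E j g)); first exact: definableM.
by apply/funext => g; rewrite big_cons.
Qed.

Lemma definable_exp e n : definable e -> definable (fun g => e g ^+ n).
Proof.
move=> h; elim: n => [|n IH].
  rewrite (_ : (fun _ => _) = (fun _ => 1)); first exact: definable_cst.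
  by apply/funext => g; rewrite expr0.
rewrite (_ : (fun _ => _) = (fun g => e g * e g ^+ n)); first exact: definableM.
by apply/funext => g; rewrite exprS.
Qed.

End Formal.

(** Complements [rec_unique], whose proportionality gives no information when the value at the empty
    list is 0. *)
Lemma rec_zero (R : realType) (s c : R) (I : seq nat -> R) : 0 <= s ->
  (forall l, (1 + 2 * s) * (2 * (sumn l)%:R) * I l = \sum_(u <- LL R l) u.1 * I u.2) ->
  (forall l, I (0%N :: l) = c * I l) -> I [::] = 0 -> forall l, I l = 0.
Proof.
move=> s0 r z I0 l; have [d] := ubnP (sumn l); elim: d l => // d IH l hl.
case: (posnP (sumn l)) => [h0|lpos].
  have {h0} : all (pred1 0%N) l by move/eqP: h0; rewrite -leqn0; elim: (l) => //= a l' IHl h; rewrite IHl; lia.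
  by elim: (l) => [//|a l' IHl /= /andP[/eqP -> /IHl h]]; rewrite z h mulr0.
have K0 : (1 + 2 * s) * (2 * (sumn l)%:R) != 0.
  by rewrite mulf_neq0 // ?mulf_neq0 ?pnatr_eq0 -?lt0n // gt_eqF //; lra.
apply: (mulfI K0); rewrite r mulr0 big1_seq // => u /andP[_ /LL_deg[->|hu]].
  by rewrite mul0r.
by rewrite IH ?mulr0 //; exact: (leq_trans hu).
Qed.

(** What a model must supply: Gaussian coordinates, a density c V^2 of total mass 1, and L values
    y_j whose power sums are polynomials obeying the common identities. The y_j are bare functions;
    measurability enters through the polynomials [ss_P]. *)
Record spectral_system (R : realType) (L : nat) := SpectralSystem {
  ss_dim : nat;
  ss_P : nat -> mpoly.mpoly ss_dim R;
  ss_V : mpoly.mpoly ss_dim R;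
  ss_c : R;
  ss_y : (nat -> R) -> 'I_L -> R;
  ss_Gam : forall a b, Gam (ss_P a) (ss_P b) = (4 * a * b)%:R *: ss_P (a + b).-1;
  ss_Lap : forall a, Lap ss_V (ss_P a) =
    a%:R *: (\sum_(b <- iota 0 a) ss_P b * ss_P (a.-1 - b)%N - ss_P a.-1) * ss_V;
  ss_Eul : forall a, \sum_(j < ss_dim) mvar R j * mderiv j (ss_P a) = (2 * a)%:R *: ss_P a;
  ss_y_ge0 : forall v j, 0 <= ss_y v j;
  ss_PE : forall v a, mev v (ss_P a) = \sum_j ss_y v j ^+ a;
  ss_P0 : ss_P 0 = L%:R;
  ss_c_ge0 : 0 <= ss_c;
  ss_mass : ss_c * Iexp (ss_P 1) 0 (ss_V ^+ 2) = 1
}.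

Section System.
Variables (R : realType) (L : nat) (S : spectral_system R L).
Notation M := (ss_dim S).
Notation y := (ss_y S).
Notation mp := (mpoly.mpoly M R).

Lemma ss_P1_ge0 v : 0 <= mev v (ss_P S 1).
Proof. by rewrite ss_PE sumr_ge0 // => j _; rewrite expr1 ss_y_ge0. Qed.

Definition ss_w (v : nat -> R) : R := ss_c S * mev v (ss_V S ^+ 2).

Lemma ss_w_ge0 v : 0 <= ss_w v.
Proof. by rewrite mulr_ge0 ?ss_c_ge0 // mev_exp sqr_ge0. Qed.

Lemma measurable_ss_w : measurable_fun setT (ss_w : seqspace R -> R).
Proof. by apply: measurable_funM => //; exact: measurable_mev. Qed.

Lemma integrable_ss_w : (gam R M).-integrable setT (fun v => (ss_w v)%:E).
Proof.
have := @integrable_mev R M (ss_P S 1) 0 (lexx 0) ss_P1_ge0 (ss_c S *: ss_V S ^+ 2).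
apply: eq_integrable => // v _.
by rewrite /expw mul0r oppr0 expR0 mulr1 mevZ.
Qed.

Definition ss_E (F : (nat -> R) -> R) : R := (\int[gam R M]_v (F v * ss_w v))%R.

Lemma ss_integrable (F : seqspace R -> R) (K : R) : measurable_fun setT F ->
  (forall v, `|F v| <= K) -> (gam R M).-integrable setT (fun v => (F v * ss_w v)%:E).
Proof.
move=> mF hF.
have iK : (gam R M).-integrable setT (fun v => (K * ss_w v)%:E).
  rewrite (_ : (fun _ => _) = (fun v => K%:E * (ss_w v)%:E)%E); last by apply/funext => v; rewrite EFinM.
  by apply: integrableZl => //; exact: integrable_ss_w.
apply: (le_integrable measurableT _ _ iK).
  by apply/measurable_EFinP; apply: measurable_funM => //; exact: measurable_ss_w.
move=> v _; rewrite !abse_EFin lee_fin !normrM ler_wpM2r //.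
by rewrite (le_trans (hF v)) // ler_norm.
Qed.

Lemma ss_dominated (F : nat -> seqspace R -> R) (f : seqspace R -> R) (K : R) :
  (forall n, measurable_fun setT (F n)) -> (forall v, F n v @[n --> \oo] --> f v) ->
  (forall n v, `|F n v| <= K) -> (ss_E (F n) @[n --> \oo] --> ss_E f).
Proof.
move=> mF cF hF.
have [||||_] := @Rdominated_cvg _ _ _ (gam R M) (fun n v => F n v * ss_w v)
  (fun v => f v * ss_w v) (fun v => K * ss_w v); last by [].
- by move=> n; apply: measurable_funM => //; exact: measurable_ss_w.
- by move=> v; apply: cvgMl; exact: cF.
- rewrite (_ : (fun _ => _) = (fun v => K%:E * (ss_w v)%:E)%E); last by apply/funext => v; rewrite EFinM.
  by apply: integrableZl => //; exact: integrable_ss_w.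
- by move=> n v; rewrite normrM [ `|ss_w v|]ger0_norm ?ss_w_ge0 // ler_wpM2r ?ss_w_ge0.
Qed.

Lemma ss_E_lin (I : Type) (r : seq I) (a : I -> R) (F : I -> seqspace R -> R) (K : I -> R) :
  (forall i, measurable_fun setT (F i)) -> (forall i v, `|F i v| <= K i) ->
  ss_E (fun v => \sum_(i <- r) a i * F i v) = \sum_(i <- r) a i * ss_E (F i).
Proof.
move=> mF hF; have iF i := ss_integrable (mF i) (hF i).
elim: r => [|i r IH].
  rewrite big_nil /ss_E; transitivity (\int[gam R M]_v (0 : R))%R.
    by apply: eq_Rintegral => v _; rewrite big_nil mul0r.
  by rewrite /Rintegral integral0.
rewrite big_cons -IH /ss_E -RintegralZl //.
transitivity (\int[gam R M]_v (a i * (F i v * ss_w v) + (\sum_(j <- r) a j * F j v) * ss_w v))%R.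
  by apply: eq_Rintegral => v _; rewrite big_cons mulrDl mulrA.
apply: RintegralD => //.
- apply: (eq_integrable measurableT (fun v => (a i)%:E * (F i v * ss_w v)%:E)%E).
    by move=> v _; rewrite -EFinM.
  exact: integrableZl.
- apply: (@ss_integrable (fun v => \sum_(j <- r) a j * F j v) (\sum_(j <- r) `|a j| * K j)).
    by apply: measurable_sum => j; apply: measurable_funM.
  move=> v; apply: (le_trans (ler_norm_sum _ _ _)); apply: ler_sum => j _.
  by rewrite normrM ler_wpM2l.
- exact: iF.
Qed.

Definition ss_J (s : R) (f : mp) : R := ss_c S * Iexp (ss_P S 1) s (f * ss_V S ^+ 2).

Lemma ss_J_sum s (I : Type) (r : seq I) (a : I -> R) (f : I -> mp) : 0 <= s ->
  ss_J s (\sum_(i <- r) a i *: f i) = \sum_(i <- r) a i * ss_J s (f i).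
Proof.
move=> s0; rewrite /ss_J mulr_suml Iexp_sum //; last exact: ss_P1_ge0.
rewrite mulr_sumr; apply: eq_bigr => i _.
rewrite -scalerAl IexpZ //; last exact: ss_P1_ge0.
by rewrite mulrCA.
Qed.

Lemma ss_J_E s f : 0 <= s ->
  ss_J s f = ss_E (fun v => mev v f * expR (- (s * mev v (ss_P S 1)))).
Proof.
move=> s0; rewrite /ss_J /Iexp -RintegralZl //; last first.
  by apply: integrable_mev => //; exact: ss_P1_ge0.
apply: eq_Rintegral => v _; rewrite mevM /expw /ss_w; ring.
Qed.

Definition ss_I (s : R) (l : seq nat) : R := ss_J s (prodP (ss_P S) l).

Lemma ss_I_rec s l : 0 <= s ->
  (1 + 2 * s) * (2 * (sumn l)%:R) * ss_I s l = \sum_(u <- LL R l) u.1 * ss_I s u.2.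
Proof.
move=> s0; rewrite /ss_I /ss_J mulrCA (Iexp_rec (@ss_Gam _ _ S) (@ss_Lap _ _ S) (@ss_Eul _ _ S)) //.
  by rewrite mulr_sumr; apply: eq_bigr => u _; rewrite mulrCA.
exact: ss_P1_ge0.
Qed.

Lemma ss_I0 s l : 0 <= s -> ss_I s (0%N :: l) = L%:R * ss_I s l.
Proof.
move=> s0; rewrite /ss_I /ss_J /prodP big_cons -/(prodP _ l) ss_P0 [RHS]mulrCA; congr (_ * _).
rewrite -IexpZ //; last exact: ss_P1_ge0.
by congr Iexp; rewrite -mulrA scaler_nat mulr_natl.
Qed.

Lemma ss_E1 : ss_E (fun=> 1) = 1.
Proof.
rewrite -[RHS](ss_mass S) /ss_E /Iexp -RintegralZl //; last first.
  by apply: integrable_mev => //; exact: ss_P1_ge0.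
by apply: eq_Rintegral => v _; rewrite /expw mul0r oppr0 expR0 mulr1 mul1r.
Qed.

(* Expanding 1 = e^{-s P_1} e^{s P_1} expresses the total mass by the moments at s. *)
Lemma ss_series s : 0 <= s ->
  (\sum_(i < n) s ^+ i / i`!%:R * ss_I s (nseq i 1%N)) @[n --> \oo] --> (1 : R).
Proof.
move=> s0.
have p0 := ss_P1_ge0.
have mP : measurable_fun setT (fun v : seqspace R => mev v (ss_P S 1)) by exact: measurable_mev.
have mexp : measurable_fun setT (fun v : seqspace R => expR (- (s * mev v (ss_P S 1)))).
  exact: measurable_expw.
pose F (n : nat) (v : seqspace R) := expser n (s * mev v (ss_P S 1)) * expR (- (s * mev v (ss_P S 1))).
have h : ss_E (F n) @[n --> \oo] --> ss_E (fun=> 1).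
  apply: (@ss_dominated F (fun=> 1) 1).
  - move=> n; apply: measurable_funM => //; apply: measurable_sum => i.
    apply: measurable_funM => //; apply: measurable_funX; exact: measurable_funM.
  - move=> v; rewrite -(expR0 R) -(subrr (s * mev v (ss_P S 1))) expRD; apply: cvgMl.
    exact: expser_cvg.
  - move=> n v; have sp : 0 <= s * mev v (ss_P S 1) by rewrite mulr_ge0.
    rewrite /F ger0_norm ?mulr_ge0 ?expR_ge0 ?expser_ge0 // expRN ler_pdivrMr ?expR_gt0 // mul1r.
    exact: expser_le.
rewrite ss_E1 in h; rewrite (_ : (fun n => _) = (fun n => ss_E (F n))) //.
apply/funext => n; rewrite -ss_J_sum // ss_J_E //; congr ss_E; apply/funext => v.
congr (_ * _); rewrite mev_sum; apply: eq_bigr => i _.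
by rewrite mevZ /prodP big_nseq iter_mulr_1 mev_exp exprMn mulrAC.
Qed.

Lemma measurable_definable (e : (nat -> R) -> R) (G : seqspace R -> nat -> R) :
  definable e -> (forall a, measurable_fun setT (fun v => G v a)) ->
  measurable_fun setT (fun v => e (G v)).
Proof.
move=> [F hF] mG; rewrite (_ : (fun _ => _) = (fun v => feval (G v) F)); last first.
  by apply/funext => v; rewrite hF.
apply: measurable_sum => u; apply: measurable_funM => //.
by apply: measurable_prod => a _.
Qed.

Lemma ss_E_definable s (F : seq (R * seq nat)) : 0 <= s ->
  ss_E (fun v => feval (fun a => mev v (ss_P S a)) F * expR (- (s * mev v (ss_P S 1)))) =
  \sum_(u <- F) u.1 * ss_I s u.2.
Proof.
move=> s0; rewrite -ss_J_sum // ss_J_E //; congr ss_E; apply/funext => v; congr (_ * _).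
by rewrite mev_sum; apply: eq_bigr => u _; rewrite mevZ mev_prod.
Qed.

Definition ss_T (v : nat -> R) (m : nat) : R := \sum_j expR (- (m%:R * y v j)).

(** The partial sum of order D of sum_j exp(m (P_1 - y_j)), expanded by the binomial formula so that
    only power sums occur. *)
Definition laplace_approx (D m : nat) (g : nat -> R) : R :=
  \sum_(0 <= d < D) m%:R ^+ d / d`!%:R *
    \sum_(0 <= a < d.+1) (-1) ^+ a * g 1%N ^+ (d - a) * g a * 'C(d, a)%:R.

Lemma definable_laplace_approx D m : definable (laplace_approx D m).
Proof.
apply: definable_sum => d; apply: definableM; first exact: definable_cst.
apply: definable_sum => a; apply: definableM; last exact: definable_cst.
apply: definableM; last exact: definable_var.
by apply: definableM; [exact: definable_cst|apply: definable_exp; exact: definable_var].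
Qed.

Lemma laplace_approxE D m v : laplace_approx D m (fun a => mev v (ss_P S a)) =
  \sum_j expser D (m%:R * (mev v (ss_P S 1) - y v j)).
Proof.
rewrite exchange_big /= /laplace_approx big_mkord.
apply: eq_bigr => d _; under [RHS]eq_bigr do rewrite exprMn mulrAC.
rewrite -mulr_sumr; congr (_ * _).
under [RHS]eq_bigr do rewrite exprBn.
rewrite exchange_big /= big_mkord; apply: eq_bigr => a _.
rewrite [in X in _ * X * _]ss_PE mulr_sumr mulr_suml; apply: eq_bigr => j _.
by rewrite mulr_natr.
Qed.

Lemma y_le_P1 v j : y v j <= mev v (ss_P S 1).
Proof.
rewrite ss_PE (bigD1 j) //= expr1 lerDl sumr_ge0 // => i _.
by rewrite expr1 ss_y_ge0.
Qed.

Definition ss_Tapp D v m : R :=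
  laplace_approx D m (fun a => mev v (ss_P S a)) * expR (- (m%:R * mev v (ss_P S 1))).

Lemma ss_Tapp_cvg v m : ss_Tapp D v m @[D --> \oo] --> ss_T v m.
Proof.
rewrite (_ : (fun D => _) = (fun D => (\sum_j expser D (m%:R * (mev v (ss_P S 1) - y v j))) *
    expR (- (m%:R * mev v (ss_P S 1))))); last first.
  by apply/funext => D; rewrite /ss_Tapp laplace_approxE.
rewrite (_ : ss_T v m = (\sum_j expR (m%:R * (mev v (ss_P S 1) - y v j))) *
    expR (- (m%:R * mev v (ss_P S 1)))).
  by apply: cvgMl; apply: cvg_sumr => j; exact: expser_cvg.
by rewrite /ss_T mulr_suml; apply: eq_bigr => j _; rewrite -expRD; congr expR; ring.
Qed.

(** As 0 <= y_j <= P_1, all terms of the series are nonnegative and its sum is at most exp(m P_1),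
    which the tilt cancels. This uniform bound permits dominated convergence. *)
Lemma ss_Tapp_bound D v m : 0 <= ss_Tapp D v m <= L%:R.
Proof.
have h j : 0 <= m%:R * (mev v (ss_P S 1) - y v j) by rewrite mulr_ge0 // subr_ge0 y_le_P1.
rewrite /ss_Tapp laplace_approxE mulr_suml; apply/andP; split.
  by apply: sumr_ge0 => j _; rewrite mulr_ge0 ?expR_ge0 ?expser_ge0.
have -> : L%:R = \sum_(j < L) (1 : R) by rewrite sumr_const card_ord.
apply: ler_sum => j _.
rewrite expRN ler_pdivrMr ?expR_gt0 // mul1r (le_trans (expser_le _ (h j))) // ler_expR ler_wpM2l //.
by rewrite gerBl ss_y_ge0.
Qed.

Lemma measurable_ss_Tapp D m : measurable_fun setT (fun v : seqspace R => ss_Tapp D v m).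
Proof.
apply: measurable_funM; last exact: measurable_expw.
apply: (measurable_definable (definable_laplace_approx D m)) => a; exact: measurable_mev.
Qed.

Lemma measurable_ss_T m : measurable_fun setT (fun v : seqspace R => ss_T v m).
Proof.
apply: (measurable_fun_cvg (measurable_ss_Tapp ^~ m)) => v _; exact: ss_Tapp_cvg.
Qed.

Lemma ss_T_bound v m : 0 <= ss_T v m <= L%:R.
Proof.
apply/andP; split; first by apply: sumr_ge0 => j _; exact: expR_ge0.
have -> : L%:R = \sum_(j < L) (1 : R) by rewrite sumr_const card_ord.
apply: ler_sum => j _.
by rewrite -expR0 ler_expR oppr_le0 mulr_ge0 ?ss_y_ge0.
Qed.

Lemma ss_Tapp_E l : ss_E (fun v => \prod_(m <- l) ss_Tapp D v m) @[D --> \oo] -->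
  ss_E (fun v => \prod_(m <- l) ss_T v m).
Proof.
apply: (@ss_dominated _ _ (L%:R ^+ size l)).
- by move=> D; apply: measurable_prod => m _; exact: measurable_ss_Tapp.
- by move=> v; apply: cvg_prodr => m; exact: ss_Tapp_cvg.
- move=> D v; rewrite normr_prod; elim: l => [|m l IH]; first by rewrite big_nil.
  rewrite big_cons exprS; apply: ler_pM => //; first exact: prodr_ge0.
  by have /andP[h1 h2] := ss_Tapp_bound D v m; rewrite ger0_norm.
Qed.

End System.

Section Transfer.
Variables (R : realType) (L : nat) (S1 S2 : spectral_system R L).

(** The recursion only gives proportional moments. The series in [ss_series] is built from these
    moments and converges to 1 in both systems, so the tilted masses agree; a zero mass would make
    all its terms 0. *)
Lemma ss_I_transfer (s : R) l : 0 <= s -> ss_I S1 s l = ss_I S2 s l.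
Proof.
move=> s0.
have U := rec_unique s0 (fun l => ss_I_rec S1 l s0) (fun l => ss_I_rec S2 l s0)
  (fun l => ss_I0 S1 l s0) (fun l => ss_I0 S2 l s0).
have E : ss_I S2 s [::] = ss_I S1 s [::].
  rewrite -[LHS]mul1r -[RHS]mul1r.
  have c1 : (\sum_(i < n) s ^+ i / i`!%:R * ss_I S1 s (nseq i 1%N)) * ss_I S2 s [::]
      @[n --> \oo] --> 1 * ss_I S2 s [::] by apply: cvgMl; exact: ss_series.
  have c2 : (\sum_(i < n) s ^+ i / i`!%:R * ss_I S2 s (nseq i 1%N)) * ss_I S1 s [::]
      @[n --> \oo] --> 1 * ss_I S1 s [::] by apply: cvgMl; exact: ss_series.
  have E12 : (fun n => (\sum_(i < n) s ^+ i / i`!%:R * ss_I S1 s (nseq i 1%N)) * ss_I S2 s [::])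
      = (fun n => (\sum_(i < n) s ^+ i / i`!%:R * ss_I S2 s (nseq i 1%N)) * ss_I S1 s [::]).
    by apply/funext => n; rewrite !mulr_suml; apply: eq_bigr => i _; rewrite -[LHS]mulrA -[RHS]mulrA U.
  by rewrite E12 in c1; exact: (cvg_unique _ c1 c2).
have [z|z] := eqVneq (ss_I S1 s [::]) 0; last first.
  by apply: (mulIf z); rewrite -[in LHS]E U.
have Z := rec_zero s0 (fun l => ss_I_rec S1 l s0) (fun l => ss_I0 S1 l s0) z.
have c1 := ss_series S1 s0.
have E0 : (fun n => \sum_(i < n) s ^+ i / i`!%:R * ss_I S1 s (nseq i 1%N)) = (fun=> 0).
  by apply/funext => n; rewrite big1 // => i _; rewrite Z mulr0.
rewrite E0 in c1.
have e10 : 1 = 0 :> R by exact: (cvg_unique _ c1 (cvg_cst (0 : R))).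
by have /eqP := oner_neq0 R; rewrite e10.
Qed.

Lemma ss_prodT_transfer l : ss_E S1 (fun v => \prod_(m <- l) ss_T S1 v m) =
  ss_E S2 (fun v => \prod_(m <- l) ss_T S2 v m).
Proof.
have c1 := @ss_Tapp_E _ _ S1 l.
suff E12 : (fun D => ss_E S1 (fun v => \prod_(m <- l) ss_Tapp S1 D v m)) =
    (fun D => ss_E S2 (fun v => \prod_(m <- l) ss_Tapp S2 D v m)).
  by rewrite E12 in c1; exact: (cvg_unique _ c1 (@ss_Tapp_E _ _ S2 l)).
apply/funext => D.
have [F hF] : definable (fun g : nat -> R => \prod_(m <- l) laplace_approx D m g).
  by apply: definable_prod => m; exact: definable_laplace_approx.
(* Each factor brings its own tilt exp(- m P_1), so the product is a polynomial in the power sums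
   under the tilt s = [sumn l]. *)
have key (S : spectral_system R L) : ss_E S (fun v => \prod_(m <- l) ss_Tapp S D v m) =
    \sum_(u <- F) u.1 * ss_I S (sumn l)%:R u.2.
  rewrite -ss_E_definable //; congr ss_E; apply/funext => v.
  rewrite -hF /ss_Tapp big_split /=; congr (_ * _).
  elim: (l) => [|m l' IH]; first by rewrite big_nil mul0r oppr0 expR0.
  by rewrite big_cons IH /= natrD -expRD mulrDl opprD.
by rewrite !key; apply: eq_bigr => u _; rewrite ss_I_transfer.
Qed.

Lemma ss_T_transfer (e : (nat -> R) -> R) : definable e ->
  ss_E S1 (fun v => e (ss_T S1 v)) = ss_E S2 (fun v => e (ss_T S2 v)).
Proof.
move=> [F hF].
have key (S : spectral_system R L) : ss_E S (fun v => e (ss_T S v)) =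
    \sum_(u <- F) u.1 * ss_E S (fun v => \prod_(m <- u.2) ss_T S v m).
  rewrite -(@ss_E_lin _ _ S _ F (fun u => u.1) (fun u v => \prod_(m <- u.2) ss_T S v m)
    (fun u => L%:R ^+ size u.2)).
  - by congr ss_E; apply/funext => v; rewrite hF.
  - by move=> u; apply: measurable_prod => m _; exact: measurable_ss_T.
  - move=> u v; rewrite normr_prod; elim: (u.2) => [|m l IH]; first by rewrite big_nil.
    rewrite big_cons exprS; apply: ler_pM => //; first exact: prodr_ge0.
  by have /andP[h1 h2] := ss_T_bound S v m; rewrite ger0_norm.
by rewrite !key; apply: eq_bigr => u _; rewrite ss_prodT_transfer.
Qed.

End Transfer.

Section BernsteinCount.
Variable R : realType.

(** [bstep] in the monomial basis with x^m replaced by the variable [g m]. *)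
Definition bstep_form (x0 : R) (K : nat) (g : nat -> R) : R :=
  \sum_(q < (K.+1 ^ 3).+1) ((K.+1%:R ^+ 3 * x0 - K.+1%:R ^+ 2 <= q%:R)%R%:R * 'C(K.+1 ^ 3, q)%:R) *
    \sum_(i < (K.+1 ^ 3 - q).+1) ((-1) ^+ i * 'C(K.+1 ^ 3 - q, i)%:R) * g (q + i)%N.

Lemma definable_bstep_form x0 K : definable (bstep_form x0 K).
Proof.
apply: definable_sum => q; apply: definableM; first exact: definable_cst.
apply: definable_sum => i; apply: definableM; first exact: definable_cst.
exact: definable_var.
Qed.

Lemma bstep_formE x0 K (J : finType) (x : J -> R) :
  bstep_form x0 K (fun m => \sum_j x j ^+ m) = \sum_j bstep x0 K (x j).
Proof.
rewrite /bstep; under [RHS]eq_bigr do rewrite big_mkcond.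
rewrite exchange_big /=; apply: eq_bigr => q _.
case: (K.+1%:R ^+ 3 * x0 - K.+1%:R ^+ 2 <= q%:R); last by rewrite !mul0r big1.
rewrite mul1r; under [RHS]eq_bigr do rewrite /binl -mulrA.
rewrite -mulr_sumr; congr (_ * _).
under eq_bigr do rewrite mulr_sumr.
rewrite exchange_big /=; apply: eq_bigr => j _.
rewrite exprBn mulr_sumr; apply: eq_bigr => i _.
by rewrite expr1n mulr1 exprD -[in RHS]mulr_natr; ring.
Qed.

Variables (L : nat) (S : spectral_system R L).

Definition ss_X (c : R) (v : nat -> R) : R := \sum_j (ss_y S v j <= c)%R%:R.

Lemma exp_y01 v j : 0 <= expR (- ss_y S v j) <= 1.
Proof. by rewrite expR_ge0 -expR0 ler_expR oppr_le0 ss_y_ge0. Qed.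

Lemma bstep_form_T x0 K v : bstep_form x0 K (ss_T S v) = \sum_j bstep x0 K (expR (- ss_y S v j)).
Proof.
rewrite -bstep_formE; congr bstep_form; apply/funext => m; apply: eq_bigr => j _.
by rewrite -mulrN expRM_natl.
Qed.

(** The map y |-> exp(- y) reverses the order, so y_j <= c becomes exp(- c) <= exp(- y_j): the
    closed step at exp(- c) counts exactly the y_j in [0, c]. *)
Lemma bstep_form_cvg c v : bstep_form (expR (- c)) K (ss_T S v) @[K --> \oo] --> ss_X c v.
Proof.
rewrite (_ : (fun _ => _) = (fun K => \sum_j bstep (expR (- c)) K (expR (- ss_y S v j)))); last first.
  by apply/funext => K; exact: bstep_form_T.
apply: cvg_sumr => j; have := @bstep_cvg _ (expR (- c)) _ (exp_y01 v j).
by rewrite ler_expR lerN2.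
Qed.

(** The count is a limit of polynomials in the sums [ss_T], and these are limits of functions of the
    power sums. So it is measurable however the individual y_j were selected. *)
Lemma measurable_ss_X c : measurable_fun setT (ss_X c : seqspace R -> R).
Proof.
apply: (@measurable_fun_cvg _ _ _ _ (fun K (v : seqspace R) => bstep_form (expR (- c)) K (ss_T S v))).
  move=> K; apply: (measurable_definable (definable_bstep_form _ K)) => m.
  exact: measurable_ss_T.
by move=> v _; exact: bstep_form_cvg.
Qed.

(* The polynomial 1_{X = 0} on {0, ..., L}. *)
Definition zero_test (x : R) : R := \prod_(i < L) (1 - i.+1%:R^-1 * x).

Lemma zero_testX c v : zero_test (ss_X c v) = [forall j, c < ss_y S v j]%R%:R.
Proof.
have -> : ss_X c v = #|[set j | ss_y S v j <= c]%SET|%:R.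
  by rewrite /ss_X -sum1_card natr_sum [RHS]big_mkcond /=; apply: eq_bigr => j _; rewrite inE; case: ifP.
have [h|/forallPn[j]] := boolP [forall j, c < ss_y S v j].
  rewrite (_ : #|_| = 0)%N; last first.
    by apply/eqP; rewrite cards_eq0; apply/eqP/finset.setP => j; rewrite !inE leNgt (forallP h j).
  by rewrite /zero_test big1 // => i _; rewrite mulr0 subr0.
rewrite -leNgt => hj; set n := #|_|.
have n0 : (0 < n)%N by rewrite card_gt0; apply/set0Pn; exists j; rewrite inE.
have nL : (n.-1 < L)%N by rewrite prednK // -[X in (_ <= X)%N]card_ord max_card.
rewrite /zero_test (bigD1 (Ordinal nL)) //= prednK // mulVf ?subrr ?mul0r //.
by rewrite pnatr_eq0 -lt0n.
Qed.

Definition gap_form (c : R) (K : nat) (g : nat -> R) : R := zero_test (bstep_form (expR (- c)) K g).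

Lemma definable_gap_form c K : definable (gap_form c K).
Proof.
apply: definable_prod => i; apply: definableD; first exact: definable_cst.
rewrite (_ : (fun _ => _) = (fun g => (- i.+1%:R^-1) * bstep_form (expR (- c)) K g)).
  by apply: definableM; [exact: definable_cst|exact: definable_bstep_form].
by apply/funext => g; rewrite mulNr.
Qed.

Lemma gap_form_cvg c : ss_E S (fun v => gap_form c K (ss_T S v)) @[K --> \oo] -->
  ss_E S (fun v => [forall j, c < ss_y S v j]%R%:R).
Proof.
apply: (@ss_dominated _ _ _ _ _ ((1 + L%:R) ^+ L)).
- move=> K; apply: (measurable_definable (definable_gap_form c K)) => m.
  exact: measurable_ss_T.
- move=> v; rewrite -zero_testX; apply: cvg_prodr => i.
  apply: cvgB; first exact: cvg_cst.
  by apply: cvgMr; exact: bstep_form_cvg.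
- move=> K v; rewrite /gap_form /zero_test normr_prod.
  rewrite -[X in _ ^+ X](card_ord L) -prodr_const; apply: ler_prod => i _; rewrite normr_ge0 /=.
  have h : 0 <= bstep_form (expR (- c)) K (ss_T S v) <= L%:R.
    rewrite bstep_form_T; apply/andP; split.
      by apply: sumr_ge0 => j _; have /andP[] := bstep_bound (expR (- c)) K (exp_y01 v j).
    have -> : L%:R = \sum_(j < L) (1 : R) by rewrite sumr_const card_ord.
    by apply: ler_sum => j _; have /andP[] := bstep_bound (expR (- c)) K (exp_y01 v j).
  move/andP: h => [h0 h1].
  rewrite (le_trans (ler_normB _ _)) // normr1 lerD2l normrM [X in _ * X]ger0_norm //.
  rewrite ger0_norm ?invr_ge0 // ler_pdivrMl // (le_trans h1) //.
  by rewrite ler_peMl // ler1n.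
Qed.

End BernsteinCount.

Lemma ss_gap_transfer (R : realType) L (S1 S2 : spectral_system R L) (c : R) :
  ss_E S1 (fun v => [forall j, c < ss_y S1 v j]%R%:R) =
  ss_E S2 (fun v => [forall j, c < ss_y S2 v j]%R%:R).
Proof.
have c1 := @gap_form_cvg _ _ S1 c.
have E12 : (fun K => ss_E S1 (fun v => gap_form L c K (ss_T S1 v))) =
    (fun K => ss_E S2 (fun v => gap_form L c K (ss_T S2 v))).
  by apply/funext => K; apply: ss_T_transfer; exact: definable_gap_form.
by rewrite E12 in c1; exact: (cvg_unique _ c1 (@gap_form_cvg _ _ S2 c)).
Qed.

(** * Hankel determinants of truncated Gaussian moments *)

Lemma Rintegral_lin d (T : measurableType d) (R : realType) (mu : {measure set T -> \bar R})
  (I : Type) (r : seq I) (a : I -> R) (F : I -> T -> R) :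
  (forall i, mu.-integrable setT (fun x => (F i x)%:E)) ->
  mu.-integrable setT (fun x => (\sum_(i <- r) a i * F i x)%:E) /\
  (\int[mu]_x (\sum_(i <- r) a i * F i x))%R = \sum_(i <- r) a i * (\int[mu]_x (F i x))%R.
Proof.
move=> iF; elim: r => [|i r [IH1 IH2]].
  under eq_fun do rewrite big_nil; split; first exact: integrable0.
  rewrite big_nil; transitivity (\int[mu]_x (0 : R))%R.
    by apply: eq_Rintegral => v _; rewrite big_nil.
  by rewrite /Rintegral integral0.
have iaF : mu.-integrable setT (fun x => (a i * F i x)%:E).
  apply: (eq_integrable measurableT (fun v => (a i)%:E * (F i v)%:E)%E).
    by move=> v _; rewrite -EFinM.
  exact: integrableZl.
split.
  apply: (eq_integrable measurableT (fun x => (a i * F i x)%:E + (\sum_(j <- r) a j * F j x)%:E)%E).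
    by move=> v _; rewrite big_cons EFinD.
  exact: integrableD.
rewrite big_cons -IH2 -RintegralZl //; last exact: iF.
transitivity (\int[mu]_x (a i * F i x + \sum_(j <- r) a j * F j x))%R.
  by apply: eq_Rintegral => v _; rewrite big_cons.
exact: RintegralD.
Qed.

Lemma finite_roots (R : realType) (p : {poly R}) : p != 0 -> finite_set [set x | root p x].
Proof.
move=> p0; apply: contrapT => /(infinite_set_fset (size p))[B sB cB].
have : (size B < size p)%N.
  apply: max_poly_roots => //; last exact: fset_uniq.
  by apply/allP => x xB; exact: sB.
by rewrite ltnNge cB.
Qed.

Section Hankel.
Variable R : realType.
Notation Nrm := (@normal_prob R 0 1).
Implicit Types (x g : R).

Definition htail_fun x (j : nat) g : R := (x < `|g|)%R%:R * (g ^+ 2 / 2) ^+ j.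

Definition htail x (j : nat) : R := (\int[Nrm]_g (htail_fun x j g))%R.

Lemma htail_fun_ge0 x j g : 0 <= htail_fun x j g.
Proof. by rewrite mulr_ge0 // exprn_ge0 // divr_ge0 // sqr_ge0. Qed.

Lemma measurable_htail_fun x j : measurable_fun setT (htail_fun x j).
Proof.
apply: measurable_funM.
  rewrite (_ : (fun g => _) = \1_[set g : R | x < `|g|]); last first.
    by apply/funext => g; rewrite indicE mem_setE.
  apply: measurable_indic.
  rewrite (_ : [set g | _] = (fun g : R => `|g|) @^-1` `]x, +oo[%classic); last first.
    by apply/seteqP; split => g /=; rewrite in_itv /= andbT.
  by rewrite -[X in measurable X]setTI; apply: (@normr_measurable R setT measurableT).
apply: measurable_funX; apply: measurable_funM => //.
Qed.

Lemma integrable_htail_fun x j : Nrm.-integrable setT (fun g => (htail_fun x j g)%:E).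
Proof.
have e8 : 8^-1 < 2^-1 :> R by lra.
have [C C0 hC] := @poly_le_exp R j 8^-1 ltac:(lra).
have iC : Nrm.-integrable setT (fun g => (C * expR (8^-1 * g ^+ 2))%:E).
  have := @integrableZl _ _ _ Nrm setT measurableT C _ (integrable_normal_exp e8).
  by apply: eq_integrable.
apply: (le_integrable measurableT _ _ iC).
  by apply/measurable_EFinP; exact: measurable_htail_fun.
move=> g _; rewrite !abse_EFin lee_fin ger0_norm ?htail_fun_ge0 //.
rewrite ger0_norm ?mulr_ge0 ?expR_ge0 // (le_trans _ (hC g)) //.
have s0 := sqr_ge0 g.
apply: (@le_trans _ _ ((g ^+ 2 / 2) ^+ j)).
  rewrite /htail_fun -[leRHS]mul1r ler_wpM2r //; first by rewrite exprn_ge0 // divr_ge0.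
  by case: (_ < _).
rewrite lerXn2r ?nnegrE; lra.
Qed.

Definition hmat (k : nat) x : 'M[R]_k := \matrix_(i, j) htail x (i + j).

Lemma normal_finite_negligible (A : set R) : finite_set A -> Nrm.-negligible A.
Proof.
move=> /finite_set_countable fA.
have mA : measurable A by apply: countable_measurable fA => t; exact: measurable_set1.
exists A; split=> //.
have /null_content_dominatesP := @normal_prob_dominates R 0 1.
by apply => //; exact: countable_lebesgue_measure0.
Qed.

(** At -1 the condition on |g| is void and at 0 it removes a null set; this links the untruncated
    moments to [hmat k 0]. *)
Lemma htail0 j : htail 0 j = htail (-1) j.
Proof.
rewrite /htail /Rintegral; congr fine; apply: ae_eq_integral => //.
- by apply/measurable_EFinP; exact: measurable_htail_fun.
- by apply/measurable_EFinP; exact: measurable_htail_fun.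
apply: (negligibleS _ (normal_finite_negligible (finite_set1 (0 : R)))) => g /=.
apply: contra_notP => /eqP g0 _; rewrite /htail_fun normr_gt0 g0.
by rewrite (lt_le_trans (ltrN10 R)).
Qed.

Lemma hmat0 k : hmat k 0 = hmat k (-1).
Proof. by apply/matrixP => i j; rewrite !mxE htail0. Qed.

(* The Hankel form of w is the integral of the square of the polynomial with coefficients w. *)
Lemma det_hmat0 k : \det (hmat k 0) != 0.
Proof.
apply/negP => /det0P[w w0 wH].
pose q : {poly R} := \poly_(i < k) (if insub i is Some i' then w 0 i' else 0).
have qE u : q.[u] = \sum_(i < k) w 0 i * u ^+ i.
  by rewrite horner_poly; apply: eq_bigr => i _; rewrite valK.
have q0 : q != 0.
  apply: contraNneq w0 => q0; apply/eqP/rowP => i; rewrite mxE.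
  by have := congr1 (fun p : {poly R} => p`_i) q0; rewrite coef_poly ltn_ord valK coef0.
pose f (g : R) := (0 < `|g|)%R%:R * q.[g ^+ 2 / 2] ^+ 2.
have fE g : f g = \sum_(u : 'I_k * 'I_k) (w 0 u.1 * w 0 u.2) * htail_fun 0 (u.1 + u.2) g.
  rewrite /f qE expr2 mulr_suml mulr_sumr -(pair_bigA _ (fun i j =>
    (w 0 i * w 0 j) * htail_fun 0 (i + j) g)) /=.
  apply: eq_bigr => i _; rewrite !mulr_sumr; apply: eq_bigr => j _.
  by rewrite /htail_fun exprD; ring.
have [if1 If] := @Rintegral_lin _ _ R Nrm _ (index_enum _) (fun u : 'I_k * 'I_k => w 0 u.1 * w 0 u.2)
  (fun u => htail_fun 0 (u.1 + u.2)) (fun u => integrable_htail_fun 0 (u.1 + u.2)).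
have mf : measurable_fun setT f.
  rewrite (_ : f = fun g => \sum_(u : 'I_k * 'I_k) (w 0 u.1 * w 0 u.2) * htail_fun 0 (u.1 + u.2) g).
    by apply: measurable_sum => u; apply: measurable_funM => //; exact: measurable_htail_fun.
  by apply/funext => g; exact: fE.
have f0 g : 0 <= f g by rewrite mulr_ge0 ?sqr_ge0.
have If0 : (\int[Nrm]_g (f g)%:E = 0)%E.
  have -> : (\int[Nrm]_g (f g)%:E = \int[Nrm]_g
      (\sum_(u : 'I_k * 'I_k) (w 0 u.1 * w 0 u.2) * htail_fun 0 (u.1 + u.2) g)%:E)%E.
    by apply: eq_integral => g _; rewrite fE.
  rewrite -[LHS]fineK; last exact: integrable_fin_num.
  congr EFin; rewrite [LHS]If.
  rewrite -(pair_bigA _ (fun i j : 'I_k => (w 0 i * w 0 j) * htail 0 (i + j))) /=.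
  rewrite exchange_big big1 // => j _.
  have := congr1 (fun m : 'rV_k => m 0 j) wH; rewrite !mxE => h.
  transitivity (w 0 j * \sum_i w 0 i * hmat k 0 i j); last by rewrite h mulr0.
  by rewrite mulr_sumr; apply: eq_bigr => i _; rewrite !mxE; ring.
have mf' : measurable_fun setT (fun g => (f g)%:E) by apply/measurable_EFinP; exact: mf.
have ae0 : ae_eq Nrm setT (fun g => (f g)%:E) (cst 0%E).
  apply/(ae_eq_integral_abs Nrm measurableT mf').
  by rewrite -[RHS]If0; apply: eq_integral => g _; rewrite abse_EFin ger0_norm.
(* Where [f] vanishes, either g = 0 or g^2 / 2 is a root of [q]; in both cases g is a root of [p],
   so the zeros of [f] form a null set. *)
pose p : {poly R} := 'X * (q \Po (2^-1 *: 'X^2)).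
have sX : size (2^-1 *: 'X^2 : {poly R}) = 3%N by rewrite size_scale ?size_polyXn // invr_eq0.
have p0 : p != 0 by rewrite mulf_neq0 ?polyX_eq0 // comp_poly_eq0 ?sX.
have nF := normal_finite_negligible (finite_roots p0).
have nT := negligibleU ae0 nF.
have : Nrm setT = 0%E.
  apply: measure_negligible => //; apply: (negligibleS _ nT) => g _ /=.
  have [r|r] := boolP (root p g); [by right|left => h].
  have {}h : f g = 0 by have /eqP := h I; rewrite eqe => /eqP.
  move: r; rewrite /root /p hornerM hornerX horner_comp hornerZ hornerXn mulf_eq0 => /norP[g0 qg].
  move: h; rewrite /f normr_gt0 g0 mul1r [g ^+ 2 / 2]mulrC => /eqP.
  by rewrite expf_eq0 /= (negPf qg).
by rewrite probability_setT => /eqP; rewrite onee_eq0.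
Qed.

Lemma integral_htail_prod k x (e : nat -> nat) :
  (gam R k).-integrable setT (fun v => (\prod_(i < k) htail_fun x (e i) (v i))%:E) /\
  (\int[gam R k]_v (\prod_(i < k) htail_fun x (e i) (v i)))%R = \prod_(i < k) htail x (e i).
Proof.
have mF i : measurable_fun setT (htail_fun x (e i)) by exact: measurable_htail_fun.
have F0 i y : 0 <= htail_fun x (e i) y by exact: htail_fun_ge0.
have E := integral_gam_prod k mF F0.
have Ef : (\prod_(i < k) \int[Nrm]_y (htail_fun x (e i) y)%:E = (\prod_(i < k) htail x (e i))%:E)%E.
  rewrite (big_morph EFin EFinM (erefl 1%:E)); apply: eq_bigr => i _.
  by rewrite /htail /Rintegral fineK //; apply: integrable_fin_num => //; exact: integrable_htail_fun.
split; last by rewrite /Rintegral E Ef.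
apply/integrableP; split.
  apply/measurable_EFinP; apply: measurable_prod => i _.
  exact: (measurableT_comp (mF i) (@measurable_coord R i)).
have -> : (\int[gam R k]_v `|(\prod_(i < k) htail_fun x (e i) (v i))%:E| =
    \int[gam R k]_v (\prod_(i < k) htail_fun x (e i) (v i))%:E)%E.
  by apply: eq_integral => v _; rewrite abse_EFin ger0_norm // prodr_ge0.
by rewrite E Ef ltry.
Qed.

Lemma vdmB_sqr k (v : nat -> R) : mev v (@vdmB R k) ^+ 2 =
  \sum_(u : 'S_k * 'S_k) ((-1) ^+ u.1 * (-1) ^+ u.2) * \prod_(i < k) (v i ^+ 2 / 2) ^+ (u.1 i + u.2 i).
Proof.
pose a : 'rV[R]_k := \row_i (v i ^+ 2 / 2).
have -> : mev v (@vdmB R k) ^+ 2 = \det (Vandermonde k a)^T ^+ 2.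
  rewrite det_tr det_Vandermonde mev_vdmB pair_big_dep /= -!prodrXl; apply: eq_bigr => u _.
  by rewrite !mxE -sqrrN opprB.
rewrite expr2 /determinant mulr_suml.
rewrite -(pair_bigA _ (fun s t : 'S_k => ((-1) ^+ s * (-1) ^+ t) *
  \prod_(i < k) (v i ^+ 2 / 2) ^+ (s i + t i))) /=.
apply: eq_bigr => s _; rewrite mulr_sumr; apply: eq_bigr => t _.
rewrite mulrACA -big_split /=; congr (_ * _); apply: eq_bigr => i _.
by rewrite !mxE exprD.
Qed.

(* Andreief's identity. *)
Lemma integral_vdmB k x :
  (\int[gam R k]_v ([forall i : 'I_k, x < `|v i|]%R%:R * mev v (@vdmB R k) ^+ 2))%R =
  k`!%:R * \det (hmat k x).
Proof.
pose ex (u : 'S_k * 'S_k) (n : nat) := (if insub n is Some i then u.1 i + u.2 i else 0)%N.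
pose F (u : 'S_k * 'S_k) (v : seqspace R) := \prod_(i < k) htail_fun x (ex u i) (v i).
have [_ E] := @Rintegral_lin _ _ R (gam R k) _ (index_enum _)
  (fun u : 'S_k * 'S_k => (-1) ^+ u.1 * (-1) ^+ u.2) F (fun u => (integral_htail_prod k x (ex u)).1).
transitivity (\int[gam R k]_v (\sum_(u : 'S_k * 'S_k) ((-1) ^+ u.1 * (-1) ^+ u.2) * F u v))%R.
  apply: eq_Rintegral => v _; rewrite vdmB_sqr mulr_sumr; apply: eq_bigr => u _.
  rewrite mulrCA; congr (_ * _); rewrite /F big_split /=; congr (_ * _); last first.
    by apply: eq_bigr => i _; rewrite /ex valK.
  have [/forallP h|/forallPn[j hj]] := boolP [forall i : 'I_k, x < `|v i|].
    by rewrite big1 // => i _; rewrite h.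
  by rewrite (bigD1 j) //= (negPf hj) mul0r.
rewrite E.
have -> : \sum_(u : 'S_k * 'S_k) (-1) ^+ u.1 * (-1) ^+ u.2 * (\int[gam R k]_v (F u v))%R =
    \sum_(s : 'S_k) \sum_(t : 'S_k) (-1) ^+ s * (-1) ^+ t * \prod_(i < k) htail x (s i + t i).
  rewrite pair_bigA /=; apply: eq_bigr => u _; rewrite (integral_htail_prod k x (ex u)).2.
  by congr (_ * _); apply: eq_bigr => i _; rewrite /ex valK.
rewrite -card_Sn -sum1_card natr_sum mulr_suml.
rewrite [RHS](eq_bigl xpredT); last by move=> s; rewrite inE.
apply: eq_bigr => s _; rewrite mul1r.
transitivity ((-1) ^+ s * \det (row_perm s (hmat k x))).
  rewrite /determinant mulr_sumr; apply: eq_bigr => t _; rewrite -mulrA; congr (_ * (_ * _)).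
  by apply: eq_bigr => i _; rewrite !mxE.
by rewrite row_permE det_mulmx det_perm mulrA -expr2 sqrr_sign mul1r.
Qed.

End Hankel.

(** * The two models *)

Lemma measurable_gap (R : realType) L (S : spectral_system R L) (c : R) :
  measurable_fun setT (fun v : seqspace R => [forall j, c < ss_y S v j]%R%:R : R).
Proof.
rewrite (_ : (fun _ => _) = (fun v => zero_test L (ss_X S c v))); last first.
  by apply/funext => v; rewrite zero_testX.
apply: measurable_prod => i _; apply: measurable_funB => //.
by apply: measurable_funM => //; exact: measurable_ss_X.
Qed.

Section HalfIndex.
Variables (R : realType) (k : nat).

Lemma half_subproof (j : 'I_(2 * k)) : (j./2 < k)%N.
Proof. by rewrite ltn_half_double -mul2n. Qed.

(** Lists each of the k values twice, as in a spectrum symmetric about 0. *)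
Definition half_ord j : 'I_k := Ordinal (half_subproof j).

Lemma sum_half_ord (F : nat -> R) : \sum_(j < 2 * k) F (half_ord j) = 2 * \sum_(i < k) F i.
Proof.
transitivity (\sum_(0 <= j < 2 * k) F j./2); first by rewrite big_mkord.
rewrite -(big_mkord xpredT F); elim: (k) => [|m IH]; first by rewrite muln0 !big_geq ?mulr0.
rewrite mulnS addnC !addnS addn0 !big_nat_recr //= IH.
have -> : uphalf (2 * m) = m by lia.
have -> : (2 * m)./2 = m by lia.
by rewrite mulrDr; ring.
Qed.

Definition ys2 (v : nat -> R) (j : 'I_(2 * k)) : R := v (half_ord j) ^+ 2 / 2.

Lemma forall_ys2 (x : R) v : 0 <= x ->
  [forall j, x ^+ 2 / 2 < ys2 v j] = [forall i : 'I_k, x < `|v i|].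
Proof.
move=> x0.
have E g : (x ^+ 2 / 2 < g ^+ 2 / 2) = (x < `|g|).
  by rewrite ltr_pM2r ?invr_gt0 // -[g ^+ 2]real_normK ?num_real // ltr_pXn2r ?nnegrE.
apply/forallP/forallP => h i; last by rewrite E h.
have hi : (i.*2 < 2 * k)%N by rewrite mul2n ltn_double.
by have := h (Ordinal hi); rewrite E /= doubleK.
Qed.

Lemma vdmB_mass : Iexp (@PB R k 1) 0 (@vdmB R k ^+ 2) = k`!%:R * \det (@hmat R k 0).
Proof.
rewrite hmat0 -integral_vdmB; apply: eq_Rintegral => v _.
rewrite /expw mul0r oppr0 expR0 mulr1 mev_exp (_ : [forall i, _]) ?mul1r //.
by apply/forallP => i; rewrite (lt_le_trans (ltrN10 R)).
Qed.

Definition gauss_vandermonde : spectral_system R (2 * k).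
Proof.
apply: (@SpectralSystem R (2 * k) k (@PB R k) (@vdmB R k) (k`!%:R * \det (@hmat R k 0))^-1 ys2).
- exact: GamPB.
- exact: LapPB.
- exact: EulPB.
- by move=> v j; rewrite divr_ge0 // sqr_ge0.
- by move=> v a; rewrite mev_PB (sum_half_ord (fun i => (v i ^+ 2 / 2) ^+ a)).
- rewrite /PB /psum; under eq_bigr do rewrite expr0.
  by rewrite sumr_const card_ord scaler_nat -mulrnA mulnC.
- rewrite invr_ge0 -vdmB_mass; apply: Rintegral_ge0 => // v _.
  by rewrite mulr_ge0 ?expw_ge0 // mev_exp sqr_ge0.
- by rewrite vdmB_mass mulVf // mulf_neq0 ?det_hmat0 // pnatr_eq0 -lt0n fact_gt0.
Defined.

Lemma gap_vandermonde (x : R) : 0 <= x ->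
  ss_E gauss_vandermonde (fun v => [forall j, x ^+ 2 / 2 < ss_y gauss_vandermonde v j]%R%:R) =
  \det (@hmat R k x) / \det (@hmat R k 0).
Proof.
move=> x0; pose Z := k`!%:R * \det (@hmat R k 0).
have k0 : k`!%:R != 0 :> R by rewrite pnatr_eq0 -lt0n fact_gt0.
have Z0 : Z != 0 by rewrite mulf_neq0 ?det_hmat0.
apply: (mulfI Z0); transitivity (k`!%:R * \det (@hmat R k x)); last first.
  by rewrite /Z; field; rewrite det_hmat0.
rewrite -integral_vdmB -RintegralZl //; last first.
  apply: (@ss_integrable _ _ gauss_vandermonde _ 1); first exact: measurable_gap.
  by move=> v; rewrite ger0_norm //; case: [forall j, _].
apply: eq_Rintegral => v _; rewrite /= forall_ys2 // /ss_w /= mev_exp -/Z.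
by field.
Qed.

End HalfIndex.

(** * Eigenvalues of aGUE matrices *)

Section Spectrum.
Variable R : realType.
Local Open Scope complex_scope.

Lemma aGUEE l (Y : 'M[R]_l) : aGUE Y = ('i / 2) *: map_mx (real_complex R) (Y - Y^T).
Proof. by apply/matrixP => i j; rewrite !mxE rmorphB. Qed.

Lemma aGUE_conj l (Y : 'M[R]_l) : map_mx conjc (aGUE Y) = - aGUE Y.
Proof.
apply/matrixP => i j; rewrite !mxE -rmorphB -mulNr.
transitivity (conjc ('i / 2) * conjc ((Y i j - Y j i)%:C)); first exact: rmorphM.
rewrite conjc_real; congr (_ * _).
transitivity (conjc 'i * conjc (2^-1) : R[i]); first exact: rmorphM.
rewrite conjc_inv conjc_nat -mulNr; congr (_ * _).
by apply/eqP; rewrite eq_complex /= oppr0 !eqxx.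
Qed.

Lemma aGUE_tr l (Y : 'M[R]_l) : (aGUE Y)^T = - aGUE Y.
Proof. by apply/matrixP => i j; rewrite !mxE; ring. Qed.

Lemma aGUE_herm l (Y : 'M[R]_l) : aGUE Y \is hermsymmx.
Proof.
apply/is_hermitianmxP; rewrite expr0 scale1r aGUE_tr map_mxN.
by rewrite -[LHS]opprK -aGUE_conj.
Qed.

Lemma aGUE_spectrum l (Y : 'M[R]_l) : exists lam : 'I_l -> R,
  (forall mu : R, eigenvalue (aGUE Y) mu%:C <-> exists j, lam j = mu) /\
  (forall a, \tr (mpow (aGUE Y) a) = (\sum_j lam j ^+ a)%:C).
Proof.
set A := aGUE Y; have hA := aGUE_herm Y.
have AE := orthomx_spectralP (hermitian_normalmx hA).
have rd := hermitian_spectral_diag_real hA.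
move: AE rd (spectral_unit A); rewrite -/A; set P := spectralmx A; set d := spectral_diag A.
move=> AE rd uP.
have dE j : (complex.Re (d 0 j))%:C = d 0 j by apply: RRe_real; exact: (mxOverP rd).
exists (fun j => complex.Re (d 0 j)); split=> [mu|a].
  split=> [/eigenvalueP[v vA v0]|[j <-]].
    pose w := v *m invmx P.
    have wD : w *m diag_mx d = mu%:C *: w.
      by rewrite /w scalemxAl -vA [in RHS]AE !mulmxA mulmxK.
    have w0 : w != 0.
      by apply: contraNneq v0 => w0; rewrite -[v](mulmxKV uP) -/w w0 mul0mx.
    have [j wj] : exists j, w 0 j != 0.
      by move: w0 => /rV0Pn.
    exists j; apply: complexI; rewrite dE; apply: (mulfI wj).
    by have := congr1 (fun B : 'rV_l => B 0 j) wD; rewrite mul_mx_diag !mxE [RHS]mulrC.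
  apply/eigenvalueP; exists (row j P).
    rewrite dE [in LHS]AE !mulmxA -row_mul mulmxV // -[row j 1%:M *m _]row_mul mul1mx.
    by rewrite row_diag_mx -scalemxAl -matrix.rowE.
  apply: contraTneq uP => P0; rewrite unitmxE unitfE (expand_det_row P j) big1 ?eqxx // => i _.
  by have := congr1 (fun B : 'rV_l => B 0 i) P0; rewrite !mxE => ->; rewrite mul0r.
have powE : mpow A a = invmx P *m mpow (diag_mx d) a *m P.
  elim: a => [|a IH]; first by rewrite /= mulmx1 mulVmx.
  by rewrite !mpowS IH [in LHS]AE !mulmxA mulmxK //.
have diagE : mpow (diag_mx d) a = diag_mx (\row_j d 0 j ^+ a).
  elim: (a) => [|a' IH]; first by apply/matrixP => i j; rewrite !mxE expr0.
  rewrite mpowS IH mulmx_diag; congr diag_mx; apply/rowP => j.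
  by rewrite !mxE exprS.
rewrite powE mxtrace_mulC mulmxA mulmxV // mul1mx diagE mxtrace_diag rmorph_sum.
by apply: eq_bigr => j _; rewrite !mxE rmorphXn /= -[in LHS]dE.
Qed.

(** The entries are purely imaginary, so the conjugate of an eigenvector belongs to the opposite
    eigenvalue. *)
Lemma aGUE_spectrum_sym l (Y : 'M[R]_l) (mu : R) :
  eigenvalue (aGUE Y) mu%:C -> eigenvalue (aGUE Y) (- mu)%:C.
Proof.
move=> /eigenvalueP[v vA v0]; apply/eigenvalueP; exists (map_mx conjc v); last first.
  by rewrite map_mx_eq0.
have := congr1 (map_mx (@conjc R)) vA; rewrite map_mxM aGUE_conj mulmxN map_mxZ.
rewrite (_ : _ mu%:C = mu%:C); last exact: conjc_real.
by move=> /eqP; rewrite eqr_oppLR -scaleNr => /eqP ->; rewrite rmorphN.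
Qed.

End Spectrum.

Section GaussMatrix.
Variables (R : realType) (L : nat).
Local Open Scope complex_scope.

(** A list chosen separately for each v, with no regularity in v; the integrals only see symmetric
    functions of it. *)
Definition eigs (v : nat -> R) : 'I_L -> R := projT1 (cid (aGUE_spectrum (mx_of_vec L v))).

Lemma eigsP v (mu : R) : eigenvalue (aGUE (mx_of_vec L v)) mu%:C <-> exists j, eigs v j = mu.
Proof. exact: (projT2 (cid (aGUE_spectrum (mx_of_vec L v)))).1. Qed.

Lemma eigs_trace v a : \tr (mpow (aGUE (mx_of_vec L v)) a) = (\sum_j eigs v j ^+ a)%:C.
Proof. exact: (projT2 (cid (aGUE_spectrum (mx_of_vec L v)))).2. Qed.

Lemma eigs_sym v j : exists j', eigs v j' = - eigs v j.
Proof. by apply/eigsP/aGUE_spectrum_sym/eigsP; exists j. Qed.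

Definition ys1 v j : R := eigs v j ^+ 2.

Lemma mev_PA v a : mev v (@PA R L a) = \sum_j ys1 v j ^+ a.
Proof.
apply: complexI; under eq_bigr do rewrite /ys1 -exprM; rewrite -eigs_trace.
have ci : ('i / 2 : R[i]) ^+ (2 * a) = ((- 4^-1 : R) ^+ a)%:C.
  rewrite exprM [RHS]rmorphXn; congr (_ ^+ a).
  rewrite expr2 mulrACA -expr2 sqr_i mulN1r rmorphN fmorphV rmorph_nat; congr (- _).
  by rewrite -invfM -natrM.
rewrite /PA mevZ aGUEE mpowZ mxtraceZ ci rmorphM; congr (_ * _).
rewrite -map_mpow trace_map_mx; congr (_%:C).
rewrite /mev -trace_map_mx map_mpow; congr (\tr (mpow _ _)).
apply/matrixP => i j; rewrite !mxE rmorphB /=; congr (_ - _); exact: mevX.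
Qed.

Definition gauss_matrix : spectral_system R L.
Proof.
apply: (@SpectralSystem R L (L * L) (@PA R L) 1 1 ys1).
- exact: GamPA.
- exact: LapPA.
- exact: EulPA.
- by move=> v j; rewrite sqr_ge0.
- exact: mev_PA.
- by rewrite /PA muln0 expr0 scale1r mxtrace1.
- by [].
- rewrite mul1r /Iexp expr1n; transitivity (\int[gam R (L * L)]_v (1 : R))%R.
    by apply: eq_Rintegral => v _; rewrite /expw mul0r oppr0 expR0 mulr1 mev1.
  by rewrite /Rintegral integral_cst //= mul1e probability_setT.
Defined.

Lemma ss_E_gauss_matrix (A : set (seqspace R)) : measurable A ->
  (gam R (L * L)) A = (ss_E gauss_matrix (fun v => \1_A v))%:E.
Proof.
move=> mA; rewrite /ss_E.
have -> : (\int[gam R (L * L)]_v (\1_A v * ss_w gauss_matrix v))%R = (\int[gam R (L * L)]_v (\1_A v : R))%R.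
  by apply: eq_Rintegral => v _; rewrite /ss_w /= expr1n mev1 !mulr1.
rewrite /Rintegral integral_indic // setIT fineK //.
exact: fin_num_measure.
Qed.

Definition pos_spec (Y : 'M[R]_L) : set R := [set mu : R | 0 < mu /\ eigenvalue (aGUE Y) mu%:C].

Lemma smallest_pos_eig_ge0 (Y : 'M[R]_L) : 0 <= smallest_pos_eig Y.
Proof.
rewrite /smallest_pos_eig -/(pos_spec Y).
have [->|/set0P ne] := eqVneq (pos_spec Y) set0; first by rewrite inf0.
by apply: lb_le_inf => // mu [/ltW].
Qed.

(** The infimum of the empty set is 0, so exceeding x >= 0 includes the existence of a nonzero
    eigenvalue. By the symmetry of the spectrum the positive eigenvalues are the absolute values of
    the nonzero ones. *)
Lemma smallest_pos_eig_gt v (x : R) : 0 <= x ->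
  x < smallest_pos_eig (mx_of_vec L v) <->
  (exists j, eigs v j != 0) /\ (forall j, eigs v j != 0 -> x ^+ 2 < ys1 v j).
Proof.
move=> x0; rewrite /smallest_pos_eig -/(pos_spec _); set A := pos_spec _.
have lbA : has_lbound A by exists 0 => mu [/ltW].
have inA j : eigs v j != 0 -> A `|eigs v j|.
  move=> h; split; first by rewrite normr_gt0.
  apply/eigsP; have [e0|e0] := ger0P (eigs v j); first by exists j.
  exact: eigs_sym.
have E j : (x ^+ 2 < ys1 v j) = (x < `|eigs v j|).
  by rewrite /ys1 -[X in _ < X]real_normK ?num_real // ltr_pXn2r ?nnegrE.
split=> [h|[[j hj] h]].
  split=> [|j hj]; last by rewrite E (lt_le_trans h) // ge_inf //; exact: inA.
  have [A0|/set0P[mu [mu0 /eigsP[j hj]]]] := eqVneq A set0.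
    by move: h; rewrite A0 inf0 ltNge x0.
  by exists j; rewrite hj gt_eqF.
(* The minimum over a finite list keeps the inequality strict, which a lower bound on the infimum
   alone would not. *)
pose m := \big[Num.min/`|eigs v j|]_(i | eigs v i != 0) `|eigs v i|.
have xm : x < m.
  rewrite /m; elim/big_ind: _ => [|a b ha hb|i hi]; rewrite -?E ?h //.
  by rewrite lt_min ha hb.
apply: (lt_le_trans xm); apply: lb_le_inf; first by exists `|eigs v j|; exact: inA.
move=> mu [mu0 /eigsP[i hi]]; rewrite -hi in mu0 *.
by rewrite -[leRHS]gtr0_norm // /m bigmin_le_cond // gt_eqF.
Qed.

End GaussMatrix.

(** * The distribution function of the limit *)

Section HalfCdf.
Variables (R : realType) (k : nat).
Hypothesis k_gt0 : (0 < k)%N.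
Notation L := (2 * k)%N.
Notation S1 := (gauss_matrix R L).
Notation G := (gam R (L * L)).
Notation spe v := (smallest_pos_eig (mx_of_vec L v)).

Definition hlim (x : R) : R := \det (hmat k x) / \det (@hmat R k 0).

Definition gap_set (c : R) : set (seqspace R) := [set v | forall j : 'I_L, c < ys1 v j].

Lemma gap_setE (c : R) : \1_(gap_set c) = (fun v => [forall j, c < ss_y S1 v j]%R%:R : R).
Proof.
apply/funext => v; rewrite indicE; congr (_%:R); congr nat_of_bool.
by apply/idP/forallP => [/set_mem h j|h]; [exact: h|rewrite inE => j; exact: h].
Qed.

Lemma measurable_gap_set c : measurable (gap_set c).
Proof.
rewrite (_ : gap_set c = [set v | \1_(gap_set c) v = 1 :> R]).
  rewrite gap_setE.
  rewrite -[X in measurable X]setTI.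
  exact: (measurable_gap S1 c measurableT (@measurable_set1 R 1)).
apply/seteqP; split=> v /=; rewrite indicE; first by move=> /mem_set ->.
by case: (boolP (v \in gap_set c)) => [/set_mem //|_ /eqP]; rewrite eq_sym oner_eq0.
Qed.

Lemma gap_set_prob (x : R) : 0 <= x -> G (gap_set (x ^+ 2 / 2)) = (hlim x)%:E.
Proof.
move=> x0; rewrite ss_E_gauss_matrix; last exact: measurable_gap_set.
by rewrite gap_setE (ss_gap_transfer S1 (gauss_vandermonde R k)) gap_vandermonde.
Qed.

Lemma hlim0 : hlim 0 = 1.
Proof. by rewrite /hlim divff // det_hmat0. Qed.

(** In terms of the measurable counts: no y_j lies in (0, x^2], and not all of them are zero. *)
Lemma spe_gtE (x : R) : 0 <= x -> [set v : seqspace R | x < spe v] =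
  [set v | ss_X S1 (x ^+ 2) v - ss_X S1 0 v = 0] `&` [set v | ss_X S1 0 v < L%:R].
Proof.
move=> x0.
have c0 : 0 <= x ^+ 2 by rewrite sqr_ge0.
have y0 v j : (ss_y S1 v j <= 0) = (eigs v j == 0).
  by rewrite /= /ys1 -sqrf_eq0 eq_le sqr_ge0 andbT.
have LE : L%:R = \sum_(j < L) (1 : R) by rewrite sumr_const card_ord.
apply/seteqP; split=> v /=.
  move=> /(@smallest_pos_eig_gt R L v x x0)[[j hj] h]; split.
    rewrite /ss_X -sumrB big1 // => i _; rewrite y0.
    have [e0|e0] := eqVneq (eigs v i) 0; first by rewrite /= /ys1 e0 expr0n /= c0 subrr.
    by rewrite /= leNgt h // subr0.
  rewrite LE -subr_gt0 /ss_X -sumrB (bigD1 j) //= -/(ss_y S1 v j) y0 (negPf hj) subr0.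
  by rewrite ltr_pwDl // sumr_ge0 // => i _; case: (_ <= 0); rewrite ?subrr ?subr0.
move=> [h1 h2]; apply/(@smallest_pos_eig_gt R L v x x0); split.
  apply: contrapT => h; move: h2; rewrite LE ltNge; apply/negP/negPn.
  apply: ler_sum => j _; rewrite y0; case: eqVneq => // e0.
  by exfalso; apply: h; exists j.
move=> j hj; rewrite ltNge; apply/negP => hc; move: h1; rewrite /ss_X -sumrB => /eqP.
rewrite psumr_eq0; last first.
  move=> i _; have [h|h] := leP (ss_y S1 v i) 0; first by rewrite (le_trans h c0) subrr.
  by rewrite subr0.
by move=> /allP /(_ j (mem_index_enum j)) /=; rewrite -/(ss_y S1 v j) y0 (negPf hj) /= hc subr0 oner_eq0.
Qed.

Lemma measurable_spe_gt (x : R) : 0 <= x -> measurable [set v : seqspace R | x < spe v].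
Proof.
move=> x0; rewrite spe_gtE //; apply: measurableI.
  rewrite -[X in measurable X]setTI.
  have mB := measurable_funB (measurable_ss_X S1 (x ^+ 2)) (measurable_ss_X S1 0).
  exact: (mB measurableT _ (@measurable_set1 R 0)).
rewrite (_ : [set v | _] = setT `&` ss_X S1 0 @^-1` `]-oo, L%:R[%classic); last first.
  by apply/seteqP; split=> v /=; rewrite in_itv //=; case.
exact: (measurable_ss_X S1 0 measurableT).
Qed.

(** The two events differ only if 0 is an eigenvalue. That this is a null event comes from the
    comparison of the models: by [gap_set_prob] at level 0 the event that all y_j are positive has
    probability [hlim 0] = 1. *)
Lemma spe_gt_prob (x : R) : 0 <= x -> G [set v : seqspace R | x < spe v] = G (gap_set (x ^+ 2)).
Proof.
move=> x0; have c0 : 0 <= x ^+ 2 by rewrite sqr_ge0.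
have L0 : (0 < L)%N by rewrite muln_gt0.
have mN : measurable (~` gap_set 0 : set (seqspace R)) by apply: measurableC; exact: measurable_gap_set.
have N0 : G (~` gap_set 0) = 0%E.
  rewrite probability_setC; last exact: measurable_gap_set.
  have := gap_set_prob (lexx 0); rewrite expr0n /= mul0r hlim0 => ->.
  by rewrite -EFinB subrr.
apply/eqP; rewrite eq_le; apply/andP; split.
  rewrite -[leRHS]adde0 -N0.
  apply: le_trans (measureU2 _ _ _) => //; last exact: measurable_gap_set.
  apply: le_measure; rewrite ?inE.
  - exact: measurable_spe_gt.
  - by apply: measurableU => //; exact: measurable_gap_set.
  move=> v /= /(@smallest_pos_eig_gt R L v x x0)[_ h].
  have [hv|hv] := pselect (gap_set 0 v); last by right.
  by left => j; apply: h; have := hv j; rewrite /ys1; apply: contraTneq => ->; rewrite expr0n ltxx.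
apply: le_measure; rewrite ?inE; [exact: measurable_gap_set|exact: measurable_spe_gt|].
move=> v /= h; apply/(@smallest_pos_eig_gt R L v x x0); split=> [|j _]; last exact: h.
exists (Ordinal L0); have := h (Ordinal L0); rewrite /ys1; apply: contraTneq => ->.
by rewrite expr0n -leNgt.
Qed.

(** T / 2 <= x means T <= 2 x, and (2 x)^2 = (2 sqrt 2 x)^2 / 2 brings the level into the form
    required by [gap_set_prob]. *)
Lemma half_TFS_cdfE (x : R) : half_TFS_cdf k x =
  (if x < 0 then 0 else 1 - hlim (2 * Num.sqrt 2 * x))%:E.
Proof.
rewrite /half_TFS_cdf /gauss_mx_prob; set A := [set v | _].
have [xn|x0] := ltP x 0.
  rewrite (_ : A = set0); last first.
    apply/seteqP; split=> v //= h; move: (le_lt_trans h xn).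
    by rewrite ltNge divr_ge0 // smallest_pos_eig_ge0.
  rewrite (_ : (fun v => _) = (fun=> 0%E)); last by apply/funext => v; rewrite indic0.
  rewrite gauss_iterE //.
  by rewrite integral0.
have x20 : 0 <= 2 * x by rewrite mulr_ge0.
have AE : A = ~` [set v : seqspace R | 2 * x < spe v].
  rewrite /A; apply/seteqP; split=> v /=; rewrite ler_pdivrMr // [x * 2]mulrC leNgt.
    by move/negP.
  by move/negP.
have mA : measurable (A : set (seqspace R)).
  by rewrite AE; apply: measurableC; exact: measurable_spe_gt.
rewrite gauss_iterE.
- rewrite integral_indic // setIT AE.
  transitivity (1 - G [set v : seqspace R | (2 * x < spe v)%R])%E.
    by apply: probability_setC; exact: measurable_spe_gt.
  rewrite spe_gt_prob // (_ : (2 * x) ^+ 2 = (2 * Num.sqrt 2 * x) ^+ 2 / 2).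
    by rewrite gap_set_prob ?mulr_ge0 ?sqrtr_ge0.
  by rewrite !exprMn sqr_sqrtr //; field.
- have mI : measurable_fun setT (\1_A : seqspace R -> R) by exact: measurable_indic.
  by have h := (measurable_EFinP _ _).2 mI; exact: h.
- by move=> v; rewrite lee_fin.
Qed.

End HalfCdf.

(** * Asymptotics of the counting formula *)

Section Moments.
Variable R : realType.
Notation mu := (@lebesgue_measure R).

Lemma integral_even_annulus (F h : R -> R) (x c : R) : 0 <= x -> x < c ->
  (forall u : R, is_derive u 1 F (h u)) -> continuous h -> (forall u, h (- u) = h u) ->
  (\int[mu]_u ((x < `|u| < c)%R%:R * h u)%:E = (2 * (F c - F x))%:E)%E.
Proof.
move=> x0 xc dF ch evh.
have mh (D : set R) : measurable_fun D h.
  by apply: measurable_funTS; exact: continuous_measurable_fun.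
have mhE (D : set R) : measurable_fun D (fun u => (h u)%:E) by apply/measurable_EFinP; exact: mh.
pose D := `]x, c[%classic `|` `]- c, - x[%classic.
transitivity (\int[mu]_(u in D) (h u)%:E)%E.
  rewrite [RHS]integral_mkcond; apply: eq_integral => u _; rewrite patchE.
  have -> : (u \in D) = (x < `|u| < c).
    apply/idP/idP => [/set_mem[]|]; rewrite /= ?in_itv /=.
    - by move=> /andP[h1 h2]; rewrite ger0_norm ?h1 //; exact: (le_trans x0 (ltW h1)).
    - by move=> /andP[h1 h2]; rewrite ltr0_norm; lra.
    - move=> /andP[h1 h2]; apply/mem_set; move: h1 h2; have [u0|u0] := ger0P u => h1 h2.
        by left; rewrite /= in_itv /= h1.
      by right; rewrite /= in_itv /=; lra.
  by case: (_ < _ < _); rewrite ?mul1r ?mul0r.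
rewrite integral_setU_EFin //; last 2 first.
- exact: mh.
- apply/disj_setPS => u [] /=; rewrite !in_itv /= => /andP[h1 _] /andP[_ h2].
  by move: (lt_trans h1 h2); lra.
have dG (u : R) : is_derive u 1 (fun u => - F (- u)) (h u).
  have h0 : is_derive u 1 (fun u : R => - u) (-1).
    by have := is_deriveN (is_derive_id u (1 : R)).
  have h1 := is_deriveN (@is_derive1_comp R F (fun u => - u) u _ _ (dF (- u)) h0).
  by apply: is_derive_eq h1 _; rewrite evh mulrN1 opprK.
have IF (G : R -> R) (a b : R) : a < b -> (forall u : R, is_derive u 1 G (h u)) ->
    (\int[mu]_(u in `]a, b[) (h u)%:E = (G b - G a)%:E)%E.
  move=> ab hG; rewrite -(FTC_is_derive ab hG ch).
  exact: (esym (@integral_itv_bndoo R a b (fun u => (h u)%:E) true false (mhE _))).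
transitivity ((F c - F x)%:E + ((- F (- - x)) - (- F (- - c)))%:E)%E.
  by congr (_ + _)%E; [apply: IF|apply: (IF (fun u => - F (- u))) => //; rewrite ltrN2].
by rewrite -EFinD !opprK; congr EFin; ring.
Qed.

(** The scale sqrt(2 n): for u = [jscale] v with u fixed, (1 - v^2)^(m - k) tends to exp(- u^2 /
    2). *)
Definition jscale (k m : nat) : R := Num.sqrt (2 * (k + m)%:R).

Lemma jscale_sqr k m : jscale k m ^+ 2 = 2 * (k + m)%:R.
Proof. by rewrite sqr_sqrtr // mulr_ge0. Qed.

Definition jfun (k m d : nat) (x u : R) : R :=
  (x < `|u| < jscale k m)%R%:R * (u ^+ (2 * d) * (1 - u ^+ 2 / (2 * (k + m)%:R)) ^+ (m - k)).

Lemma integral_jfun k m d (x : R) : 0 <= x -> x < jscale k m ->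
  (\int[mu]_u (jfun k m d x u))%R =
  2 * (jscale k m ^+ (2 * d).+1 * jacmom k m d (x / jscale k m)).
Proof.
move=> x0 xc; set c := jscale k m in xc *.
have c0 : 0 < c by exact: (le_lt_trans x0 xc).
pose q := (c ^+ (2 * d).+1) *: (prim (jac R k m d) \Po (c^-1 *: 'X)).
pose h u : R := u ^+ (2 * d) * (1 - u ^+ 2 / (2 * (k + m)%:R)) ^+ (m - k).
have hE u : h u = q^`().[u].
  rewrite /q derivZ deriv_comp deriv_prim derivZ derivX /jac ?(hornerE, horner_comp) /=.
  rewrite exprSr /h -jscale_sqr -/c ?exprMn [(2 * d)%N]mulnC.
  have e1 : c ^+ (d * 2) * c^-1 ^+ (d * 2) = 1 by rewrite -exprMn divff ?expr1n // gt_eqF.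
  have e2 : c * c^-1 = 1 by rewrite divff // gt_eqF.
  rewrite -[(c ^+ 2)^-1]exprVn [u ^+ 2 * _]mulrC.
  set X := (1 - _) ^+ _; set a := c ^+ _ in e1 *; set b := c^-1 ^+ _ in e1 *; set b' := c^-1 in e2 *.
  transitivity ((a * b) * (c * b') * (u ^+ (d * 2) * X)); last by ring.
  by rewrite e1 e2 !mul1r.
have dq (u : R) : is_derive u 1 (horner q) (h u) by rewrite hE; exact: is_derive_poly.
have ch : continuous h.
  by rewrite (_ : h = horner q^`()); [exact: continuous_horner|apply/funext => u; exact: hE].
have evh u : h (- u) = h u by rewrite /h sqrrN [X in X * _]exprM [in RHS]exprM sqrrN.
rewrite /Rintegral (integral_even_annulus x0 xc dq ch evh) /=; congr (_ * _).
rewrite /q !hornerZ !horner_comp !hornerZ !hornerX /jacmom -mulrBr.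
by rewrite mulVf ?gt_eqF // [c^-1 * x]mulrC.
Qed.

Variable k : nat.

(* n = k + moffset j runs through all n > 3 k; then (m - k) / n >= 1/4. *)
Definition moffset (j : nat) : nat := (2 * k + 1 + j)%N.
Notation n_ j := (k + moffset j)%:R.

Lemma nj_gt0 j : 0 < n_ j :> R. Proof. by rewrite ltr0n /moffset; lia. Qed.

Lemma nj_inv_cvg : (n_ j)^-1 @[j --> \oo] --> (0 : R).
Proof.
apply: (squeeze_cvgr _ (cvg_cst (0 : R)) (@cvg_harmonic R)).
apply: nearW => j; rewrite invr_ge0 ler0n /= lef_pV2 ?posrE ?nj_gt0 // ler_nat /moffset; lia.
Qed.

Lemma moffset_ratio j : (moffset j - k)%N%:R / n_ j = 1 - (2 * k)%:R * (n_ j)^-1 :> R.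
Proof.
have E : (k + moffset j)%N = (moffset j - k + 2 * k)%N by rewrite /moffset; lia.
have -> : (moffset j - k)%N%:R = n_ j - (2 * k)%:R :> R by rewrite E natrD addrK.
by rewrite mulrBl divff // gt_eqF // nj_gt0.
Qed.

Lemma moffset_ratio_ge j : 4^-1 <= (moffset j - k)%N%:R / n_ j :> R.
Proof.
rewrite ler_pdivlMr ?nj_gt0 // ler_pdivrMl // -natrM ler_nat /moffset; lia.
Qed.

(** With z = y / n, squeeze by exp(- z / (1 - z)) <= 1 - z <= exp(- z), after enlarging the exponent
    n - 2 k to n for the lower bound. *)
Lemma pow_cvg_exp (y : R) : 0 <= y ->
  (1 - y / n_ j) ^+ (moffset j - k) @[j --> \oo] --> expR (- y).
Proof.
move=> y0; have ci := nj_inv_cvg.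
have up : expR (- (y * (1 - (2 * k)%:R * (n_ j)^-1))) @[j --> \oo] --> expR (- y).
  apply: continuous_cvg; first exact: continuous_expR.
  apply: cvgN; rewrite -[X in _ --> X]mulr1; apply: cvgMr.
  rewrite -[X in _ --> X]subr0 -[X in _ --> _ - X](mulr0 (2 * k)%:R).
  by apply: cvgB; [exact: cvg_cst|exact: cvgMr].
have lo : expR (- (y / (1 - y * (n_ j)^-1))) @[j --> \oo] --> expR (- y).
  apply: continuous_cvg; first exact: continuous_expR.
  apply: cvgN; rewrite -[X in _ --> X]mulr1; apply: cvgMr.
  rewrite -[X in _ --> X]invr1; apply: cvgV; first exact: oner_neq0.
  rewrite -[X in _ --> X]subr0 -[X in _ --> _ - X](mulr0 y).
  by apply: cvgB; [exact: cvg_cst|exact: cvgMr].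
apply: (squeeze_cvgr _ lo up).
near=> j.
have yn : y < n_ j.
  have : y < j.+1%:R by near: j; apply: filterS (nbhs_infty_gtr y) => i hi; rewrite (lt_trans hi) // ltr_nat.
  by move/lt_le_trans; apply; rewrite ler_nat /moffset; lia.
have z1 : y / n_ j < 1 by rewrite ltr_pdivrMr ?nj_gt0 // mul1r.
have z0 : 0 <= y / n_ j by rewrite divr_ge0 // ltW // nj_gt0.
set z := y / n_ j in z0 z1 *; apply/andP; split.
  apply: (@le_trans _ _ ((1 - z) ^+ (k + moffset j))); last first.
    by rewrite ler_wiXn2l ?subr_ge0 ?(ltW z1) ?gerBl //; rewrite /moffset; lia.
  have -> : y / (1 - z) = z / (1 - z) * n_ j.
    by rewrite /z mulrAC divfK // gt_eqF // nj_gt0.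
  rewrite -mulNr mulrC expRM_natl lerXn2r ?nnegrE ?expR_ge0 ?subr_ge0 ?(ltW z1) //.
  rewrite expRN -[leRHS]invrK lef_pV2 ?posrE ?expR_gt0 ?invr_gt0 ?subr_gt0 //.
  apply: le_trans (expR_ge1Dx _); rewrite le_eqVlt; apply/orP; left; apply/eqP.
  by field; rewrite subr_eq0 gt_eqF.
have -> : y * (1 - (2 * k)%:R / n_ j) = z * (moffset j - k)%N%:R.
  by rewrite -moffset_ratio /z mulrCA mulrC.
rewrite -[- (z * _)]mulNr [- z * _]mulrC expRM_natl lerXn2r ?nnegrE ?expR_ge0 ?subr_ge0 ?(ltW z1) //.
exact: expR_ge1Dx.
Unshelve. all: by end_near. Qed.

Definition jlim (d : nat) (x u : R) : R := (x < `|u|)%R%:R * (u ^+ (2 * d) * expR (- (u ^+ 2 / 2))).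

Lemma jfun_cvg d (x u : R) : jfun k (moffset j) d x u @[j --> \oo] --> jlim d x u.
Proof.
have h : (x < `|u|)%R%:R * (u ^+ (2 * d) * (1 - (u ^+ 2 / 2) / n_ j) ^+ (moffset j - k))
    @[j --> \oo] --> jlim d x u.
  by apply: cvgMr; apply: cvgMr; apply: pow_cvg_exp; rewrite divr_ge0 // sqr_ge0.
apply: cvg_trans h; apply: near_eq_cvg; near=> j.
have uc : `|u| < jscale k (moffset j).
  rewrite -sqrtr_sqr /jscale ltr_sqrt ?mulr_gt0 ?nj_gt0 //.
  have : u ^+ 2 < j.+1%:R.
    by near: j; apply: filterS (nbhs_infty_gtr (u ^+ 2)) => i hi; rewrite (lt_trans hi) // ltr_nat.
  move/lt_le_trans; apply; rewrite -natrM ler_nat /moffset; lia.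
by rewrite /jfun uc andbT; congr (_ * (_ * (1 - _) ^+ _)); rewrite invfM mulrA.
Unshelve. all: by end_near. Qed.

Lemma even_pow_bound (d : nat) : exists2 C : R, 0 <= C & forall u, u ^+ (2 * d) <= C * expR (16^-1 * u ^+ 2).
Proof.
have [C C0 hC] := @poly_le_exp R d 16^-1 ltac:(lra); exists C => // u.
apply: le_trans (hC u); rewrite exprM lerXn2r ?nnegrE ?sqr_ge0 ?addr_ge0 ?sqr_ge0 //.
by rewrite lerDr.
Qed.

(** From 1 - z <= exp(- z) and (m - k) / n >= 1/4 the power is at most exp(- u^2 / 8); the factor
    u^(2 d) costs exp(u^2 / 16). *)
Lemma jfun_bound (d : nat) : exists2 C : R, 0 <= C &
  forall j x u, `|jfun k (moffset j) d x u| <= C * expR (- (16^-1 * u ^+ 2)).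
Proof.
have [C C0 hC] := even_pow_bound d; exists C => // j x u; rewrite /jfun.
have r0 : 0 <= C * expR (- (16^-1 * u ^+ 2)) by rewrite mulr_ge0 ?expR_ge0.
have [/andP[_ uc]|_] := boolP (x < `|u| < jscale k (moffset j)); last by rewrite mul0r normr0.
have u2 : 0 <= u ^+ (2 * d) by rewrite exprM exprn_ge0 // sqr_ge0.
set z := u ^+ 2 / (2 * n_ j).
have n0 : 0 < 2 * n_ j :> R by rewrite mulr_gt0 ?nj_gt0.
have z1 : z < 1.
  rewrite ltr_pdivrMr // mul1r -jscale_sqr -[u ^+ 2]real_normK ?num_real //.
  by rewrite ltr_pXn2r ?nnegrE ?sqrtr_ge0.
have p0 : 0 <= (1 - z) ^+ (moffset j - k) by rewrite exprn_ge0 // subr_ge0 ltW.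
rewrite mul1r ger0_norm ?mulr_ge0 //.
have pe : (1 - z) ^+ (moffset j - k) <= expR (- (8^-1 * u ^+ 2)).
  apply: (@le_trans _ _ (expR (- z) ^+ (moffset j - k))).
    by rewrite lerXn2r ?nnegrE ?expR_ge0 ?subr_ge0 ?(ltW z1) // expR_ge1Dx.
  rewrite -expRM_natl ler_expR mulrN lerN2.
  have -> : (moffset j - k)%N%:R * z = u ^+ 2 / 2 * ((moffset j - k)%N%:R / n_ j).
    by rewrite /z invfM; ring.
  have := moffset_ratio_ge j; have := sqr_ge0 u.
  set r := _ / _; set w := u ^+ 2 => w0 hr.
  have : w / 2 * 4^-1 <= w / 2 * r by rewrite ler_wpM2l // divr_ge0.
  lra.
apply: (le_trans (ler_pM u2 p0 (hC u) pe)); rewrite -mulrA -expRD ler_wpM2l // ler_expR.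
have := sqr_ge0 u; lra.
Qed.

Lemma measurable_jfun m d x : measurable_fun setT (jfun k m d x).
Proof.
apply: measurable_funM.
  rewrite (_ : (fun u => _) = \1_(Num.norm @^-1` `]x, jscale k m[%classic)); last first.
    apply/funext => u; rewrite indicE; congr (_%:R); congr nat_of_bool.
    by apply/idP/idP => [h|/set_mem /=]; [apply/mem_set; rewrite /= in_itv|rewrite in_itv].
  apply: measurable_indic; rewrite -[X in measurable X]setTI.
  exact: (@normr_measurable R setT measurableT).
apply: measurable_funM; first exact: exprn_measurable.
apply: measurable_funX; apply: measurable_funB => //.
by apply: measurable_funM.
Qed.

Lemma integral_jfun_cvg d x :
  (\int[mu]_u (jfun k (moffset j) d x u))%R @[j --> \oo] --> (\int[mu]_u (jlim d x u))%R.
Proof.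
have [C C0 hC] := jfun_bound d.
have [||||_ h] := @Rdominated_cvg _ _ R mu (fun j => jfun k (moffset j) d x) (jlim d x)
  (fun u => C * expR (- (16^-1 * u ^+ 2))); last exact: h.
- by move=> j; exact: measurable_jfun.
- by move=> u; exact: jfun_cvg.
- have i16 : 0 < 16^-1 :> R by lra.
  have := @integrableZl _ _ _ mu setT measurableT C _ (integrable_gauss i16).
  by apply: eq_integrable.
- by move=> j u; exact: hC.
Qed.

Lemma htail_jlim d x : (\int[mu]_u (jlim d x u))%R = htail x d * (2 ^+ d / normal_peak 1).
Proof.
have pk : normal_peak 1 != 0 :> R by rewrite gt_eqF // normal_peak_gt0.
have mh := @measurable_htail_fun R x d.
have iN := integrable_htail_fun x d.
have E u : jlim d x u = (2 ^+ d / normal_peak 1) * (htail_fun x d u * normal_pdf 0 1 u).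
  rewrite normal_pdf01 /htail_fun /jlim expr_div_n -exprM mulnC.
  by field; rewrite pk expf_neq0.
have ip : mu.-integrable setT (fun u => (htail_fun x d u * normal_pdf 0 1 u)%:E).
  apply/integrableP; split.
    apply/measurable_EFinP; apply: measurable_funM => //; exact: measurable_normal_pdf.
  have -> : (\int[mu]_u `|(htail_fun x d u * normal_pdf 0 1 u)%:E| =
      \int[mu]_u (htail_fun x d u * normal_pdf 0 1 u)%:E)%E.
    apply: eq_integral => u _; rewrite abse_EFin ger0_norm // mulr_ge0 ?htail_fun_ge0 //.
    exact: normal_pdf_ge0.
  rewrite -integral_normal // ltey_eq; apply/orP; left.
  exact: integrable_fin_num.
transitivity ((2 ^+ d / normal_peak 1) * (\int[mu]_u (htail_fun x d u * normal_pdf 0 1 u))%R).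
  rewrite -RintegralZl //; apply: eq_Rintegral => u _; exact: E.
by rewrite mulrC /htail /Rintegral integral_normal.
Qed.

Lemma jacmom_cvg d x : 0 <= x ->
  2 * (jscale k (moffset j) ^+ (2 * d).+1 * jacmom k (moffset j) d (x / jscale k (moffset j)))
    @[j --> \oo] --> htail x d * (2 ^+ d / normal_peak 1).
Proof.
move=> x0; rewrite -htail_jlim; apply: cvg_trans (@integral_jfun_cvg d x).
apply: near_eq_cvg; near=> j; apply: integral_jfun => //.
rewrite -[x]ger0_norm // -sqrtr_sqr /jscale ltr_sqrt ?mulr_gt0 ?nj_gt0 //.
have : x ^+ 2 < j.+1%:R.
  by near: j; apply: filterS (nbhs_infty_gtr (x ^+ 2)) => i hi; rewrite (lt_trans hi) // ltr_nat.
move/lt_le_trans; apply; rewrite -natrM ler_nat /moffset; lia.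
Unshelve. all: by end_near. Qed.

Lemma det_scale (a b : 'I_k -> R) (M : 'M[R]_k) :
  \det (\matrix_(i, l) (a i * b l * M i l)) = (\prod_i a i) * (\prod_i b i) * \det M.
Proof.
have -> : \matrix_(i, l) (a i * b l * M i l) =
    diag_mx (\row_i a i) *m M *m diag_mx (\row_i b i).
  by apply/matrixP => i l; rewrite mul_diag_mx mul_mx_diag !mxE mulrAC.
rewrite !det_mulmx !det_diag; under eq_bigr do rewrite mxE.
by under [X in _ * _ * X]eq_bigr do rewrite mxE; rewrite mulrAC.
Qed.

(** With c = [jscale], entry (i, l) needs the factor 2 c^(2 (i + l) + 1) to converge. It splits into
    a row and a column factor, so it cancels in the ratio of determinants, and so do the constants
    of [htail_jlim] in the limit. *)
Lemma jachankel_cvg x : 0 <= x ->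
  \det (jachankel k (moffset j) (x / jscale k (moffset j))) /
    \det (jachankel k (moffset j) (0 : R)) @[j --> \oo] --> hlim k x.
Proof.
move=> x0.
pose a0 i : R := 2 ^+ i / normal_peak 1; pose b0 i : R := 2 ^+ i.
pose a j i : R := 2 * jscale k (moffset j) * jscale k (moffset j) ^+ (2 * i).
pose b j i : R := jscale k (moffset j) ^+ (2 * i).
pose P j : R := (\prod_(i < k) a j i) * \prod_(i < k) b j i.
pose P0 : R := (\prod_(i < k) a0 i) * \prod_(i < k) b0 i.
have pk : normal_peak 1 != 0 :> R by rewrite gt_eqF // normal_peak_gt0.
have js0 j : jscale k (moffset j) != 0 by rewrite gt_eqF // sqrtr_gt0 mulr_gt0 ?nj_gt0.
have two0 : 2 != 0 :> R by [].
have P00 : P0 != 0.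
  apply: mulf_neq0; apply/prodf_neq0 => i _; last by rewrite expf_neq0.
  by rewrite /a0; apply: mulf_neq0; [exact: expf_neq0|exact: invr_neq0].
have Pj0 j : P j != 0.
  apply: mulf_neq0; apply/prodf_neq0 => i _; last by rewrite expf_neq0.
  by rewrite /a; apply: mulf_neq0; [exact: mulf_neq0|exact: expf_neq0].
have key z : 0 <= z -> P j * \det (jachankel k (moffset j) (z / jscale k (moffset j)))
    @[j --> \oo] --> P0 * \det (hmat k z).
  move=> z0; rewrite -det_scale (_ : (fun j => _) = (fun j => \det (\matrix_(i < k, l < k)
    (a j i * b j l * jachankel k (moffset j) (z / jscale k (moffset j)) i l)))); last first.
    by apply/funext => j; rewrite det_scale.
  apply: cvg_sumr => s; apply: cvgMr; apply: cvg_prodr => i; rewrite !mxE.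
  under eq_fun do rewrite !mxE.
  have := @jacmom_cvg (i + s i) z z0.
  have -> : htail z (i + s i) * (2 ^+ (i + s i) / normal_peak 1) = a0 i * b0 (s i) * htail z (i + s i).
    by rewrite /a0 /b0 exprD; ring.
  suff -> : (fun j => 2 * (jscale k (moffset j) ^+ (2 * (i + s i)).+1 *
       jacmom k (moffset j) (i + s i) (z / jscale k (moffset j)))) =
     (fun j => a j i * b j (s i) * jacmom k (moffset j) (i + s i) (z / jscale k (moffset j))) by [].
  by apply/funext => j; rewrite /a /b mulnDr -addnS exprD exprSr; ring.
have -> : hlim k x = (P0 * \det (hmat k x)) / (P0 * \det (@hmat R k 0)).
  by rewrite /hlim -mulf_div divff ?mul1r.
rewrite (_ : (fun j => _) = (fun j => (P j * \det (jachankel k (moffset j) (x / jscale k (moffset j)))) /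
  (P j * \det (jachankel k (moffset j) (0 / jscale k (moffset j)))))); last first.
  by apply/funext => j; rewrite -mulf_div divff ?mul1r // mul0r.
apply: cvgM; first exact: key.
by apply: cvgV; [rewrite mulf_neq0 ?det_hmat0|exact: key].
Qed.

End Moments.

(** * From binomial mixtures to a fixed time *)

Section Depoissonization.
Variable R : realType.
Variables (N : nat) (t G X d : R) (F : nat -> R).
Hypotheses (t01 : 0 <= t <= 1) (d0 : 0 < d) (F01 : forall q, 0 <= F q <= 1) (G01 : 0 <= G <= 1).

(** From X on, F is at most G; the binomial variable falls below X only by deviating from its mean
    by at least d, where F <= 1 suffices. *)
Lemma binl_mean_le : (forall q, X <= q%:R -> F q <= G) -> X + d <= N%:R * t ->
  \sum_(q < N.+1) binl N q t * F q <= G + N%:R / d ^+ 2.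
Proof.
move=> FG Xd; pose A := fun q : nat => q%:R < X.
apply: (@le_trans _ _ (\sum_(q < N.+1) binl N q t * G + \sum_(q < N.+1 | A q) binl N q t)).
  rewrite [X in _ <= _ + X]big_mkcond -big_split /=; apply: ler_sum => q _.
  have b0 := @binl_ge0 R N q _ t01; have /andP[F0 F1] := F01 q; move/andP: G01 => [G0 G1].
  rewrite /A; case: ltP => h; last by rewrite addr0 ler_wpM2l // FG.
  by rewrite -[leLHS]add0r; apply: lerD; [exact: mulr_ge0|exact: ler_piMr].
rewrite -mulr_suml binl_sum1 mul1r lerD2l; apply: binl_chebyshev => // q; rewrite /A => h.
by rewrite distrC ler_normr; apply/orP; left; lra.
Qed.

Lemma binl_mean_ge : (forall q, q%:R <= X -> G <= F q) -> N%:R * t + d <= X ->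
  G <= \sum_(q < N.+1) binl N q t * F q + N%:R / d ^+ 2.
Proof.
move=> FG Xd; pose A := fun q : nat => X < q%:R.
apply: (@le_trans _ _ (\sum_(q < N.+1) binl N q t * F q + \sum_(q < N.+1 | A q) binl N q t)).
  rewrite -[leLHS]mul1r -(binl_sum1 N t) mulr_suml [X in _ <= _ + X]big_mkcond -big_split /=.
  apply: ler_sum => q _.
  have b0 := @binl_ge0 R N q _ t01; have /andP[F0 F1] := F01 q; move/andP: G01 => [G0 G1].
  rewrite /A; case: ltP => h; last by rewrite addr0 ler_wpM2l // FG.
  by rewrite -[leLHS]add0r; apply: lerD; [exact: mulr_ge0|exact: ler_piMr].
rewrite lerD2l; apply: binl_chebyshev => // q; rewrite /A => h.
by rewrite ler_normr; apply/orP; left; lra.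
Qed.

End Depoissonization.

Section Survival.
Variables (R : realType) (k : nat).
Hypothesis k_gt0 : (0 < k)%N.

(** [first_swap_time] is [index] plus 1, so this is the probability that the time exceeds q; [survR]
    is its version at real levels. *)
Definition surv (n q : nat) : R := (Cnt n k q)%:R / #|Omega n|%:R.

Definition survR (n : nat) (X : R) : R :=
  #|[set s in Omega n | X < (first_swap_time k s)%:R]%SET|%:R / #|Omega n|%:R.

Lemma omega_pos n : 0 < #|Omega n|%:R :> R.
Proof. by rewrite ltr0n Omega_gt0. Qed.

Lemma frac01 n (A : {set 'C(n, 2).-tuple 'I_n}) : A \subset Omega n ->
  0 <= (#|A|%:R / #|Omega n|%:R : R) <= 1.
Proof.
move=> sA; rewrite divr_ge0 //= ler_pdivrMr ?omega_pos // mul1r ler_nat.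
exact: subset_leq_card.
Qed.

Lemma surv01 n q : 0 <= surv n q <= 1.
Proof. by rewrite /surv /survR; apply: frac01; apply/fintype.subsetP => s; rewrite inE => /andP[]. Qed.

Lemma survR01 n X : 0 <= survR n X <= 1.
Proof. by rewrite /surv /survR; apply: frac01; apply/fintype.subsetP => s; rewrite inE => /andP[]. Qed.

Lemma surv_le n q X : X <= q%:R -> surv n q <= survR n X.
Proof.
move=> h; rewrite ler_wpM2r ?invr_ge0 // ler_nat; apply: subset_leq_card.
apply/fintype.subsetP => s; rewrite !inE => /andP[-> hs] /=.
by rewrite (le_lt_trans h) // ltr_nat ltnS.
Qed.

Lemma surv_ge n q X : q%:R <= X -> survR n X <= surv n q.
Proof.
move=> h; rewrite ler_wpM2r ?invr_ge0 // ler_nat; apply: subset_leq_card.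
apply/fintype.subsetP => s; rewrite !inE => /andP[-> hs] /=.
by move: (le_lt_trans h hs); rewrite ltr_nat ltnS.
Qed.

Lemma TFSn_cdf_survR n x : (0 < n)%N -> TFSn_cdf k n x = 1 - survR n (x * n%:R `^ (3/2 : R)).
Proof.
move=> n0; have p0 : 0 < n%:R `^ (3/2 : R) :> R by rewrite powR_gt0 // ltr0n.
rewrite -[X in _ = X - _](divff (lt0r_neq0 (omega_pos n))) /TFSn_cdf /survR -mulrBl; congr (_ / _).
apply/eqP; rewrite -subr_eq opprK -natrD; apply/eqP; congr (_%:R).
rewrite -[RHS](cardsID [set s : 'C(n, 2).-tuple 'I_n | (first_swap_time k s)%:R / (n%:R `^ (3/2 : R)) <= x]%SET).
congr (_ + _)%N; apply: eq_card => s; rewrite !inE //.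
by rewrite ler_pdivrMr // -ltNge andbC.
Qed.

(** The unknown constant is eliminated at t = 0, where the binomial law is concentrated at q = 0 and
    every network qualifies. The same identity shows that the denominator is nonzero. *)
Lemma binl_mean_surv j (t : R) : let m := moffset k j in
  \sum_(q < 'C(k + m, 2).+1) binl 'C(k + m, 2) q t * surv (k + m) q =
  \det (jachankel k m t) / \det (jachankel k m (0 : R)).
Proof.
move=> m; have km : (0 < k <= m)%N by rewrite k_gt0 /m /moffset; lia.
have [C hC] := Cnt_jachankel R km.
have E (s : R) : \sum_(q < 'C(k + m, 2).+1) binl 'C(k + m, 2) q s * surv (k + m) q =
    C * \det (jachankel k m s) / #|Omega (k + m)|%:R.
  by rewrite -hC mulr_suml; apply: eq_bigr => q _; rewrite /surv /binl mulrA.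
have C1 : C * \det (jachankel k m (0 : R)) / #|Omega (k + m)|%:R = 1.
  rewrite -E big_ord_recl big1 => [|q _]; last first.
    by rewrite /binl /= /bump add1n exprS mul0r mulr0 !mul0r.
  rewrite addr0 /binl bin0 expr0 !mul1r subr0 expr1n mul1r /surv /Cnt.
  rewrite (_ : [set s in Omega (k + m) | _]%SET = Omega (k + m)) ?divff //.
    by rewrite gt_eqF // omega_pos.
  by apply/finset.setP => s; rewrite !inE andbT.
have D0 : \det (jachankel k m (0 : R)) != 0.
  by apply/negP => /eqP h; move/eqP: C1; rewrite h mulr0 mul0r eq_sym oner_eq0.
rewrite E -[RHS]mul1r -[X in _ = X * _]C1; field; rewrite D0 gt_eqF //; exact: omega_pos.
Qed.

End Survival.

Section Limit.
Variables (R : realType) (k : nat).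
Hypothesis k_gt0 : (0 < k)%N.
Notation nn j := (k + moffset k j)%N.
Notation rt j := (Num.sqrt (nn j)%:R : R).

Lemma rt_sqr j : rt j ^+ 2 = (nn j)%:R.
Proof. by rewrite sqr_sqrtr. Qed.

Lemma rt_gt0 j : 0 < rt j.
Proof. by rewrite sqrtr_gt0 nj_gt0. Qed.

Lemma pow32 j : (nn j)%:R `^ (3/2 : R) = (nn j)%:R * rt j.
Proof.
have -> : 3/2 = 1 + 2^-1 :> R by lra.
rewrite powRD; last by rewrite (gt_eqF (nj_gt0 _ k j)) implybT.
by rewrite powRr1 ?powR12_sqrt.
Qed.

Lemma bin2R n : 2 * 'C(n, 2)%:R = n%:R * (n%:R - 1) :> R.
Proof.
have := bin_ffact n 2; rewrite ffactnS ffactn1 mulnC => /(congr1 (fun i => i%:R : R)).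
by rewrite !natrM => ->; case: n => [|n]; rewrite ?mul0r //= -natr1 addrK.
Qed.

(** Chosen to make the binomial mean close to z n^(3/2): it is z sqrt n (n - 1). *)
Definition tz (z : R) j : R := 2 * Num.sqrt 2 * z / jscale R k (moffset k j).

Lemma tzE z j : tz z j = 2 * z / rt j.
Proof.
have s2 : Num.sqrt 2 != 0 :> R by rewrite gt_eqF // sqrtr_gt0.
rewrite /tz /jscale sqrtrM //; field.
by rewrite s2 gt_eqF // rt_gt0.
Qed.

Lemma mean_tz z j : 'C(nn j, 2)%:R * tz z j = z * rt j * ((nn j)%:R - 1).
Proof.
have r0 : rt j != 0 by rewrite gt_eqF // rt_gt0.
rewrite tzE; transitivity (2 * 'C(nn j, 2)%:R * (z / rt j)); first by ring.
rewrite bin2R -[X in X * (_ - _) * _]rt_sqr.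
by move: r0; move: (rt j) => r r0; field.
Qed.

Lemma cheb_error e j : 0 < e ->
  'C(nn j, 2)%:R / (e * ((nn j)%:R * rt j)) ^+ 2 <= (e ^+ 2)^-1 * (nn j)%:R^-1 :> R.
Proof.
move=> e0; have n0 := nj_gt0 R k j; have r0 := rt_gt0 j.
have hN : 'C(nn j, 2)%:R <= (nn j)%:R ^+ 2 :> R.
  by have := bin2R (nn j); have : 0 <= 'C(nn j, 2)%:R :> R by []; rewrite expr2; move: n0; nra.
rewrite !exprMn rt_sqr ler_pdivrMr; last by rewrite !mulr_gt0 // exprn_gt0.
apply: (le_trans hN); rewrite le_eqVlt; apply/orP; left; apply/eqP.
move: n0; move: (nn j)%:R => n n0; field.
by rewrite !gt_eqF.
Qed.

Definition pmean (z : R) j : R :=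
  \sum_(q < 'C(nn j, 2).+1) binl 'C(nn j, 2) q (tz z j) * surv R k (nn j) q.

Definition hz (z : R) : R := hlim k (2 * Num.sqrt 2 * z).

Lemma pmean_cvg z : 0 <= z -> pmean z j @[j --> \oo] --> hz z.
Proof.
move=> z0; have h : 0 <= 2 * Num.sqrt 2 * z by rewrite !mulr_ge0 ?sqrtr_ge0.
rewrite (_ : pmean z = fun j => \det (jachankel k (moffset k j) (tz z j)) /
  \det (jachankel k (moffset k j) (0 : R))); first exact: jachankel_cvg.
by apply/funext => j; rewrite /pmean binl_mean_surv.
Qed.

Definition gsurv (x : R) j : R := survR k (nn j) (x * (nn j)%:R `^ (3/2 : R)).

Lemma cheb_cvg (e : R) : (e ^+ 2)^-1 * (nn j)%:R^-1 @[j --> \oo] --> (0 : R).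
Proof. by rewrite -[X in _ --> X](mulr0 (e ^+ 2)^-1); apply: cvgMr; exact: nj_inv_cvg. Qed.

Lemma nn_near (a : R) : \forall j \near \oo, a <= (nn j)%:R.
Proof.
apply: filterS (nbhs_infty_ger a) => j hj; rewrite (le_trans hj) // ler_nat /moffset; lia.
Qed.

Lemma tz01_near z : 0 <= z -> \forall j \near \oo, 0 <= tz z j <= 1.
Proof.
move=> z0; apply: filterS (nn_near ((2 * z) ^+ 2)) => j hj.
have r0 := rt_gt0 j; rewrite tzE divr_ge0 ?mulr_ge0 ?(ltW r0) //= ler_pdivrMr // mul1r.
by rewrite -[leLHS]ger0_norm ?mulr_ge0 // -sqrtr_sqr ler_sqrt.
Qed.

(** The mean falls short of z n^(3/2) by z sqrt n. Half of the gap z - x is kept to absorb this for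
    large n, the other half is the deviation d. In the opposite bound the defect has the favourable
    sign, and the full gap can be used. *)
Lemma gsurv_ge x z : 0 <= x -> x < z ->
  \forall j \near \oo, pmean z j <= gsurv x j + (((z - x) / 2) ^+ 2)^-1 * (nn j)%:R^-1.
Proof.
move=> x0 xz; have z0 : 0 <= z by lra.
have e0 : 0 < (z - x) / 2 by lra.
near=> j.
have n0 := nj_gt0 R k j; have r0 := rt_gt0 j.
have d0 : 0 < (z - x) / 2 * ((nn j)%:R * rt j) by apply: mulr_gt0 => //; apply: mulr_gt0.
apply: le_trans (lerD (lexx _) (cheb_error j e0)).
apply: (@binl_mean_le R 'C(nn j, 2) (tz z j) (gsurv x j) (x * (nn j)%:R `^ (3/2 : R)) _ (surv R k (nn j))) => //.
- by near: j; exact: tz01_near.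
- exact: surv01.
- exact: survR01.
- by move=> q; exact: surv_le.
have nz : z / ((z - x) / 2) <= (nn j)%:R by near: j; exact: nn_near.
move: nz; rewrite ler_pdivrMr // mean_tz pow32 => nz.
have : rt j * z <= rt j * ((nn j)%:R * ((z - x) / 2)) by rewrite ler_wpM2l // ltW.
move: (nn j)%:R (rt j) => n r; nra.
Unshelve. all: by end_near. Qed.

Lemma gsurv_le x z : 0 <= z -> z < x ->
  \forall j \near \oo, gsurv x j <= pmean z j + ((x - z) ^+ 2)^-1 * (nn j)%:R^-1.
Proof.
move=> z0 zx; have e0 : 0 < x - z by lra.
near=> j.
have n0 := nj_gt0 R k j; have r0 := rt_gt0 j.
have d0 : 0 < (x - z) * ((nn j)%:R * rt j) by apply: mulr_gt0 => //; apply: mulr_gt0.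
apply: le_trans (lerD (lexx _) (cheb_error j e0)).
apply: (@binl_mean_ge R 'C(nn j, 2) (tz z j) (gsurv x j) (x * (nn j)%:R `^ (3/2 : R)) _ (surv R k (nn j))) => //.
- by near: j; exact: tz01_near.
- exact: surv01.
- exact: survR01.
- by move=> q; exact: surv_ge.
rewrite mean_tz pow32.
have : 0 <= z * rt j by rewrite mulr_ge0 // ltW.
move: (nn j)%:R (rt j) => n r; nra.
Unshelve. all: by end_near. Qed.

(** Survival is squeezed between binomial means at parameters on either side of x, within the radius
    given by continuity. At x = 0 there is no room on the left; there survival is at most 1 =
    [hz 0]. *)
Lemma gsurv_cvg x : 0 <= x -> hz 0 = 1 ->
  (forall e, 0 < e -> exists2 r, 0 < r & forall z, 0 <= z -> `|z - x| < r -> `|hz x - hz z| < e) ->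
  gsurv x j @[j --> \oo] --> hz x.
Proof.
move=> x0 h0 ch; apply/cvgrPdist_lt => e e0.
have e3 : 0 < e / 3 by lra.
have [r r0 hr] := ch _ e3.
have lower : \forall j \near \oo, hz x - gsurv x j < e.
  have z0 : 0 <= x + r / 2 by lra.
  have hh := hr (x + r / 2) z0 ltac:(rewrite addrAC subrr add0r gtr0_norm; lra).
  near=> j.
  have h1 : pmean (x + r / 2) j <= gsurv x j + (((x + r / 2 - x) / 2) ^+ 2)^-1 * (nn j)%:R^-1.
    by near: j; apply: gsurv_ge; lra.
  have h2 : `|hz (x + r / 2) - pmean (x + r / 2) j| < e / 3.
    by near: j; move/cvgrPdist_lt: (@pmean_cvg (x + r / 2) z0); apply.
  have h3 : `|0 - (((x + r / 2 - x) / 2) ^+ 2)^-1 * (nn j)%:R^-1| < e / 3.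
    by near: j; move/cvgrPdist_lt: (@cheb_cvg ((x + r / 2 - x) / 2)); apply.
  move: (hh) (h2) (h3); rewrite !ltr_norml => /andP[? ?] /andP[? ?] /andP[? ?]; lra.
have upper : \forall j \near \oo, gsurv x j - hz x < e.
  move: x0; rewrite le_eqVlt => /orP[/eqP x0|x0].
    apply: nearW => j; rewrite -x0 h0; have /andP[_ h] := @survR01 R k (nn j) (0 * (nn j)%:R `^ (3/2 : R)).
    by rewrite (le_lt_trans _ e0) // subr_le0.
  pose z := Num.max 0 (x - r / 2).
  have zx : z < x by rewrite gt_max x0 /=; lra.
  have z0 : 0 <= z by rewrite le_max lexx.
  have zr : x - r / 2 <= z by rewrite le_max lexx orbT.
  have hh := hr z z0 ltac:(rewrite ltr_norml; lra).
  near=> j.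
  have h1 : gsurv x j <= pmean z j + ((x - z) ^+ 2)^-1 * (nn j)%:R^-1.
    by near: j; apply: gsurv_le.
  have h2 : `|hz z - pmean z j| < e / 3.
    by near: j; move/cvgrPdist_lt: (@pmean_cvg z z0); apply.
  have h3 : `|0 - ((x - z) ^+ 2)^-1 * (nn j)%:R^-1| < e / 3.
    by near: j; move/cvgrPdist_lt: (@cheb_cvg (x - z)); apply.
  move: (hh) (h2) (h3); rewrite !ltr_norml => /andP[? ?] /andP[? ?] /andP[? ?]; lra.
near=> j; rewrite ltr_norml; apply/andP; split.
  rewrite -opprB ltrN2; near: j; exact: upper.
near: j; exact: lower.
Unshelve. all: by end_near. Qed.

End Limit.

(* Convergence in distribution: the CDFs of T_{FS,n}(k)/n^{3/2} converge to
   the CDF of T_FS(k)/2 at every continuity point of the latter. *)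
Theorem theorem1p5 (R : realType) (k : nat) (hk : (1 <= k)%N) :
  forall x : R,
    {for x, continuous (fun y : R => fine (half_TFS_cdf k y))} ->
    (fun n : nat => (TFSn_cdf k n x)%:E) @ \oo --> half_TFS_cdf k x.
Proof.
move=> x cx; have [xn|x0] := ltP x 0.
  rewrite half_TFS_cdfE // xn (_ : (fun n => _) = (fun=> 0%E)); first exact: cvg_cst.
  apply/funext => n; congr EFin; rewrite /TFSn_cdf (_ : [set s in Omega n | _]%SET = finset.set0).
    by rewrite cards0 mul0r.
  apply/finset.setP => s; rewrite !inE; apply/negbTE/negP => /andP[_ h].
  by move: (le_lt_trans h xn); rewrite ltNge divr_ge0 // powR_ge0.
have hE z : 0 <= z -> fine (half_TFS_cdf k z) = 1 - hz k z.
  by move=> z0; rewrite half_TFS_cdfE // ltNge z0.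
have cg : gsurv k x j @[j --> \oo] --> hz k x.
  apply: gsurv_cvg => //; first by rewrite /hz mulr0 hlim0.
  move=> e e0; have /cvgrPdist_lt /(_ e e0) /nbhs_ballP[r /= r0 hr] := cx.
  exists r => // z z0 zr.
  have := hr z; rewrite /ball /= distrC => /(_ zr); rewrite !hE // => h.
  have -> : hz k x - hz k z = - (1 - hz k x - (1 - hz k z)) by ring.
  by rewrite normrN.
(* The asymptotics are indexed by n = k + [moffset k j], which starts at 3 k + 1. *)
rewrite half_TFS_cdfE // ltNge x0 /= -(cvg_shiftn (3 * k + 1)).
apply: cvg_EFin; first exact: nearW.
rewrite (_ : _ \o _ = fun j => 1 - gsurv k x j); first by apply: cvgB => //; exact: cvg_cst.
apply/funext => j /=; rewrite (_ : (j + (3 * k + 1))%N = (k + moffset k j)%N); last by rewrite /moffset; lia.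
by rewrite TFSn_cdf_survR // /moffset; lia.
Qed.
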